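(* There exist positive constants $\tau_0$ and $x_0$ such that $F(x,\tau)<0$ for all $(x,\tau)$ in the set $X=\{(x,\tau)\in\mathbb{R}^2:\ x_0<x<\tau_0/\tau\}$.
   Context: $\zeta$ is the Riemann zeta function and $\xi(s)=s(s-1)\pi^{-s/2}\Gamma(s/2)\zeta(s)$ (entire). For real $x$ and real $\tau\neq0$ define $$F(x,\tau)=\frac{1}{\tau}\sum_{\rho}\left[1-\left(\frac{\rho}{\rho-\tau}\right)^{x}\right],$$ where $\rho$ runs over the nontrivial zeros of $\zeta$ (with multiplicity), terms for $\rho$ and $1-\rho$ being paired together, and the power is taken with the principal branch. (For positive integers $n$, $F(n,\tau)=\frac{1}{(n-1)!}\frac{d^{n}}{ds^{n}}[s^{n-1}\log\xi(s)]|_{s=\tau}$.) *)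

(* Defs.v *)
From HB Require Import structures.
From mathcomp Require Import all_boot all_order all_algebra.
From mathcomp Require Import finmap.
From mathcomp Require Import all_classical all_reals all_analysis.
From mathcomp.real_closed Require Import complex.

Set Implicit Arguments.
Unset Strict Implicit.
Unset Printing Implicit Defensive.

Import Order.TTheory GRing.Theory Num.Theory.
Import numFieldNormedType.Exports.

Local Open Scope classical_set_scope.
Local Open Scope ring_scope.
Local Open Scope complex_scope.

Section ComplexPower.
Variable R : realType.
Implicit Types z s : R[i].

Definition cexp z : R[i] :=
  (expR (complex.Re z) * cos (complex.Im z)) +i*
  (expR (complex.Re z) * sin (complex.Im z)).

Definition cabs z : R := Num.sqrt (complex.Re z ^+ 2 + complex.Im z ^+ 2).

(* Principal argument, with values in ]-pi, pi] for z != 0. *)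
Definition carg z : R :=
  let t := acos (complex.Re z / cabs z) in
  if 0 <= complex.Im z then t else - t.

Definition clog z : R[i] := ln (cabs z) +i* carg z.

Definition cpow z s : R[i] :=
  if z == 0 then (s == 0)%:R else cexp (s * clog z).

End ComplexPower.

Section Zeta.
Variable R : realType.

(* The regular algebra R[i]^o is R[i] as a normed space over itself, so that
   [derivable f s 1], for f : C -> C, is complex differentiability at s. *)
Local Notation C := R[i]^o.

Implicit Types (f g : C -> C) (s z : C).

Definition is_riemann_zeta f : Prop :=
  (forall s, s != 1 -> derivable f s 1) /\
  (forall s, 1 < complex.Re s ->
     series (fun n => cpow n.+1%:R (- s)) @ \oo --> f s).

(* The analytic continuation; its value at the pole 1 is unspecified. *)
Definition zeta : C -> C := get [set f | is_riemann_zeta f].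

Definition nontrivial_zero z : Prop :=
  [/\ z != 1, zeta z = 0 & forall n : nat, z != - (2 * n.+1)%:R].

Definition has_order f z (m : nat) : Prop :=
  exists g, [/\ \forall s \near z, derivable g s 1, g z != 0
              & \forall s \near z, f s = (s - z) ^+ m * g s].

Definition multiplicity z : nat := get [set m | has_order zeta z m].

Definition paired (A : {fset C}) : Prop :=
  forall z, z \in A -> nontrivial_zero z /\ 1 - z \in A.

(* Pairing the terms for z and 1 - z in an otherwise unordered sum amounts to
   taking the limit of the finite partial sums only along those finite sets of
   zeros that are stable under z |-> 1 - z, directed by inclusion. *)
Definition paired_sets : set_system {fset C} :=
  filter_from paired (fun A => [set B | paired B /\ (A `<=` B)%fset]).

(* This is 0 when the limit does not exist. *)
Definition sum_over_zeros f : C :=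
  lim ((fun A : {fset C} => \sum_(z <- A) f z *+ multiplicity z)
         @ paired_sets).

(* Real-valued in the paper; here it takes values in R[i], where w < 0 means
   that w is real and negative. *)
Definition F (x tau : R) : C :=
  tau%:C^-1 *
  sum_over_zeros (fun z => 1 - cpow (z / (z - tau%:C)) x%:C).

End Zeta.

(* Main.v *)
(* Polya's evaluation of a binomial row modulo an odd number gives, in the limit, the functional
   equation of theta. Its Mellin transform expresses [xi] as
   [1 + s (s - 1) \sum_k c_k (s - 1/2)^(2 k)] with [c_k >= 0] and [c_0 > 0]; hence [xi] is entire,
   invariant under [s |-> 1 - s], without zeros on the real line outside the open interval (0, 1),
   and [xi 1 = 1], [xi' 1 > 0]. Estimating the [c_k] gives order of growth at most 3/2, and dividing
   out zeros turns this into the convergence of [\sum 1 / |rho|^2]. Borel-Caratheodory, applied to a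
   logarithm of [xi] divided by its zeros of modulus at most [4 ^ j], identifies [\sum 1 / rho] with
   [k = xi' 1]. Finally put [a = x tau]: when [a] is small compared with every [|rho|], each term is
   [- a / rho + O (a^2 / |rho|^2)] uniformly, so that [tau F (x, tau) = - a k + O (a^2)] is negative.
   The inequality [1 < x < tau0 / tau] forces [tau > 0]. *)

Require Import Defs.
From HB Require Import structures.
From mathcomp Require Import all_boot all_order all_algebra.
From mathcomp Require Import finmap.
From mathcomp Require Import all_classical all_reals all_analysis.
From mathcomp.real_closed Require Import complex.
From mathcomp Require Import measurable_realfun.
From mathcomp Require Import ring lra zify.
Import Order.TTheory GRing.Theory Num.Theory.
Import numFieldNormedType.Exports.
Set Implicit Arguments.
Unset Strict Implicit.
Unset Printing Implicit Defensive.
Local Open Scope classical_set_scope.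
Local Open Scope ring_scope.
Local Open Scope complex_scope.

(** * Complex derivatives, limits and series *)

Section ComplexBasics.
Context {R : realType}.
Local Notation C := R[i].
Implicit Types (z w l : C).

(** [zeta] is an unspecified choice among the functions satisfying [is_riemann_zeta]; an explicit
    one, [rzeta], has to be built and the choice shown to be determined off 1 before its zeros and
    multiplicities become those of [xi]. Discs of radius [4 ^ j] fix the scale: there [log |xi|] is
    [O(8 ^ j)]. Since the order bound exceeds 1, the estimate [8 ^ j / 4 ^ j] for a single
    logarithmic derivative of the quotient of [xi] by its zeros is useless. A second-order estimate
    gives [8 ^ j / 16 ^ j = 2 ^- j], and the invariance of [xi] makes it sufficient: the logarithmic
    derivatives of [xi] at 0 and 1 are opposite, so their difference already determines the sum of
    [1 / rho]. That sum is controlled only through pairing, which replaces [1 / rho] by half of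
    [1 / (rho (1 - rho))]. The thresholds come from a disc around 1, hence one around 0, free of
    zeros, and from comparing the main term with the quadratic error. Integrals along curves are
    limits of dyadic Riemann sums, so that exchanges of integrals are exchanges of finite sums. *)

Lemma norm_cabs z : `|z| = (cabs z)%:C.
Proof. exact: normc_def. Qed.

Lemma cabs_def z : cabs z = complex.Re `|z|.
Proof. by rewrite norm_cabs. Qed.

Lemma cabs_ge0 z : 0 <= cabs z. Proof. exact: sqrtr_ge0. Qed.
Hint Resolve cabs_ge0 : core.

Lemma cabsM z w : cabs (z * w) = cabs z * cabs w.
Proof.
by apply: (@complexI R); rewrite rmorphM/= -!norm_cabs normrM.
Qed.

Lemma cabsD z w : cabs (z + w) <= cabs z + cabs w.
Proof. by rewrite -lecR rmorphD/= -!norm_cabs ler_normD. Qed.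

Lemma cabsN z : cabs (- z) = cabs z.
Proof. by rewrite !cabs_def normrN. Qed.

Lemma cabsB z w : cabs (z - w) <= cabs z + cabs w.
Proof. by rewrite -(cabsN w) cabsD. Qed.

Lemma cabs_subC z w : cabs (z - w) = cabs (w - z).
Proof. by rewrite -cabsN opprB. Qed.

Lemma cabs_lerB z w : cabs z - cabs w <= cabs (z - w).
Proof. by rewrite lerBlDr -{1}(subrK w z) cabsD. Qed.

Lemma cabs_eq0 z : (cabs z == 0) = (z == 0).
Proof. by rewrite -(inj_eq (@complexI R)) -norm_cabs normr_eq0. Qed.

Lemma cabs0 : cabs (0 : C) = 0.
Proof. by apply/eqP; rewrite cabs_eq0. Qed.

Lemma cabs_gt0 z : (0 < cabs z) = (z != 0).
Proof. by rewrite lt_def cabs_eq0 cabs_ge0 andbT. Qed.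

Lemma cabs_real (x : R) : cabs (x%:C : C) = `|x|.
Proof. by rewrite /cabs/= expr0n/= addr0 sqrtr_sqr. Qed.

Lemma cabs1 : cabs (1 : C) = 1.
Proof. by have := cabs_real 1; rewrite normr1. Qed.

Lemma cabsX z n : cabs (z ^+ n) = cabs z ^+ n.
Proof.
by elim: n => [|n IH]; rewrite ?expr0 ?cabs1// !exprS cabsM IH.
Qed.

Lemma cabsV z : cabs z^-1 = (cabs z)^-1.
Proof. by apply: (@complexI R); rewrite fmorphV/= -!norm_cabs normfV. Qed.

Lemma cabs_nat n : cabs (n%:R : C) = n%:R.
Proof. by have := cabs_real n%:R; rewrite rmorph_nat normr_nat. Qed.

Lemma ReD z w : complex.Re (z + w) = complex.Re z + complex.Re w.
Proof. by case: z w => ? ? []. Qed.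

Lemma ReB z w : complex.Re (z - w) = complex.Re z - complex.Re w.
Proof. by case: z w => ? ? []. Qed.

Lemma ImD z w : complex.Im (z + w) = complex.Im z + complex.Im w.
Proof. by case: z w => ? ? []. Qed.

Lemma ImB z w : complex.Im (z - w) = complex.Im z - complex.Im w.
Proof. by case: z w => ? ? []. Qed.

Lemma cabs_Re z : `|complex.Re z| <= cabs z.
Proof.
rewrite /cabs -sqrtr_sqr ler_wsqrtr// lerDl; exact: sqr_ge0.
Qed.

Lemma cabs_Im z : `|complex.Im z| <= cabs z.
Proof.
rewrite /cabs -sqrtr_sqr ler_wsqrtr// lerDr; exact: sqr_ge0.
Qed.

Lemma cabs_sqr z : cabs z ^+ 2 = complex.Re z ^+ 2 + complex.Im z ^+ 2.
Proof. by rewrite sqr_sqrtr// addr_ge0// sqr_ge0. Qed.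

Lemma cabs_ReIm z : cabs z <= `|complex.Re z| + `|complex.Im z|.
Proof.
rewrite -(@ler_pXn2r _ 2)// ?nnegrE ?addr_ge0// cabs_sqr sqrrD.
by rewrite !real_normK ?num_real// addrAC lerDl mulrn_wge0// mulr_ge0.
Qed.

Lemma cabs_conj z : cabs z^* = cabs z.
Proof. by case: z => a b; rewrite /cabs/= sqrrN. Qed.

Lemma cabs_sum (I : Type) (r : seq I) (P : pred I) (F : I -> C) :
  cabs (\sum_(i <- r | P i) F i) <= \sum_(i <- r | P i) cabs (F i).
Proof.
elim/big_ind2 : _ => [|a b c d h1 h2|//]; first by rewrite cabs0.
exact: le_trans (cabsD _ _) (lerD h1 h2).
Qed.

Lemma cabs_prod (I : Type) (r : seq I) (P : pred I) (F : I -> C) :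
  cabs (\prod_(i <- r | P i) F i) = \prod_(i <- r | P i) cabs (F i).
Proof.
elim/big_ind2 : _ => [|a b c d <- <-|//]; first by rewrite cabs1.
by rewrite cabsM.
Qed.

(** In the order of [R[i]] comparable numbers have equal imaginary parts, so a positive radius is
    real; this turns neighbourhoods in [R[i]] into real estimates. *)
Lemma posC_ex (e : R[i]) : 0 < e -> exists2 d : R, 0 < d & e = d%:C.
Proof.
case: e => a b; rewrite ltcE/= => /andP[/eqP -> a0]; by exists a.
Qed.

Lemma cvgCP (T : Type) (F : set_system T) {FF : Filter F} (f : T -> R[i]^o) (l : R[i]^o) :
  f x @[x --> F] --> l <->
  forall e : R, 0 < e -> \forall x \near F, cabs (f x - l) < e.
Proof.
split.
  move=> /cvgrPdist_lt h e e0; have := h e%:C; rewrite ltcR => /(_ e0).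
  apply: filterS => x; rewrite norm_cabs ltcR cabs_subC//.
move=> h; apply/cvgrPdist_lt => e /posC_ex[d d0 ->].
by apply: filterS (h d d0) => x; rewrite norm_cabs ltcR cabs_subC.
Qed.

Lemma nearCP (P : C -> Prop) z :
  (\forall s \near (z : R[i]^o), P s) <->
  exists2 e : R, 0 < e & forall s, cabs (s - z) < e -> P s.
Proof.
split.
  move=> /nbhs_ballP[e /posC_ex[d d0 ->]] h; exists d => // s hs; apply: h.
  by rewrite /ball/= norm_cabs ltcR cabs_subC.
move=> [e e0 h]; apply/nbhs_ballP; exists (e%:C) => /=; first by rewrite ltcR.
by move=> s; rewrite /ball/= norm_cabs ltcR cabs_subC => /h.
Qed.

(** The little-o form of complex differentiability, with the derivative explicit. It makes sense at
    [h = 0] and keeps quotients out of the estimates; [derivableC] links it to [derivable]. *)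
Definition cdiff (f : C -> C) z l :=
  forall e : R, 0 < e -> exists2 d : R, 0 < d &
    forall h : C, cabs h < d -> cabs (f (z + h) - f z - l * h) <= e * cabs h.

Lemma cdiff_is_derive (f : C -> C) z l :
  cdiff f z l <-> is_derive (z : R[i]^o) 1 (f : R[i]^o -> R[i]^o) l.
Proof.
have E (h m : R[i]^o) : h != 0 ->
    h^-1 *: (f (h *: (1:R[i]^o) + z) - f z : R[i]^o) - m = (f (z + h) - f z - m * h) / h.
  move=> h0; rewrite /GRing.scale/= mulr1 (addrC h z).
  by rewrite mulrBl -mulrA mulfV// mulr1 mulrC.

split => [H|[df <-]].
  have hl : (h^-1 *: (f (h *: (1 : R[i]^o) + z) - f z) : R[i]^o) @[h --> (0 : R[i]^o)^'] --> (l : R[i]^o).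
    apply/cvgCP => e e0; have e2 : 0 < e / 2 by rewrite divr_gt0.
    have [d d0 hd] := H _ e2.
    apply/nbhs_ballP; exists (d%:C) => /=; first by rewrite ltcR.
    move=> h; rewrite /ball/= sub0r normrN norm_cabs ltcR => hh h0.
    rewrite E// cabsM cabsV; apply: le_lt_trans (_ : e / 2 < e); last lra.
    by rewrite ler_pdivrMr ?cabs_gt0//; exact: hd.
  by apply: DeriveDef; [apply/cvg_ex; exists l|exact: cvg_lim hl].
move=> e e0; have /cvgCP/(_ e e0) := df.
move=> /nbhs_ballP[d0 /= /posC_ex[d dgt ->] hd]; exists d => // h hh.
have [->|h0] := eqVneq h 0.
  by rewrite addr0 subrr mulr0 subrr cabs0 mulr0.
have := hd h; rewrite /ball/= sub0r normrN norm_cabs ltcR => /(_ hh h0).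
rewrite E// cabsM cabsV => /ltW; by rewrite ler_pdivrMr ?cabs_gt0.
Qed.

Lemma derivableC (f : R[i]^o -> R[i]^o) z :
  derivable f z 1 <-> exists l, cdiff f z l.
Proof.
split; first by move=> /derivableP /cdiff_is_derive; exists ('D_1 f z).
by move=> [l /cdiff_is_derive []].
Qed.

Lemma cdiff_unique (f : C -> C) z l w : cdiff f z l -> cdiff f z w -> l = w.
Proof. by move=> /cdiff_is_derive [_ <-] /cdiff_is_derive [_ <-]. Qed.

Lemma cdiff_cst (c : C) z : cdiff (fun=> c) z 0.
Proof. by apply/cdiff_is_derive; exact: is_derive_cst. Qed.

Lemma cdiff_id z : cdiff id z 1.
Proof. by apply/cdiff_is_derive; exact: is_derive_id. Qed.

Lemma cdiffD (f g : C -> C) z a b :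
  cdiff f z a -> cdiff g z b -> cdiff (fun w => f w + g w) z (a + b).
Proof.
by move=> /cdiff_is_derive h1 /cdiff_is_derive h2; apply/cdiff_is_derive.
Qed.

Lemma cdiffN (f : C -> C) z a : cdiff f z a -> cdiff (fun w => - f w) z (- a).
Proof.
by move=> /cdiff_is_derive h1; apply/cdiff_is_derive; exact: is_deriveN.
Qed.

Lemma cdiffB (f g : C -> C) z a b :
  cdiff f z a -> cdiff g z b -> cdiff (fun w => f w - g w) z (a - b).
Proof. by move=> ? /cdiffN; exact: cdiffD. Qed.

Lemma cdiffM (f g : C -> C) z a b :
  cdiff f z a -> cdiff g z b ->
  cdiff (fun w => f w * g w) z (f z * b + g z * a).
Proof.
by move=> /cdiff_is_derive h1 /cdiff_is_derive h2; apply/cdiff_is_derive.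
Qed.

Lemma cdiffV (f : C -> C) z a : f z != 0 ->
  cdiff f z a -> cdiff (fun w => (f w)^-1) z (- f z ^- 2 * a).
Proof.
move=> f0 /cdiff_is_derive [h1 <-]; apply/cdiff_is_derive.
apply: DeriveDef; first exact: (@derivableV _ R[i]^o).
exact: (@deriveV _ R[i]^o).
Qed.

Lemma cdiff_lip (f : C -> C) z l : cdiff f z l -> exists2 d : R, 0 < d &
  forall h, cabs h < d -> cabs (f (z + h) - f z) <= (cabs l + 1) * cabs h.
Proof.
move=> /(_ 1 ltr01)[d d0 hd]; exists d => // h /hd; rewrite mul1r => h1.
have := cabsD (f (z + h) - f z - l * h) (l * h).
by rewrite subrK cabsM mulrDl mul1r => h2; lra.
Qed.

Lemma cdiff_continuous (f : C -> C) z l : cdiff f z l ->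
  forall e : R, 0 < e -> exists2 d : R, 0 < d &
    forall w, cabs (w - z) < d -> cabs (f w - f z) < e.
Proof.
move=> /cdiff_lip[d d0 hd] e e0.
have L0 : 0 < cabs l + 1 by rewrite ltr_wpDl.
exists (Num.min d (e / (cabs l + 1))); first by rewrite lt_min d0 divr_gt0.
move=> w; rewrite lt_min => /andP[/hd]; rewrite addrCA subrr addr0 => h1 h2.
by apply: le_lt_trans h1 _; rewrite mulrC -ltr_pdivlMr.
Qed.

Lemma cdiff_comp (f g : C -> C) z a b :
  cdiff f z a -> cdiff g (f z) b -> cdiff (g \o f) z (b * a).
Proof.
move=> hf hg e e0.
have [d1 d10 h1] := cdiff_lip hf.
have L0 : 0 < cabs a + 1 by rewrite ltr_wpDl.
have M0 : 0 < cabs b + 1 by rewrite ltr_wpDl.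
have e1 : 0 < e / 2 / (cabs a + 1) by rewrite !divr_gt0.
have e2 : 0 < e / 2 / (cabs b + 1) by rewrite !divr_gt0.
have [d2 d20 h2] := hg _ e1.
have [d3 d30 h3] := hf _ e2.
exists (Num.min d1 (Num.min (d2 / (cabs a + 1)) d3)).
  by rewrite !lt_min d10 d30 divr_gt0.
move=> h; rewrite !lt_min => /and3P[/h1 A B /h3 D] /=.
set k := f (z + h) - f z in A D *.
have fE : f (z + h) = f z + k by rewrite /k addrCA subrr addr0.
have kd : cabs k < d2.
  by apply: le_lt_trans A _; rewrite mulrC -ltr_pdivlMr.
have := h2 _ kd; rewrite -fE => E.
have -> : g (f (z + h)) - g (f z) - b * a * h =
  (g (f (z + h)) - g (f z) - b * k) + b * (k - a * h) by ring.
apply: le_trans (cabsD _ _) _; rewrite cabsM.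
have E1 : e / 2 / (cabs a + 1) * cabs k <= e / 2 * cabs h.
  apply: le_trans (ler_wpM2l (ltW e1) A) _.
  by rewrite mulrA divfK ?gt_eqF.
have E2 : cabs b * cabs (k - a * h) <= e / 2 * cabs h.
  apply: le_trans (ler_wpM2l (cabs_ge0 _) D) _.
  have : (cabs b + 1) * (e / 2 / (cabs b + 1) * cabs h) = e / 2 * cabs h.
    by field; rewrite gt_eqF.
  have := mulr_ge0 (ltW e2) (cabs_ge0 h); nra.
lra.
Qed.

Lemma cdiff_eq_near (f g : C -> C) z l (d : R) : 0 < d ->
  (forall w, cabs (w - z) < d -> f w = g w) -> cdiff f z l -> cdiff g z l.
Proof.
move=> d0 fg hf e e0; have [d1 d10 h1] := hf _ e0.
exists (Num.min d d1); first by rewrite lt_min d0.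
move=> h; rewrite lt_min => /andP[hd /h1].
by rewrite -!fg// ?subrr ?cabs0// addrAC subrr add0r.
Qed.

Lemma cdiff_ext (f g : C -> C) z l a :
  (forall w, f w = g w) -> l = a -> cdiff f z l -> cdiff g z a.
Proof. by move=> fg <-; apply: (@cdiff_eq_near _ _ _ _ 1). Qed.

Lemma cdiff_sum (I : Type) (r : seq I) (f : I -> C -> C) (a : I -> C) z :
  (forall i, cdiff (f i) z (a i)) ->
  cdiff (fun w => \sum_(i <- r) f i w) z (\sum_(i <- r) a i).
Proof.
move=> h; elim: r => [|i r IH].
  by apply: cdiff_ext (cdiff_cst 0 z) => [w|]; rewrite big_nil.
by apply: cdiff_ext (cdiffD (h i) IH) => [w|]; rewrite big_cons.
Qed.

Lemma cdiffX (n : nat) z : cdiff (fun w => w ^+ n) z (z ^+ n.-1 *+ n).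
Proof.
elim: n => [|n IH]; first exact: cdiff_cst.
apply: cdiff_ext (cdiffM (cdiff_id z) IH) => [w|/=]; first by rewrite exprS.
case: n {IH} => [|n] /=; first by rewrite mulr0n mulr0 add0r expr0 mulr1.
by rewrite mulr1 mulrnAr -exprS -mulrSr.
Qed.

Definition clim (u : nat -> C) l :=
  (fun n => cabs (u n - l)) @ \oo --> (0 : R).

Lemma climP (u : nat -> C) l : clim u l <->
  forall e : R, 0 < e -> exists N, forall n, (N <= n)%N -> cabs (u n - l) < e.
Proof.
split.
  move=> /cvgrPdist_lt h e /h[N _ hN]; exists N => n /hN.
  by rewrite sub0r normrN ger0_norm.
move=> h; apply/cvgrPdist_lt => e /h[N hN]; exists N => // n /hN.
by rewrite /= sub0r normrN ger0_norm.
Qed.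

Lemma clim_cvg (u : nat -> C) l :
  clim u l <-> (u n : R[i]^o) @[n --> \oo] --> (l : R[i]^o).
Proof.
rewrite cvgCP climP; split=> h e /h[N hN].
  by exists N.
by move=> hN2; exists N => n /hN2.
Qed.

Lemma clim_le (u : nat -> C) l (b : nat -> R) :
  (forall n, cabs (u n - l) <= b n) -> b @ \oo --> (0 : R) -> clim u l.
Proof.
move=> ub b0; apply: (@squeeze_cvgr _ _ _ _ (fun=> 0) b) b0; last exact: cvg_cst.
by apply: nearW => n; rewrite cabs_ge0 ub.
Qed.

Lemma clim_cst l : clim (fun=> l) l.
Proof.
by apply: (@clim_le _ _ (fun=> 0)) => [n|]; [rewrite subrr cabs0|exact: cvg_cst].
Qed.

Lemma climD (u v : nat -> C) z w :
  clim u z -> clim v w -> clim (fun n => u n + v n) (z + w).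
Proof.
move=> h1 h2; apply: (@clim_le _ _ (fun n => cabs (u n - z) + cabs (v n - w))).
  by move=> n; rewrite opprD addrACA cabsD.
by rewrite -[0]addr0; apply: cvgD.
Qed.

Lemma clim_cabs (u : nat -> C) l :
  clim u l -> (fun n => cabs (u n)) @ \oo --> cabs l.
Proof.
move=> /climP h; apply/cvgrPdist_lt => e /h[N hN]; exists N => // n /hN /=.
apply: le_lt_trans; rewrite ler_norml.
have := cabs_lerB (u n) l; have := cabs_lerB l (u n).
by rewrite (cabs_subC l) => h1 h2; apply/andP; split; lra.
Qed.

Lemma climM (u v : nat -> C) z w :
  clim u z -> clim v w -> clim (fun n => u n * v n) (z * w).
Proof.
move=> h1 h2.
apply: (@clim_le _ _ (fun n => cabs (u n - z) * cabs (v n) + cabs z * cabs (v n - w))).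
  move=> n; have -> : u n * v n - z * w = (u n - z) * v n + z * (v n - w) by ring.
  by apply: le_trans (cabsD _ _) _; rewrite !cabsM.
have -> : 0 = 0 * cabs w + cabs z * 0 by rewrite mul0r mulr0 addr0.
apply: cvgD; apply: cvgM => //; [exact: clim_cabs|exact: cvg_cst].
Qed.

Lemma climN (u : nat -> C) z : clim u z -> clim (fun n => - u n) (- z).
Proof.
by move=> h; apply: (clim_le _ h) => n; rewrite -opprD cabsN.
Qed.

Lemma climB (u v : nat -> C) z w :
  clim u z -> clim v w -> clim (fun n => u n - v n) (z - w).
Proof. by move=> ? /climN; exact: climD. Qed.

Lemma clim_sum (I : Type) (r : seq I) (u : I -> nat -> C) (a : I -> C) :
  (forall i, clim (u i) (a i)) ->
  clim (fun n => \sum_(i <- r) u i n) (\sum_(i <- r) a i).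
Proof.
move=> h; elim: r => [|i r IH].
  rewrite big_nil (_ : (fun n => _) = fun=> 0); first exact: clim_cst.
  by apply/funext => n; rewrite big_nil.
rewrite big_cons (_ : (fun n => _) = fun n => u i n + \sum_(j <- r) u j n).
  exact: climD.
by apply/funext => n; rewrite big_cons.
Qed.

Lemma clim_unique (u : nat -> C) z w : clim u z -> clim u w -> z = w.
Proof.
move=> h1 h2; have := climB h1 h2; under [X in clim X]eq_fun do rewrite subrr.
move=> /clim_cabs; rewrite cabs0 => h.
have /eqP : 0 = cabs (z - w) by apply: (cvg_unique _ _ h) => //; exact: cvg_cst.
by rewrite eq_sym cabs_eq0 subr_eq0 => /eqP.
Qed.

Lemma clim_ext (u v : nat -> C) z : u =1 v -> clim u z -> clim v z.
Proof. by move=> /funext ->. Qed.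

Lemma clim_Re (u : nat -> C) l : clim u l ->
  (fun n => complex.Re (u n)) @ \oo --> complex.Re l.
Proof.
move=> /climP h; apply/cvgrPdist_lt => e /h[N hN]; exists N => // n /hN /=.
by apply: le_lt_trans; rewrite distrC -ReB; exact: cabs_Re.
Qed.

Lemma clim_ReIm (u : nat -> C) (a b : R) :
  (fun n => complex.Re (u n)) @ \oo --> a ->
  (fun n => complex.Im (u n)) @ \oo --> b -> clim u (a +i* b).
Proof.
move=> ha hb.
apply: (@clim_le _ _ (fun n => `|complex.Re (u n) - a| + `|complex.Im (u n) - b|)).
  by move=> n; apply: le_trans (cabs_ReIm _) _; rewrite ReB ImB.
have h (f : nat -> R) c : f @ \oo --> c -> (fun n => `|f n - c|) @ \oo --> (0 : R).
  move=> hf; rewrite -(@normr0 _ R) -(subrr c).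
  by apply: cvg_norm; apply: cvgB => //; exact: cvg_cst.
by rewrite -[0]addr0; apply: cvgD; exact: h.
Qed.

Lemma clim_real (u : nat -> R) (a : R) :
  u @ \oo --> a <-> clim (fun n => (u n)%:C) a%:C.
Proof.
split; first by move=> h; apply: clim_ReIm => //=; exact: cvg_cst.
by move/clim_Re.
Qed.

Lemma clim_cauchy (u : nat -> C) (b : nat -> R) :
  (forall m n, (m <= n)%N -> cabs (u n - u m) <= b m) -> b @ \oo --> (0 : R) ->
  exists2 l, clim u l & forall m, cabs (l - u m) <= b m.
Proof.
move=> ub b0.
have aux (p : C -> R) : (forall z w, p (z - w) = p z - p w) ->
    (forall z, `|p z| <= cabs z) -> cvgn (p \o u).
  move=> pB pl; apply/cauchy_cvgP/cauchy_exP => e e0.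
  move/cvgrPdist_lt : b0 => /(_ e e0)[N _ hN]; exists (p (u N)), N => // n /= Nn.
  rewrite /ball/= distrC -pB; apply: le_lt_trans (pl _) _.
  apply: le_lt_trans (ub _ _ Nn) _; have := hN N (leqnn _).
  by rewrite /= sub0r normrN; apply: le_lt_trans; exact: ler_norm.
have h1 := aux _ ReB cabs_Re; have h2 := aux _ ImB cabs_Im.
have hl := clim_ReIm h1 h2; exists (limn (@complex.Re R \o u) +i* limn (@complex.Im R \o u)) => // m.
apply: (ler_cvg_to (clim_cabs (climB hl (clim_cst (u m)))) (cvg_cst (b m))).
by exists m => // n; exact: ub.
Qed.

Definition csum (u : nat -> C) l := clim (series u) l.

Lemma csum_ext (u v : nat -> C) z : u =1 v -> csum u z -> csum v z.
Proof. by move=> /funext ->. Qed.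

Lemma csum_unique (u : nat -> C) z w : csum u z -> csum u w -> z = w.
Proof. exact: clim_unique. Qed.

Lemma csumD (u v : nat -> C) z w :
  csum u z -> csum v w -> csum (fun n => u n + v n) (z + w).
Proof.
move=> h1 h2; apply: clim_ext (climD h1 h2) => n.
by rewrite /series/= -big_split.
Qed.

Lemma csumZ (c : C) (u : nat -> C) z : csum u z -> csum (fun n => c * u n) (c * z).
Proof.
move=> h1; apply: clim_ext (climM (clim_cst c) h1) => n.
by rewrite /series/= mulr_sumr.
Qed.

Lemma csumN (u : nat -> C) z : csum u z -> csum (fun n => - u n) (- z).
Proof.
move=> h; have := csumZ (-1) h; rewrite mulN1r; apply: csum_ext => n.
by rewrite mulN1r.
Qed.

Lemma csumB (u v : nat -> C) z w :
  csum u z -> csum v w -> csum (fun n => u n - v n) (z - w).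
Proof. by move=> ? /csumN; exact: csumD. Qed.

Lemma csum_real (u : nat -> R) (a : R) :
  series u @ \oo --> a <-> csum (fun n => (u n)%:C) a%:C.
Proof.
rewrite clim_real /csum; have -> // : (fun n => (series u n)%:C) = series (fun n => (u n)%:C).
by apply/funext => n; rewrite /series/= rmorph_sum.
Qed.

Lemma csum_shift (u : nat -> C) z :
  csum (fun n => u n.+1) z <-> csum u (u 0%N + z).
Proof.
rewrite /csum; have E n : series u n.+1 = u 0%N + series (fun n => u n.+1) n.
  by rewrite /series/= big_nat_recl.
have S v l : clim (fun n => v n.+1) l <-> clim v l.
  by rewrite /clim -(@cvg_shiftS _ (fun n => cabs (v n - l))).
have EE : (fun n => series u n.+1) = (fun n => u 0%N + series (fun k => u k.+1) n).
  by apply/funext => n; exact: E.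
rewrite -(S (series u)) EE.
split; first by move=> h; apply: climD => //; exact: clim_cst.
move=> h; have := climB h (clim_cst (u 0%N)); rewrite addrAC subrr add0r.
by apply: clim_ext => n; rewrite addrAC subrr add0r.
Qed.

(** The Weierstrass test with its remainder: the tail of the majorant is the uniform error from
    which holomorphy of limits is deduced later. *)
Lemma csum_tail (u : nat -> C) (b : nat -> R) :
  (forall n, cabs (u n) <= b n) -> cvgn (series b) ->
  exists2 l, csum u l & forall N, cabs (l - series u N) <= limn (series b) - series b N.
Proof.
move=> ub cb; have b0 n : 0 <= b n by exact: le_trans (ub n).
apply: clim_cauchy.
  move=> m n mn; apply: le_trans (_ : series b n - series b m <= _).
    rewrite !sub_series_geq//; apply: le_trans (cabs_sum _ _ _) _.
    exact: ler_sum.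
  rewrite lerB//; apply: nondecreasing_cvgn_le => //.
  by apply/nondecreasing_seqP => k; rewrite seriesSr lerDl.
by rewrite -(subrr (limn (series b))); apply: cvgB => //; exact: cvg_cst.
Qed.

Lemma csum_tail_le (u : nat -> C) (b : nat -> R) l N :
  (forall n, cabs (u n) <= b n) -> cvgn (series b) -> csum u l ->
  cabs (l - series u N) <= limn (series b) - series b N.
Proof.
by move=> ub cb ul; have [m /(csum_unique ul) <-] := csum_tail ub cb.
Qed.

Lemma csum_le (u : nat -> C) (b : nat -> R) l :
  (forall n, cabs (u n) <= b n) -> cvgn (series b) -> csum u l ->
  cabs l <= limn (series b).
Proof.
move=> ub cb ul; have := csum_tail_le 0 ub cb ul.
by rewrite /series/= !big_geq// !subr0.
Qed.

(** Dominated convergence for series: the majorant makes both tails beyond [K] smaller than [e / 3],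
    and the first [K] terms converge as a finite sum. *)
Lemma tannery (u : nat -> nat -> C) (v : nat -> C) (b : nat -> R)
    (U : nat -> C) l :
  (forall N k, cabs (u N k) <= b k) -> cvgn (series b) ->
  (forall k, clim (fun N => u N k) (v k)) ->
  (forall N, csum (u N) (U N)) -> csum v l -> clim U l.
Proof.
move=> ub cb uv uU vl.
have vb k : cabs (v k) <= b k.
  apply: (ler_cvg_to (clim_cabs (uv k)) (cvg_cst (b k))).
  by apply: nearW => n; exact: ub.
apply/climP => e e0; have e3 : 0 < e / 3 by rewrite divr_gt0.
have [K hK] : exists K, limn (series b) - series b K < e / 3.
  move/cvgrPdist_lt : (cb) => /(_ _ e3) [K _ hK]; exists K.
  apply: le_lt_trans (hK K (leqnn _)); exact: ler_norm.
have /climP/(_ _ e3)[N0 hN0] : clim (fun N => series (u N) K) (series v K).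
  by apply: clim_sum.
exists N0 => N /hN0 hN.
have h1 := le_lt_trans (csum_tail_le K (ub N) cb (uU N)) hK.
have h2 := le_lt_trans (csum_tail_le K vb cb vl) hK.
have -> : U N - l = (U N - series (u N) K) + (series (u N) K - series v K)
   - (l - series v K) by ring.
apply: le_lt_trans (cabsB _ _) _.
have := cabsD (U N - series (u N) K) (series (u N) K - series v K); lra.
Qed.

End ComplexBasics.
#[export] Hint Extern 0 (is_true (0 <= cabs _)) => exact: cabs_ge0 : core.

(** * The complex exponential *)

Section ComplexExp.
Context {R : realType}.
Local Notation C := R[i].
Implicit Types (z w : C).

Lemma cexpD z w : cexp (z + w) = cexp z * cexp w.
Proof.
case: z w => a b [c d]; rewrite /cexp/= expRD cosD sinD.
by apply/eqP; rewrite eq_complex/=; apply/andP; split; apply/eqP; ring.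
Qed.

Lemma cexp0 : cexp (0 : C) = 1.
Proof. by rewrite /cexp/= expR0 cos0 sin0 mulr0 mulr1. Qed.

Lemma cabs_cexp z : cabs (cexp z) = expR (complex.Re z).
Proof.
by rewrite /cabs/= !exprMn -mulrDr cos2Dsin2 mulr1 sqrtr_sqr ger0_norm ?expR_ge0.
Qed.

Lemma cexp_neq0 z : cexp z != 0.
Proof. by rewrite -cabs_gt0 cabs_cexp expR_gt0. Qed.

Lemma cexpN z : cexp (- z) = (cexp z)^-1.
Proof.
by apply: (mulfI (cexp_neq0 z)); rewrite -cexpD subrr cexp0 mulfV// cexp_neq0.
Qed.

Lemma cexp_real (x : R) : cexp (x%:C : C) = (expR x)%:C.
Proof. by rewrite /cexp/= cos0 sin0 mulr1 mulr0. Qed.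

Lemma cexp_conj z : cexp z^* = (cexp z)^*.
Proof. by case: z => a b; rewrite /cexp/= cosN sinN mulrN. Qed.

Lemma sin_le_id (x : R) : `|sin x| <= `|x|.
Proof.
wlog x0 : x / 0 < x => [h|].
  have [x0|x0|->] := ltgtP x 0; last by rewrite sin0.
    by have := h (- x); rewrite sinN !normrN oppr_gt0; exact.
  exact: h.
have [c _] := @MVT R sin cos 0 x x0 (fun y _ => is_derive_sin y)
  (continuous_subspaceT (@continuous_sin R)).
rewrite sin0 !subr0 => ->; rewrite normrM ler_piMl// cos_max//.
Qed.

Lemma cos_ge_quad (x : R) : `|cos x - 1| <= x ^+ 2 / 2.
Proof.
have -> : cos x - 1 = - (2 * sin (x / 2) ^+ 2).
  have {1}-> : x = (x / 2) *+ 2 by rewrite mulr2n; lra.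
  by rewrite cos_mulr2n cos2sin2 mulr2n; ring.
rewrite normrN ger0_norm; last by have := sqr_ge0 (sin (x / 2)); lra.
have : sin (x / 2) ^+ 2 <= (x / 2) ^+ 2.
  rewrite -[leLHS]real_normK ?num_real// -[leRHS]real_normK ?num_real//.
  by rewrite ler_pXn2r ?nnegrE ?normr_ge0// sin_le_id.
by nra.
Qed.

Lemma sin_quad (x : R) : `|x| <= 1 -> `|sin x - x| <= x ^+ 2.
Proof.
wlog x0 : x / 0 < x => [h|].
  have [x0 x1|x0|-> _] := ltgtP x 0; last by rewrite sin0 subrr normr0 expr0n.
    have := h (- x); rewrite oppr_gt0 normrN => /(_ x0 x1).
    by rewrite sinN -opprD normrN sqrrN.
  exact: h.
rewrite (ger0_norm (ltW x0)) => x1.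
have [c /andP[c0 cx]] := @MVT R sin cos 0 x x0 (fun y _ => is_derive_sin y)
  (continuous_subspaceT (@continuous_sin R)).
rewrite sin0 !subr0 => ->; rewrite -[X in _ - X]mul1r -mulrBl normrM.
move: c0 cx; rewrite !bnd_simp => c0 cx.
have h := cos_ge_quad c; rewrite (ger0_norm (ltW x0)) expr2 ler_wpM2r ?ltW//.
by apply: le_lt_trans h _; nra.
Qed.

Lemma expR_quad (x : R) : `|x| <= 1 / 2 -> `|expR x - 1 - x| <= 2 * x ^+ 2.
Proof.
rewrite ler_norml => /andP[h1 h2]; rewrite ger0_norm; last first.
  by have := expR_ge1Dx x; lra.
have := expR_ge1Dx (- x); rewrite expRN => h3.
have e0 := expR_gt0 x.
have : expR x * (1 - x) <= 1.
  by rewrite mulrC -ler_pdivlMr ?expR_gt0// div1r; lra.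
nra.
Qed.

Lemma cexp_quad z : cabs z <= 1 / 2 -> cabs (cexp z - 1 - z) <= 4 * cabs z ^+ 2.
Proof.
case: z => x y h.
have hx : `|x| <= 1 / 2 := le_trans (cabs_Re _) h.
have hy : `|y| <= 1 / 2 := le_trans (cabs_Im _) h.
rewrite cabs_sqr/=; apply: le_trans (cabs_ReIm _) _.
rewrite /cexp !ReB !ImB/= subr0.
have -> : expR x * cos y - 1 - x = (expR x - 1 - x) + expR x * (cos y - 1) by ring.
have -> : expR x * sin y - y = (expR x - 1) * sin y + (sin y - y) by ring.
have A := expR_quad hx; have B := cos_ge_quad y.
have D := sin_le_id y; have E : `|sin y - y| <= y ^+ 2 by apply: sin_quad; lra.
have [nx ny] : `|x| ^+ 2 = x ^+ 2 /\ `|y| ^+ 2 = y ^+ 2.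
  by rewrite !real_normK ?num_real.
have e2 : expR x <= 2.
  move: A; rewrite ler_norml => /andP[_]; move: hx; rewrite ler_norml => /andP[]; nra.
have e1 : `|expR x - 1| <= 2 * `|x|.
  have -> : expR x - 1 = (expR x - 1 - x) + x by ring.
  apply: le_trans (ler_normD _ _) _.
  by have := normr_ge0 x; nra.
have := ler_normD (expR x - 1 - x) (expR x * (cos y - 1)).
have := ler_normD ((expR x - 1) * sin y) (sin y - y).
rewrite !normrM (gtr0_norm (expR_gt0 x)).
have F : expR x * `|cos y - 1| <= y ^+ 2.
  have := normr_ge0 (cos y - 1); have := expR_gt0 x; nra.
have G : `|expR x - 1| * `|sin y| <= x ^+ 2 + y ^+ 2.
  apply: le_trans (ler_pM _ _ e1 D) _ => //.
  have := sqr_ge0 (`|x| - `|y|); nra.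
have := sqr_ge0 x; have := sqr_ge0 y; lra.
Qed.

Lemma cdiff_cexp z : cdiff (@cexp R) z (cexp z).
Proof.
move=> e e0.
have K0 : 0 < 4 * cabs (cexp z) + 1 by have := cabs_ge0 (cexp z); lra.
exists (Num.min (1 / 2) (e / (4 * cabs (cexp z) + 1))).
  by rewrite lt_min !divr_gt0.
move=> h; rewrite lt_min => /andP[h1 h2].
have -> : cexp (z + h) - cexp z - cexp z * h = cexp z * (cexp h - 1 - h).
  by rewrite cexpD; ring.
rewrite cabsM; apply: le_trans (ler_wpM2l (cabs_ge0 _) (cexp_quad (ltW h1))) _.
have -> : cabs (cexp z) * (4 * cabs h ^+ 2) = 4 * cabs (cexp z) * cabs h * cabs h.
  by ring.
by rewrite ler_wpM2r//; move: h2; rewrite ltr_pdivlMr// => h2; have := cabs_ge0 h; nra.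
Qed.

End ComplexExp.

(** * Cauchy theory on discs *)

Section DyadicIntegral.
Context {R : realType}.
Local Notation C := R[i].
Implicit Types (g f : R -> C).

(* The left Riemann sum of [g] on [0, 1] with mesh [2 ^- n], in a form where halving the
   interval is definitional. *)
Fixpoint dsum (n : nat) (g : R -> C) : C :=
  if n is n'.+1 then
    (dsum n' (fun t => g (t / 2)) + dsum n' (fun t => g ((1 + t) / 2))) / 2
  else g 0.

Lemma half_itv (t : R) : 0 <= t <= 1 ->
  (0 <= t / 2 <= 1) /\ (0 <= (1 + t) / 2 <= 1).
Proof. by move=> /andP[h1 h2]; split; apply/andP; split; lra. Qed.

Lemma dsum_ext n g f : (forall t, 0 <= t <= 1 -> g t = f t) ->
  dsum n g = dsum n f.
Proof.
elim: n g f => [|n IH] g f gf /=; first by rewrite gf// lexx ler01.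
by congr ((_ + _) / 2); apply: IH => t /half_itv[h1 h2]; exact: gf.
Qed.

Lemma dsumE n g :
  dsum n g = (\sum_(j < 2 ^ n) g (j%:R / 2 ^+ n)) / 2 ^+ n.
Proof.
elim: n g => [|n IH] g /=.
  by rewrite expn0 big_ord1 mul0r expr0 divr1.
have -> : (2 ^ n.+1 = 2 ^ n + 2 ^ n)%N by rewrite expnS mul2n addnn.
rewrite big_split_ord/= !IH [in X in _ = _ / X]exprS invfM -mulrDl.
rewrite mulrA [RHS]mulrAC; congr ((_ + _) / _ / _); apply: eq_bigr => j _; congr g.
  by rewrite exprS; field; rewrite expf_neq0.
by rewrite natrD natrX exprS; field; rewrite expf_neq0.
Qed.

Lemma dsumD n g f : dsum n (fun t => g t + f t) = dsum n g + dsum n f.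
Proof. by elim: n g f => [|n IH] g f //=; rewrite !IH; ring. Qed.

Lemma dsumZ n (c : C) g : dsum n (fun t => c * g t) = c * dsum n g.
Proof. by elim: n g => [|n IH] g //=; rewrite !IH; ring. Qed.

Lemma dsumN n g : dsum n (fun t => - g t) = - dsum n g.
Proof.
rewrite -mulN1r -dsumZ; apply: dsum_ext => t _; by rewrite mulN1r.
Qed.

Lemma dsumB n g f : dsum n (fun t => g t - f t) = dsum n g - dsum n f.
Proof. by rewrite dsumD dsumN. Qed.

Lemma dsum_cst n (c : C) : dsum n (fun=> c) = c.
Proof. by elim: n => [|n IH] //=; rewrite IH; field. Qed.

(** Fubini for finite sums; in [circ] it exchanges the mean over a circle with the mean over
    radii. *)
Lemma dsum_swap m n (h : R -> R -> C) :
  dsum n (fun t => dsum m (h t)) = dsum m (fun s => dsum n (h^~ s)).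
Proof.
elim: m h => [|m IH] h //=; rewrite -!IH -dsumD mulrC -dsumZ.
by apply: dsum_ext => t _; rewrite mulrC.
Qed.

Lemma cabs2 : cabs (2 : C) = 2.
Proof. by rewrite cabs_nat. Qed.

Lemma dsum_le n g (M : R) : (forall t, 0 <= t <= 1 -> cabs (g t) <= M) ->
  cabs (dsum n g) <= M.
Proof.
elim: n g => [|n IH] g h /=; first by apply: h; rewrite lexx ler01.
have h1 : cabs (dsum n (fun t => g (t / 2))) <= M.
  by apply: IH => t /half_itv[+ _]; exact: h.
have h2 : cabs (dsum n (fun t => g ((1 + t) / 2))) <= M.
  by apply: IH => t /half_itv[_]; exact: h.
rewrite cabsM cabsV cabs2; have := cabsD (dsum n (fun t => g (t / 2)))
  (dsum n (fun t => g ((1 + t) / 2))); lra.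
Qed.

Lemma dsum_csum n (u : R -> nat -> C) (v : R -> C) :
  (forall t, 0 <= t <= 1 -> csum (u t) (v t)) ->
  csum (fun k => dsum n (fun t => u t k)) (dsum n v).
Proof.
elim: n u v => [|n IH] u v h /=; first by apply: h; rewrite lexx ler01.
rewrite mulrC; apply: (@csum_ext _ (fun k => 2^-1 * _)) => [k|].
  by rewrite mulrC.
apply/csumZ/csumD; apply: IH => t /half_itv[h1 h2]; exact: h.
Qed.

(** Both halves inherit the oscillation bound at the coarser level, and at level 0 a mean of values
    is compared with [g 0]. This is the Cauchy criterion behind [dint]. *)
Lemma dsum_osc n k g (e : R) : 0 <= e ->
  (forall s t, 0 <= s <= 1 -> 0 <= t <= 1 -> `|s - t| <= (2 ^+ n)^-1 ->
     cabs (g s - g t) <= e) ->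
  cabs (dsum (n + k) g - dsum n g) <= e.
Proof.
move=> e0; elim: n g => [|n IH] g h /=.
  rewrite add0n -[X in dsum k g - X](dsum_cst k) -dsumB; apply: dsum_le => t t01.
  apply: h => //; first by rewrite lexx ler01.
  by rewrite subr0 expr0 invr1 ger0_norm; case/andP: t01.
have E (s t : R) : `|s - t| <= (2 ^+ n)^-1 -> `|(s - t) / 2| <= (2 ^+ n.+1)^-1.
  by rewrite normrM (ger0_norm (_ : 0 <= 2^-1))// exprSr invfM ler_pM2r.
have h1 : cabs (dsum (n + k) (fun t => g (t / 2)) - dsum n (fun t => g (t / 2))) <= e.
  apply: IH => s t /half_itv[s1 _] /half_itv[t1 _] /E st; apply: h => //.
  by rewrite -mulrBl.
have h2 : cabs (dsum (n + k) (fun t => g ((1 + t) / 2)) - dsum n (fun t => g ((1 + t) / 2))) <= e.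
  apply: IH => s t /half_itv[_ s1] /half_itv[_ t1] /E st; apply: h => //.
  by rewrite -mulrBl (_ : 1 + s - (1 + t) = s - t)//; ring.
rewrite -mulrBl opprD addrACA cabsM cabsV cabs2.
have := cabsD (dsum (n + k) (fun t => g (t / 2)) - dsum n (fun t => g (t / 2)))
  (dsum (n + k) (fun t => g ((1 + t) / 2)) - dsum n (fun t => g ((1 + t) / 2))).
lra.
Qed.

Definition ucont g := forall e : R, 0 < e -> exists2 d : R, 0 < d &
  forall s t, 0 <= s <= 1 -> 0 <= t <= 1 -> `|s - t| < d -> cabs (g s - g t) < e.

Definition dint g : C := xget 0 [set l | clim (fun n => dsum n g) l].

Lemma dint_clim g l : clim (fun n => dsum n g) l -> dint g = l.
Proof.
move=> h; rewrite /dint; case: xgetP => [x -> /= hx|]; first exact: clim_unique hx h.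
by move=> /(_ l).
Qed.

Lemma half_pow_lt (d : R) : 0 < d -> exists N, (2 ^+ N)^-1 < d.
Proof.
move=> d0.
have : (fun n => (1 : R) / 2 ^+ n) @ \oo --> (0 : R).
  have := @cvg_geometric R 1 (2^-1); rewrite ger0_norm// => h.
  have : (2^-1 : R) < 1 by lra.
  move=> /h; rewrite /geometric/=; under eq_fun do rewrite exprVn; exact.
move=> /cvgrPdist_lt/(_ _ d0)[N _ h]; exists N.
by have := h N (leqnn _); rewrite /= sub0r normrN div1r ger0_norm// invr_ge0 exprn_ge0.
Qed.

Lemma dintP g : ucont g -> clim (fun n => dsum n g) (dint g).
Proof.
move=> ug.
suff [l hl] : exists l, clim (fun n => dsum n g) l by rewrite (dint_clim hl).
have hN (e : R) : 0 < e -> exists N, forall n, (N <= n)%N ->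
    cabs (dsum n g - dsum N g) <= e.
  move=> e0; have [d d0 hd] := ug _ e0; have [N hN] := half_pow_lt d0.
  exists N => n /subnKC <-; apply: dsum_osc => //; first exact: ltW.
  by move=> s t s0 t0 st; apply/ltW/hd => //; exact: le_lt_trans st hN.
have aux (p : C -> R) : (forall z w, p (z - w) = p z - p w) ->
    (forall z, `|p z| <= cabs z) -> cvgn (p \o (fun n => dsum n g)).
  move=> pB pl; apply/cauchy_cvgP/cauchy_exP => e e0.
  have e2 : 0 < e / 2 by rewrite divr_gt0.
  have [N NN] := hN _ e2; exists (p (dsum N g)), N => // n /= Nn.
  rewrite /ball/= distrC -pB; apply: le_lt_trans (pl _) _.
  by apply: le_lt_trans (NN _ Nn) _; lra.
have h1 := aux _ ReB cabs_Re; have h2 := aux _ ImB cabs_Im.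
by exists (limn (@complex.Re R \o (fun n => dsum n g))
  +i* limn (@complex.Im R \o (fun n => dsum n g))); exact: clim_ReIm.
Qed.

Lemma clim_cabs_le (u : nat -> C) l (M : R) :
  clim u l -> (exists N, forall n, (N <= n)%N -> cabs (u n) <= M) -> cabs l <= M.
Proof.
move=> ul [N hN]; apply: (ler_cvg_to (clim_cabs ul) (cvg_cst M)).
by exists N.
Qed.

Lemma dsum_id n : dsum n (fun t => t%:C) = (1 - (2 ^+ n)^-1) / 2.
Proof.
elim: n => [|n IH]; first by rewrite /= expr0 invr1 subrr mul0r.
rewrite /= (@dsum_ext n _ (fun t => 2^-1 * t%:C)); last first.
  by move=> t _; rewrite rmorphM/= fmorphV/= rmorph_nat mulrC.
rewrite (@dsum_ext n (fun t => ((1 + t) / 2)%:C) (fun t => 2^-1 + 2^-1 * t%:C)); last first.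
  by move=> t _; rewrite rmorphM/= rmorphD/= fmorphV/= rmorph_nat; ring.
rewrite dsumD dsumZ dsum_cst IH exprS; field; by rewrite expf_neq0.
Qed.

(** Reversing the path turns left Riemann sums into right ones, which differ only by the end
    values. *)
Lemma dsum_rev n g :
  dsum n (fun t => g (1 - t)) = dsum n g + (g 1 - g 0) / 2 ^+ n.
Proof.
elim: n g => [|n IH] g /=.
  by rewrite subr0 expr0 divr1 addrC subrK.
rewrite (@dsum_ext n (fun t => g (1 - t / 2)) (fun t => (fun s => g ((1 + s) / 2)) (1 - t))); last first.
  by move=> t _; congr g; lra.
rewrite (@dsum_ext n (fun t => g (1 - (1 + t) / 2)) (fun t => (fun s => g (s / 2)) (1 - t))); last first.
  by move=> t _; congr g; lra.
rewrite (IH (fun s => g ((1 + s) / 2))) (IH (fun s => g (s / 2))) mul0r addr0 exprS.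
have -> : ((1 + 1) / 2 : R) = 1 by lra.
by field; rewrite expf_neq0.
Qed.

End DyadicIntegral.

(** * Integrals along segments and uniform continuity *)

Section LineIntegral.
Context {R : realType}.
Local Notation C := R[i].
Implicit Types (f : C -> C) (a b z w : C).

Definition ccont f z := forall e : R, 0 < e -> exists2 d : R, 0 < d &
    forall w, cabs (w - z) < d -> cabs (f w - f z) < e.

Definition seg a b (t : R) : C := a + t%:C * (b - a).

Lemma seg_dist a b s t : cabs (seg a b s - seg a b t) = `|s - t| * cabs (b - a).
Proof.
have -> : seg a b s - seg a b t = (s - t)%:C * (b - a).
  by rewrite /seg rmorphB/=; ring.
by rewrite cabsM cabs_real.
Qed.

Lemma seg_cabs a b c t (r : R) : 0 <= t <= 1 ->
  cabs (a - c) <= r -> cabs (b - c) <= r -> cabs (seg a b t - c) <= r.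
Proof.
move=> /andP[t0 t1] ha hb.
have -> : seg a b t - c = (1 - t)%:C * (a - c) + t%:C * (b - c).
  by rewrite /seg rmorphB/= rmorph1; ring.
apply: le_trans (cabsD _ _) _; rewrite !cabsM !cabs_real !ger0_norm// ?subr_ge0//.
have t1' : 0 <= 1 - t by lra.
have := ler_wpM2l t0 hb; have := ler_wpM2l t1' ha; lra.
Qed.

(** Two extractions, for the real and then the imaginary part. Of the indices only [n <= phi n] is
    kept, which is what limits along [phi] use. *)
Lemma bw_complex (u : nat -> C) (M : R) : (forall n, cabs (u n) <= M) ->
  exists2 phi : nat -> nat, (forall n, (n <= phi n)%N) &
    exists l, clim (u \o phi) l.
Proof.
move=> uM.
have bd (p : C -> R) (v : nat -> C) : (forall z, `|p z| <= cabs z) ->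
    (forall n, cabs (v n) <= M) -> bounded_fun (p \o v).
  move=> pl vM; exists M; split; first exact: num_real.
  move=> x Mx n _ /=; apply: le_trans (pl _) _; apply: le_trans (vM _) _; exact: ltW.
have [p pi pc] := bolzano_weierstrass (bd _ _ cabs_Re uM).
have [q qi qc] := bolzano_weierstrass (bd (@complex.Im R) (u \o p) cabs_Im (fun n => uM _)).
have ge (h : nat -> nat) : increasing_seq h -> forall n, (n <= h n)%N.
  move=> hi; elim=> // n IH; apply: leq_ltn_trans IH _.
  by have /increasing_seqP := hi; exact.
exists (p \o q) => [n|]; first by apply: leq_trans (ge _ qi n) _; exact: ge.
exists (limn (@complex.Re R \o u \o p) +i* limn (@complex.Im R \o (u \o p) \o q)).
apply: clim_ReIm => //=.
have : (fun n => (@complex.Re R \o u \o p) (q n)) @ \oo --> limn (@complex.Re R \o u \o p).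
  apply: (cvg_comp _ _ _ pc).
  move=> A [N _ hA]; exists N => // n /= Nn; apply: hA; exact: leq_trans Nn (ge _ qi n).
by [].
Qed.

Lemma ccont_unif f c (r : R) : (forall z, cabs (z - c) <= r -> ccont f z) ->
  forall e : R, 0 < e -> exists2 d : R, 0 < d &
    forall z w, cabs (z - c) <= r -> cabs (w - c) <= r -> cabs (z - w) < d ->
      cabs (f z - f w) < e.
Proof.
move=> fc e e0; apply: contrapT => H.
(* Heine-Cantor by contradiction: bad pairs at distance below [2 ^- n] accumulate at a single point,
   where continuity is violated. *)
have h n : exists p : C * C, [/\ cabs (p.1 - c) <= r, cabs (p.2 - c) <= r,
    cabs (p.1 - p.2) < (2 ^+ n)^-1 & e <= cabs (f p.1 - f p.2)].
  apply: contrapT => Hn; apply: H; exists (2 ^+ n)^-1; first by rewrite invr_gt0 exprn_gt0.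
  move=> z w hz hw zw; rewrite ltNge; apply/negP => he; apply: Hn.
  by exists (z, w).
have [p hp] := choice h.
have [phi hphi [l hl]] := @bw_complex (fun n => (p n).1 - c) r (fun n => let: And4 h _ _ _ := hp n in h).
have lr : cabs (l + c - c) <= r.
  rewrite addrK; apply: clim_cabs_le hl _; exists 0%N => n _ /=.
  by case: (hp (phi n)).
have e2 : 0 < e / 2 by rewrite divr_gt0.
have [d d0 hd] := fc _ lr _ e2.
have d2 : 0 < d / 2 by rewrite divr_gt0.
have /climP/(_ _ d2)[N hN] := hl.
have [K hK] := half_pow_lt d2.
set n := maxn N K; have /= h1 := hN n (leq_maxl _ _).
have [_ _ h2 h3] := hp (phi n).
have h4 : cabs ((p (phi n)).1 - (p (phi n)).2) < d / 2.
  apply: lt_trans h2 _; apply: le_lt_trans hK.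
  rewrite lef_pV2 ?posrE ?exprn_gt0// ler_weXn2l ?ler1n//.
  exact: leq_trans (leq_maxr N K) (hphi n).
have h5 := hd (p (phi n)).1; have h6 := hd (p (phi n)).2.
have e1 : (p (phi n)).1 - (l + c) = (p (phi n)).1 - c - l by ring.
have e3 : (p (phi n)).2 - (l + c) = ((p (phi n)).1 - c - l) - ((p (phi n)).1 - (p (phi n)).2) by ring.
have h7 := h5 (_ : _ < d); have h8 := h6 (_ : _ < d).
have h9 : cabs (f (p (phi n)).1 - f (l + c)) < e / 2 by apply: h7; rewrite e1; lra.
have h10 : cabs (f (p (phi n)).2 - f (l + c)) < e / 2.
  by apply: h8; rewrite e3; apply: le_lt_trans (cabsB _ _) _; lra.
have := cabsB (f (p (phi n)).1 - f (l + c)) (f (p (phi n)).2 - f (l + c)).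
have -> : f (p (phi n)).1 - f (l + c) - (f (p (phi n)).2 - f (l + c)) =
  f (p (phi n)).1 - f (p (phi n)).2 by ring.
lra.
Qed.

Definition J f a b : C := (b - a) * dint (fun t => f (seg a b t)).

End LineIntegral.

(** * Goursat's lemma for triangles *)

Section Goursat.
Context {R : realType}.
Local Notation C := R[i].
Implicit Types (f : C -> C) (a b c z w : C) (r : R).

Definition con f c r := forall z, cabs (z - c) < r -> ccont f z.

Lemma seg_ucont f c r a b : con f c r -> cabs (a - c) < r -> cabs (b - c) < r ->
  ucont (fun t => f (seg a b t)).
Proof.
move=> fc ar br e e0; set r1 := Num.max (cabs (a - c)) (cabs (b - c)).
have r1r : r1 < r by rewrite gt_max ar.
have [|d d0 hd] := @ccont_unif R f c r1 _ e e0.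
  by move=> z hz; apply: fc; exact: le_lt_trans hz r1r.
have B0 : 0 < cabs (b - a) + 1 by rewrite ltr_wpDl.
exists (d / (cabs (b - a) + 1)); first by rewrite divr_gt0.
have hs t : 0 <= t <= 1 -> cabs (seg a b t - c) <= r1.
  by move=> t01; apply: seg_cabs => //; rewrite le_max lexx ?orbT.
move=> s t s0 t0 st; apply: hd; rewrite ?hs// seg_dist.
move: st; rewrite ltr_pdivlMr//; have := normr_ge0 (s - t); nra.
Qed.

Lemma seg_in a b c t r : 0 <= t <= 1 ->
  cabs (a - c) < r -> cabs (b - c) < r -> cabs (seg a b t - c) < r.
Proof.
move=> t01 ar br; apply: (@le_lt_trans _ _ (Num.max (cabs (a - c)) (cabs (b - c)))).
  by apply: seg_cabs => //; rewrite le_max lexx ?orbT.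
by rewrite gt_max ar.
Qed.

(** Bisection is built into [dsum]: level [n + 1] on the segment is the mean of level [n] on its two
    halves, so additivity holds before the limit. *)
Lemma J_mid f c r a b : con f c r -> cabs (a - c) < r -> cabs (b - c) < r ->
  J f a b = J f a ((a + b) / 2) + J f ((a + b) / 2) b.
Proof.
move=> fc ar br; set m := (a + b) / 2.
have mE : m = seg a b (1 / 2).
  by rewrite /seg rmorphM/= fmorphV/= rmorph1 rmorph_nat /m; field.
have mr : cabs (m - c) < r by rewrite mE; apply: seg_in => //; apply/andP; split; lra.
have h1 := dintP (seg_ucont fc ar br); have h2 := dintP (seg_ucont fc ar mr).
have h3 := dintP (seg_ucont fc mr br).
rewrite /J; suff -> : dint (fun t => f (seg a b t)) =
   (dint (fun t => f (seg a m t)) + dint (fun t => f (seg m b t))) / 2.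
  by rewrite /m; field.
apply: dint_clim.
have h4 := climM (climD h2 h3) (clim_cst (2^-1 : C)).
have S (v : nat -> C) l : clim (fun n => v n.+1) l -> clim v l.
  by rewrite /clim -(@cvg_shiftS _ (fun n => cabs (v n - l))).
have hC (t : R) : (t / 2)%:C = t%:C / 2 :> C by rewrite rmorphM/= fmorphV/= rmorph_nat.
apply: S; apply: clim_ext h4 => n /=; congr ((_ + _) / 2);
  by apply: dsum_ext => t _; congr f; rewrite /seg /m hC ?rmorphD/= ?rmorph1; field.
Qed.

Lemma clim_half (a : C) : clim (fun n => a / 2 ^+ n) 0.
Proof.
apply: (@clim_le _ _ _ (fun n => cabs a * (2^-1) ^+ n)).
  by move=> n; rewrite subr0 cabsM cabsV cabsX cabs2 exprVn.
rewrite -(mulr0 (cabs a)); apply: cvgMr => //; apply: cvg_expr.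
by rewrite ger0_norm//; lra.
Qed.

Lemma J_rev f c r a b : con f c r -> cabs (a - c) < r -> cabs (b - c) < r ->
  J f b a = - J f a b.
Proof.
move=> fc ar br; have h1 := dintP (seg_ucont fc ar br).
rewrite /J -[RHS]mulNr opprB; congr (_ * _); apply: dint_clim.
rewrite -[dint _]addr0.
apply: clim_ext (climD h1 (clim_half (f (seg a b 1) - f (seg a b 0)))) => n /=.
rewrite -(@dsum_rev _ n (fun t => f (seg a b t))); apply: dsum_ext => t _.
by congr f; rewrite /seg rmorphB/= rmorph1; ring.
Qed.

(** For an affine integrand the dyadic sum is explicit by [dsum_id] and tends to the value at the
    midpoint; what remains is the deviation from the affine function. *)
Lemma J_approx f a b (al be : C) (e : R) : ucont (fun t => f (seg a b t)) ->
  (forall t, 0 <= t <= 1 -> cabs (f (seg a b t) - (al + be * seg a b t)) <= e) ->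
  cabs (J f a b - (b - a) * (al + be * ((a + b) / 2))) <= cabs (b - a) * e.
Proof.
move=> fu fe; rewrite /J -mulrBr cabsM; apply: ler_wpM2l => //.
have h := climB (dintP fu) (clim_cst (al + be * ((a + b) / 2))).
have h2 := climD h (climN (clim_half (- be * (b - a) / 2))).
rewrite oppr0 addr0 in h2.
apply: (clim_cabs_le h2); exists 0%N => n _ /=.
suff -> : dsum n (fun t => f (seg a b t)) - (al + be * ((a + b) / 2)) -
    - be * (b - a) / 2 / 2 ^+ n =
    dsum n (fun t => f (seg a b t) - (al + be * seg a b t)).
  exact: dsum_le.
rewrite dsumB (@dsum_ext _ n (fun t => al + be * seg a b t)
  (fun t => al + be * a + be * (b - a) * t%:C)); last first.
  by move=> t _; rewrite /seg; ring.
rewrite dsumD dsum_cst dsumZ dsum_id; field; by rewrite expf_neq0.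
Qed.

Definition tri f a b c := J f a b + J f b c + J f c a.
Definition per a b c := cabs (b - a) + cabs (c - b) + cabs (a - c).

Lemma cabs_half z : cabs (z / 2) = cabs z / 2.
Proof. by rewrite cabsM cabsV cabs2. Qed.

Lemma clim_geo (u : nat -> C) (A : R) : 0 <= A ->
  (forall n, cabs (u n.+1 - u n) <= A / 2 ^+ n) ->
  exists2 l, clim u l & forall m, cabs (l - u m) <= 2 * A / 2 ^+ m.
Proof.
move=> A0 uA; apply: clim_cauchy; last first.
  have := @cvg_geometric R (2 * A) 2^-1; rewrite ger0_norm// => h.
  have : (2^-1 : R) < 1 by lra.
  by move=> /h; rewrite /geometric/=; under eq_fun do rewrite exprVn.
move=> m n /subnKC <-; move: (n - m)%N => k; elim: k m => [|k IH] m.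
  by rewrite addn0 subrr cabs0 divr_ge0 ?mulr_ge0// exprn_ge0.
rewrite addnS -addSn; have -> : u (m.+1 + k)%N - u m = (u (m.+1 + k)%N - u m.+1) + (u m.+1 - u m) by ring.
apply: le_trans (cabsD _ _) _; have := IH m.+1; have := uA m.
rewrite exprS invfM; set q := (2 ^+ m)^-1; move=> h1 h2.
lra.
Qed.

(** Repeated bisection: each step divides the integral by at most 4 and the perimeter by 2. Near the
    limit point [f] is affine up to [e'] times the distance, so the integral over a small triangle
    is at most a small multiple of its squared perimeter, which compensates the factors 4. *)
Lemma goursat f c0 (r : R) a b c :
  (forall z, cabs (z - c0) < r -> exists l, cdiff f z l) ->
  cabs (a - c0) < r -> cabs (b - c0) < r -> cabs (c - c0) < r ->
  tri f a b c = 0.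
Proof.
move=> fd ar br cr.
have fc : con f c0 r by move=> z /fd[l /cdiff_continuous h].
set r1 := Num.max (cabs (a - c0)) (Num.max (cabs (b - c0)) (cabs (c - c0))).
have r1r : r1 < r by rewrite !gt_max ar br cr.
pose inK (T : C * C * C) := [/\ cabs (T.1.1 - c0) <= r1, cabs (T.1.2 - c0) <= r1
  & cabs (T.2 - c0) <= r1].
pose tT (T : C * C * C) := tri f T.1.1 T.1.2 T.2.
pose pT (T : C * C * C) := per T.1.1 T.1.2 T.2.
(* [T'] is the one among the four medial triangles that carries at least a quarter of the integral;
   outside [inK] any value will do. *)
have step (T : C * C * C) : exists T' : C * C * C, inK T ->
    [/\ inK T', cabs (tT T) <= 4 * cabs (tT T'), pT T' = pT T / 2
      & cabs (T'.1.1 - T.1.1) <= pT T].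
  have [hT|hT] := pselect (inK T); last by exists T.
  move: T hT => [[x y] z] [/= hx hy hz].
  have mid u v : cabs (u - c0) <= r1 -> cabs (v - c0) <= r1 -> cabs ((u + v) / 2 - c0) <= r1.
    move=> hu hv; have -> : (u + v) / 2 - c0 = (u - c0) / 2 + (v - c0) / 2 by field.
    by apply: le_trans (cabsD _ _) _; rewrite !cabs_half; lra.
  have K w : cabs (w - c0) <= r1 -> cabs (w - c0) < r by move=> h; exact: le_lt_trans h r1r.
  set xy := (x + y) / 2; set yz := (y + z) / 2; set zx := (z + x) / 2.
  have hxy : cabs (xy - c0) <= r1 by exact: mid.
  have hyz : cabs (yz - c0) <= r1 by exact: mid.
  have hzx : cabs (zx - c0) <= r1 by exact: mid.
  have E : tri f x y z = tri f x xy zx + tri f xy y yz + tri f zx yz z + tri f yz zx xy.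
    rewrite /tri (J_mid fc (K _ hx) (K _ hy)) (J_mid fc (K _ hy) (K _ hz)) (J_mid fc (K _ hz) (K _ hx)).
    rewrite -/xy -/yz -/zx (J_rev fc (K _ hxy) (K _ hzx)) (J_rev fc (K _ hxy) (K _ hyz)).
    rewrite (J_rev fc (K _ hzx) (K _ hyz)).
    move: (J f x xy) (J f xy y) (J f y yz) (J f yz z) (J f z zx) (J f zx x).
    by move: (J f xy zx) (J f zx yz) (J f xy yz) => *; ring.
  have dx : cabs (xy - x) = cabs (y - x) / 2.
    by rewrite -cabs_half; congr cabs; rewrite /xy; field.
  have hf u v : cabs (u - v) / 2 = cabs ((u - v) / 2 : C) by rewrite cabs_half.
  have P1 : per x xy zx = per x y z / 2.
    rewrite /per !mulrDl !hf; congr (_ + _ + _).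
    - by congr cabs; rewrite /xy; field.
    - by congr cabs; rewrite /xy /zx; field.
    - by congr cabs; rewrite /zx; field.
  have P2 : per xy y yz = per x y z / 2.
    rewrite /per !mulrDl !hf; congr (_ + _ + _).
    - by congr cabs; rewrite /xy; field.
    - by congr cabs; rewrite /yz; field.
    - by congr cabs; rewrite /xy /yz; field.
  have P3 : per zx yz z = per x y z / 2.
    rewrite /per !mulrDl !hf; congr (_ + _ + _).
    - by congr cabs; rewrite /zx /yz; field.
    - by congr cabs; rewrite /yz; field.
    - by congr cabs; rewrite /zx; field.
  have P4 : per yz zx xy = per x y z / 2.
    rewrite /per !mulrDl !hf; congr (_ + _ + _).
    - by rewrite -cabsN; congr cabs; rewrite /zx /yz; field.
    - by rewrite -cabsN; congr cabs; rewrite /xy /zx; field.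
    - by rewrite -cabsN; congr cabs; rewrite /xy /yz; field.
  have p0 : 0 <= per x y z by rewrite /per !addr_ge0.
  have D1 : cabs (x - x) <= per x y z by rewrite subrr cabs0.
  have D2 : cabs (xy - x) <= per x y z.
    rewrite dx; have := cabs_ge0 (y - x); have := cabs_ge0 (z - y); have := cabs_ge0 (x - z).
    rewrite /per; lra.
  have D3 : cabs (zx - x) <= per x y z.
    have -> : zx - x = - (x - z) / 2 by rewrite /zx; field.
    rewrite cabs_half cabsN.
    have := cabs_ge0 (y - x); have := cabs_ge0 (z - y); have := cabs_ge0 (x - z).
    rewrite /per; lra.
  have D4 : cabs (yz - x) <= per x y z.
    have -> : yz - x = (y - x) / 2 - (x - z) / 2 by rewrite /yz; field.
    apply: le_trans (cabsB _ _) _; rewrite !cabs_half.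
    have := cabs_ge0 (y - x); have := cabs_ge0 (z - y); have := cabs_ge0 (x - z).
    rewrite /per; lra.
  have M : cabs (tri f x y z) <= cabs (tri f x xy zx) + cabs (tri f xy y yz) +
      cabs (tri f zx yz z) + cabs (tri f yz zx xy).
    rewrite E; apply: le_trans (cabsD _ _) _; rewrite lerD2r.
    by apply: le_trans (cabsD _ _) _; rewrite lerD2r; exact: cabsD.
  rewrite /tT /pT /inK /=.
  have [h1|h1] := leP (cabs (tri f x y z)) (4 * cabs (tri f x xy zx)).
    by exists (x, xy, zx).
  have [h2|h2] := leP (cabs (tri f x y z)) (4 * cabs (tri f xy y yz)).
    by exists (xy, y, yz).
  have [h3|h3] := leP (cabs (tri f x y z)) (4 * cabs (tri f zx yz z)).
    by exists (zx, yz, z).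
  exists (yz, zx, xy) => _; split => //=; lra.
have [st hst] := choice step.
pose T n := iter n st (a, b, c).
have inT n : inK (T n).
  elim: n => [|n IH]; last by have [] := hst _ IH.
  by split => /=; rewrite /r1 !le_max lexx ?orbT.
have hT n := hst _ (inT n).
set L := per a b c; have L0 : 0 <= L by rewrite /L /per !addr_ge0.
have pTn n : pT (T n) = L / 2 ^+ n.
  elim: n => [|n IH]; first by rewrite expr0 divr1.
  by have [_ _ -> _] := hT n; rewrite IH exprS invfM; lra.
have tTn n : cabs (tri f a b c) <= 4 ^+ n * cabs (tT (T n)).
  elim: n => [|n IH]; first by rewrite expr0 mul1r.
  apply: le_trans IH _; have [_ h _ _] := hT n.
  by rewrite exprSr -mulrA ler_wpM2l// exprn_ge0.
have [|z zl zd] := @clim_geo (fun n => (T n).1.1) L L0.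
  by move=> n; have [_ _ _] := hT n; rewrite pTn.
have zr : cabs (z - c0) < r.
  apply: le_lt_trans r1r; apply: (clim_cabs_le (climB zl (clim_cst c0))).
  by exists 0%N => n _; have [] := inT n.
have [l hl] := fd _ zr.
apply/eqP; rewrite -cabs_eq0; apply/eqP/le_anti; rewrite cabs_ge0 andbT.
apply/ler_addgt0Pr => e e0; rewrite add0r.
have K0 : 0 < 3 * (L + 1) ^+ 2 by have := sqr_ge0 L; nra.
have e1 : 0 < e / (3 * (L + 1) ^+ 2) by rewrite divr_gt0.
have [d d0 hd] := hl _ e1; set e' := e / (3 * (L + 1) ^+ 2) in e1 hd.
have d1 : 0 < d / (3 * (L + 1)) by rewrite divr_gt0//; lra.
have [N hN] := half_pow_lt d1.
have hN' : 3 * (L + 1) / 2 ^+ N < d.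
  by move: hN; rewrite ltr_pdivlMr ?mulr_gt0//; lra.
apply: le_trans (tTn N) _.
set x := (T N).1.1; set y := (T N).1.2; set w := (T N).2.
have [ix iy iw] := inT N; rewrite -/x -/y -/w in ix iy iw.
have pN : per x y w = L / 2 ^+ N := pTn N.
have xz : cabs (x - z) <= 2 * L / 2 ^+ N by rewrite cabs_subC; exact: zd.
set q := (2 ^+ N)^-1 : R; have q0 : 0 < q by rewrite invr_gt0 exprn_gt0.
have K u : cabs (u - c0) <= r1 -> cabs (u - c0) < r by move=> h; exact: le_lt_trans h r1r.
have yz : cabs (y - z) <= 3 * L * q.
  have -> : y - z = (y - x) + (x - z) by ring.
  apply: le_trans (cabsD _ _) _; move: pN; rewrite /per -/q => pN.
  have := cabs_ge0 (w - y); have := cabs_ge0 (x - w); rewrite -/q in xz; lra.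
have wz : cabs (w - z) <= 3 * L * q.
  have -> : w - z = - (x - w) + (x - z) by ring.
  apply: le_trans (cabsD _ _) _; rewrite cabsN; move: pN; rewrite /per -/q => pN.
  have := cabs_ge0 (w - y); have := cabs_ge0 (y - x); rewrite -/q in xz; lra.
have xz' : cabs (x - z) <= 3 * L * q by rewrite -/q in xz; nra.
have Jb u v : cabs (u - c0) <= r1 -> cabs (v - c0) <= r1 ->
    cabs (u - z) <= 3 * L * q -> cabs (v - z) <= 3 * L * q ->
    cabs (J f u v - (v - u) * ((f z - l * z) + l * ((u + v) / 2))) <= cabs (v - u) * (e' * (3 * L * q)).
  move=> hu hv uz vz; apply: J_approx; first exact: (seg_ucont fc (K _ hu) (K _ hv)).
  move=> t t01; have h1 := seg_cabs t01 uz vz.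
  have -> : f (seg u v t) - (f z - l * z + l * seg u v t) =
     f (z + (seg u v t - z)) - f z - l * (seg u v t - z).
    by rewrite [z + _]addrC subrK; ring.
  apply: le_trans (hd _ _) _; last by apply: ler_wpM2l (ltW e1) _ _ h1.
  apply: le_lt_trans h1 _; apply: lt_trans hN'; rewrite -/q; nra.
(* The midpoint values of the affine function telescope to zero around the triangle, so they may be
   subtracted side by side. *)
have -> : tT (T N) = (J f x y - (y - x) * ((f z - l * z) + l * ((x + y) / 2))) +
   (J f y w - (w - y) * ((f z - l * z) + l * ((y + w) / 2))) +
   (J f w x - (x - w) * ((f z - l * z) + l * ((w + x) / 2))).
  by rewrite /tT /tri -/x -/y -/w; field.
have B1 := Jb _ _ ix iy xz' yz; have B2 := Jb _ _ iy iw yz wz; have B3 := Jb _ _ iw ix wz xz'.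
have B : cabs ((J f x y - (y - x) * ((f z - l * z) + l * ((x + y) / 2))) +
   (J f y w - (w - y) * ((f z - l * z) + l * ((y + w) / 2))) +
   (J f w x - (x - w) * ((f z - l * z) + l * ((w + x) / 2)))) <= (L * q) * (e' * (3 * L * q)).
  apply: le_trans (cabsD _ _) _; apply: le_trans (lerD (cabsD _ _) (lexx _)) _.
  have <- : cabs (y - x) + cabs (w - y) + cabs (x - w) = L * q by exact: pN.
  by apply: le_trans (lerD (lerD B1 B2) B3) _; rewrite -!mulrDl.
apply: le_trans (ler_wpM2l _ B) _; first by rewrite exprn_ge0.
have -> : (4 : R) ^+ N = q^-1 * q^-1 by rewrite /q invrK -exprMn; congr (_ ^+ _); lra.
have -> : q^-1 * q^-1 * (L * q * (e' * (3 * L * q))) = e' * (3 * L ^+ 2).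
  by field; rewrite gt_eqF.
rewrite /e' mulrAC ler_pdivrMr// ler_pM2l//; nra.
Qed.

End Goursat.

(** * Power series *)

Section PowerSeries.
Context {R : realType}.
Local Notation C := R[i].
Implicit Types (f g : C -> C) (c : nat -> C) (a b z w : C) (r : R).

Lemma geo_cvg (K q : R) : 0 <= q < 1 -> cvgn (series (fun n => K * q ^+ n)).
Proof.
by move=> /andP[q0 q1]; apply: (@is_cvg_geometric_series R K q); rewrite ger0_norm.
Qed.

Lemma geo_lim (K q : R) : 0 <= q < 1 ->
  limn (series (fun n => K * q ^+ n)) = K / (1 - q).
Proof.
move=> /andP[q0 q1]; apply: cvg_lim => //.
by apply: (@cvg_geometric_series R K q); rewrite ger0_norm.
Qed.

(** [1 - q^n] is [1 - q] times a sum of [n] powers, each at least [q^n]. For [q < 1] this bounds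
    [n q^n] by [1 / (1 - q)]. *)
Lemma nq_le (q : R) n : 0 <= q <= 1 -> n%:R * (1 - q) * q ^+ n <= 1 - q ^+ n.
Proof.
move=> /andP[q0 q1]; elim: n => [|n IH]; first by rewrite !mul0r expr0 subrr.
rewrite exprS -natr1; have qn0 := exprn_ge0 n q0.
have qn1 : q ^+ n <= 1 by rewrite exprn_ile1.
have : q * (n%:R * (1 - q) * q ^+ n) <= q * (1 - q ^+ n) by exact: ler_wpM2l.
have : (1 - q) * (q * q ^+ n) <= 1 - q.
  rewrite ler_piMr ?subr_ge0// -[leRHS]mulr1; apply: ler_pM => //.
nra.
Qed.

Lemma n2q_cvg (q : R) : 0 <= q < 1 -> cvgn (series (fun n => n%:R ^+ 2 * q ^+ n)).
Proof.
(* With [p] the fourth root of [q], [n^2 q^n] is [(n p^n)^2 s^n]: the square is bounded and [s^n] is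
   summable. *)
move=> /andP[q0 q1]; set s := Num.sqrt q; set p := Num.sqrt s.
have s0 : 0 <= s by exact: sqrtr_ge0.
have p0 : 0 <= p by exact: sqrtr_ge0.
have s1 : s < 1 by rewrite -sqrtr1 ltr_sqrt.
have p1 : p < 1 by rewrite -sqrtr1 ltr_sqrt.
have sE : s = p ^+ 2 by rewrite sqr_sqrtr.
have qE : q = s ^+ 2 by rewrite sqr_sqrtr.
apply: (@series_le_cvg _ _ (fun n => ((1 - p) ^- 2) * s ^+ n)) => [n|n|n|].
- by rewrite mulr_ge0 ?exprn_ge0.
- by rewrite mulr_ge0 ?exprn_ge0// invr_ge0 exprn_ge0// subr_ge0 ltW.
- have h : n%:R * p ^+ n <= (1 - p)^-1.
    rewrite -[leRHS]mul1r ler_pdivlMr ?subr_gt0//.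
    have := @nq_le p n; rewrite p0 (ltW p1) => /(_ isT).
    have := exprn_ge0 n p0; lra.
  have -> : n%:R ^+ 2 * q ^+ n = (n%:R * p ^+ n) ^+ 2 * s ^+ n.
    by rewrite exprMn (exprAC p) -sE qE (exprAC s 2) [in LHS](expr2 (s ^+ n)) mulrA.
  rewrite ler_wpM2r ?exprn_ge0// -exprVn ler_pXn2r// nnegrE.
    by rewrite mulr_ge0 ?exprn_ge0.
  by rewrite invr_ge0 subr_ge0 ltW.
- by apply: geo_cvg; rewrite s0.
Qed.

Lemma clim_bounded (u : nat -> C) l : clim u l -> exists K, forall n, cabs (u n) <= K.
Proof.
move=> /clim_cabs h; have [K hK] := cvg_has_ub (cvgP _ h).
exists K => n; apply: hK; exists n => //=; by rewrite ger0_norm.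
Qed.

Lemma csum_term0 (u : nat -> C) l : csum u l -> clim u 0.
Proof.
move=> h; have S : clim (fun n => series u n.+1) l.
  by move: h; rewrite /csum /clim -(@cvg_shiftS _ (fun n => cabs (series u n - l))).
have := climB S h; rewrite subrr; apply: clim_ext => n.
by rewrite seriesSB.
Qed.

Definition ps c z l := csum (fun k => c k * z ^+ k) l.

Definition psbd c r := exists K, forall k, cabs (c k) * r ^+ k <= K.

Lemma ps_bounded c z l : ps c z l -> psbd c (cabs z).
Proof.
move=> /csum_term0/clim_bounded[K hK]; exists K => k.
by have := hK k; rewrite cabsM cabsX.
Qed.

Lemma ps_terms c r (K : R) z k : 0 < r -> (forall k, cabs (c k) * r ^+ k <= K) ->
  cabs (c k * z ^+ k) <= K * (cabs z / r) ^+ k.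
Proof.
move=> r0 h; rewrite cabsM cabsX expr_div_n mulrA ler_pdivlMr ?exprn_gt0//.
by rewrite mulrAC ler_wpM2r// exprn_ge0.
Qed.

Lemma ratio_lt1 r z : cabs z < r -> 0 <= cabs z / r < 1.
Proof.
move=> h; have r0 : 0 < r := le_lt_trans (cabs_ge0 _) h.
by rewrite divr_ge0 ?(ltW r0)//= ltr_pdivrMr// mul1r.
Qed.

Lemma ps_bounded_in c r : (forall w, cabs w < r -> exists l, ps c w l) ->
  forall s, 0 <= s < r -> psbd c s.
Proof.
move=> h s /andP[s0 sr]; have [|l /ps_bounded] := h s%:C.
  by rewrite cabs_real ger0_norm.
by rewrite cabs_real ger0_norm.
Qed.

(** The second-order Taylor remainder of a power. The factor [s^2] stands on the left so that no
    power [s^(n - 2)] appears. *)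
Lemma pow_quad z h (s : R) n : cabs z <= s -> cabs (z + h) <= s ->
  s ^+ 2 * cabs ((z + h) ^+ n - z ^+ n - n%:R * h * z ^+ n.-1)
    <= n%:R ^+ 2 * cabs h ^+ 2 * s ^+ n.
Proof.
move=> hz hzh; have s0 : 0 <= s := le_trans (cabs_ge0 _) hz.
elim: n => [|n IH].
  by rewrite !expr0 subrr !mul0r subrr cabs0 mulr0 expr0n/= !mul0r.
have -> : (z + h) ^+ n.+1 - z ^+ n.+1 - n.+1%:R * h * z ^+ n.+1.-1 =
   (z + h) * ((z + h) ^+ n - z ^+ n - n%:R * h * z ^+ n.-1) + n%:R * h ^+ 2 * z ^+ n.-1.
  rewrite !exprS /= -natr1; case: n {IH} => [|n] /=; first by rewrite !expr0; ring.
  by rewrite !exprS; ring.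
apply: le_trans (ler_wpM2l (sqr_ge0 _) (cabsD _ _)) _; rewrite mulrDr !cabsM !cabsX cabs_nat.
have zn : s * (n%:R * cabs z ^+ n.-1) <= n%:R * s ^+ n.
  case: n {IH} => [|n] /=; first by rewrite !mul0r mulr0.
  rewrite mulrCA ler_wpM2l// exprS ler_wpM2l//.
  by rewrite lerXn2r ?nnegrE.
have h1 : s ^+ 2 * (cabs (z + h) * cabs ((z + h) ^+ n - z ^+ n - n%:R * h * z ^+ n.-1)) <=
    s * (n%:R ^+ 2 * cabs h ^+ 2 * s ^+ n).
  by rewrite mulrCA; apply: ler_pM => //; rewrite mulr_ge0 ?exprn_ge0.
have h2 : s ^+ 2 * (n%:R * cabs h ^+ 2 * cabs z ^+ n.-1) <= s * (cabs h ^+ 2 * (n%:R * s ^+ n)).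
  have -> : s ^+ 2 * (n%:R * cabs h ^+ 2 * cabs z ^+ n.-1) = s * (cabs h ^+ 2 * (s * (n%:R * cabs z ^+ n.-1))) by ring.
  by rewrite ler_wpM2l// ler_wpM2l// sqr_ge0.
apply: le_trans (lerD h1 h2) _; rewrite (exprS s) -natr1.
have := mulr_ge0 (sqr_ge0 (cabs h)) (mulr_ge0 s0 (exprn_ge0 n s0)).
set H := cabs h ^+ 2; set S := s ^+ n.
have : 0 <= n%:R :> R by []. nra.
Qed.

Lemma ps_cdiff c f r z : (forall w, cabs w < r -> ps c w (f w)) -> cabs z < r ->
  exists2 l, ps (fun k => k.+1%:R * c k.+1) z l & cdiff f z l.
Proof.
(* Three nested radii: the coefficients are bounded at [r1], the points [z] and [z + h] stay within
   [s], and the ratio [s / r1] leaves room for a factor [k^2]. *)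
move=> fps zr; set s := (cabs z + r) / 2; set r1 := (s + r) / 2.
have zs : cabs z < s by rewrite /s; lra.
have sr1 : s < r1 by rewrite /r1 /s; lra.
have r1r : r1 < r by rewrite /r1 /s; lra.
have s0 : 0 < s := le_lt_trans (cabs_ge0 _) zs.
have r0 : 0 < r1 by apply: lt_trans sr1.
have [|K hK] := @ps_bounded_in c r (fun w h => ex_intro _ _ (fps w h)) r1; first by rewrite (ltW r0).
have K0 : 0 <= K by apply: le_trans (hK 0%N); rewrite mulr_ge0// expr0.
set q := s / r1; have q01 : 0 <= q < 1.
  by rewrite divr_ge0 ?(ltW s0) ?(ltW r0)//= ltr_pdivrMr// mul1r.
have cs k : cabs (c k) * s ^+ k <= K * q ^+ k.
  have -> : q ^+ k = s ^+ k / r1 ^+ k by rewrite expr_div_n.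
  rewrite mulrA ler_pdivlMr ?exprn_gt0// mulrAC ler_wpM2r//.
  by rewrite exprn_ge0 ?ltW.
have [L0 hL0] : exists l, csum (fun k => k%:R * c k * z ^+ k.-1) l.
  have [||l hl _] := @csum_tail _ (fun k => k%:R * c k * z ^+ k.-1)
      (fun k => (K / s) * (k%:R ^+ 2 * q ^+ k)); last by exists l.
    move=> k; rewrite !cabsM cabsX cabs_nat.
    case: k => [|k] /=; first by rewrite !mul0r expr0n/= mul0r mulr0.
    have h1 := cs k.+1; have zk : cabs z ^+ k <= s ^+ k.
      by rewrite lerXn2r ?nnegrE// ltW.
    have n1 : 1 <= k.+1%:R :> R by rewrite ler1n.
    have -> : K / s * (k.+1%:R ^+ 2 * q ^+ k.+1) = K * q ^+ k.+1 * k.+1%:R ^+ 2 / s by ring.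
    rewrite ler_pdivlMr//.
    have h2 : cabs (c k.+1) * cabs z ^+ k * s <= K * q ^+ k.+1.
      apply: le_trans h1; rewrite exprSr mulrA ler_wpM2r ?(ltW s0)// ler_wpM2l//.
    have h3 : K * q ^+ k.+1 * k.+1%:R <= K * q ^+ k.+1 * k.+1%:R ^+ 2.
      rewrite ler_wpM2l ?mulr_ge0 ?exprn_ge0 ?(andP q01).1//; case/andP: q01 => //; nra.
    have h4 : k.+1%:R * (cabs (c k.+1) * cabs z ^+ k * s) <= k.+1%:R * (K * q ^+ k.+1) by rewrite ler_wpM2l.
    apply: le_trans h3; rewrite [leRHS]mulrC; apply: le_trans h4.
    by rewrite !mulrA.
  have := n2q_cvg q01 => h; have := @is_cvg_seriesZ R _ (K / s) h; exact.
have hl1 : ps (fun k => k.+1%:R * c k.+1) z L0.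
  by apply: (csum_shift (fun k => k%:R * c k * z ^+ k.-1) L0).2; rewrite !mul0r add0r.
exists L0 => // e e0.
set S := limn (series (fun n => n%:R ^+ 2 * q ^+ n)).
have hS h : cabs h < s - cabs z ->
    cabs (f (z + h) - f z - L0 * h) <= (K / s ^+ 2 * cabs h ^+ 2) * S.
  move=> hh; have zhs : cabs (z + h) <= s by apply: le_trans (cabsD _ _) _; lra.
  have zhr : cabs (z + h) < r by lra.
  have h1 : csum (fun k => c k * ((z + h) ^+ k - z ^+ k - k%:R * h * z ^+ k.-1))
     (f (z + h) - f z - L0 * h).
    rewrite (mulrC L0).
    apply: csum_ext (csumB (csumB (fps _ zhr) (fps _ zr)) (csumZ h hL0)) => k.
    by ring.
  have -> : (K / s ^+ 2 * cabs h ^+ 2) * S = limn (series (fun n => (K / s ^+ 2 * cabs h ^+ 2) * (n%:R ^+ 2 * q ^+ n))).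
    by rewrite lim_seriesZ//; exact: n2q_cvg.
  apply: csum_le h1; last first.
    by have := @is_cvg_seriesZ R _ (K / s ^+ 2 * cabs h ^+ 2) (n2q_cvg q01).
  move=> k; rewrite cabsM; have h2 := @pow_quad z h s k (ltW zs) zhs.
  have s2 : 0 < s ^+ 2 by rewrite exprn_gt0.
  rewrite -(ler_pM2l s2) mulrCA.
  apply: le_trans (ler_wpM2l (cabs_ge0 _) h2) _.
  have -> : s ^+ 2 * (K / s ^+ 2 * cabs h ^+ 2 * (k%:R ^+ 2 * q ^+ k)) =
    (k%:R ^+ 2 * cabs h ^+ 2) * (K * q ^+ k) by field; rewrite gt_eqF.
  have -> : cabs (c k) * (k%:R ^+ 2 * cabs h ^+ 2 * s ^+ k) = (k%:R ^+ 2 * cabs h ^+ 2) * (cabs (c k) * s ^+ k) by ring.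
  by rewrite ler_wpM2l// mulr_ge0 ?sqr_ge0.
have S0 : 0 <= S.
  apply: limr_ge; first exact: n2q_cvg.
  apply: nearW => n; rewrite /series/=; apply: sumr_ge0 => k _.
  by rewrite mulr_ge0 ?sqr_ge0// exprn_ge0//; case/andP: q01.
set M := K / s ^+ 2 * S; have M0 : 0 <= M.
  by rewrite mulr_ge0// divr_ge0// exprn_ge0// ltW.
exists (Num.min (s - cabs z) (e / (M + 1))).
  by rewrite lt_min subr_gt0 zs divr_gt0// ltr_wpDl.
move=> h; rewrite lt_min => /andP[h1 h2]; apply: le_trans (hS h h1) _.
have -> : K / s ^+ 2 * cabs h ^+ 2 * S = M * cabs h * cabs h by rewrite /M; ring.
rewrite ler_wpM2r//; move: h2; rewrite ltr_pdivlMr ?ltr_wpDl// => h2.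
have := cabs_ge0 h; nra.
Qed.

Lemma csum_drop (u : nat -> C) k l : (forall j, (j < k)%N -> u j = 0) ->
  csum u l -> csum (fun j => u (j + k)%N) l.
Proof.
elim: k => [|k IH] h hu; first by apply: csum_ext hu => j; rewrite addn0.
have := IH (fun j jk => h j (leqW jk)) hu => h2.
rewrite (_ : (fun j => u (j + k.+1)%N) = fun j => (fun i => u (i + k)%N) j.+1); last first.
  by apply/funext => j; rewrite addnS addSn.
apply/(csum_shift (fun i => u (i + k)%N)); rewrite add0n h// add0r//.
Qed.

Lemma ps_shift c z l k : z != 0 -> (forall j, (j < k)%N -> c j = 0) ->
  ps c z l -> ps (fun j => c (j + k)%N) z (l / z ^+ k).
Proof.
move=> z0 ck h; have h1 : csum (fun j => c (j + k)%N * z ^+ (j + k)) l.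
  apply: (@csum_drop (fun j => c j * z ^+ j)) h => j jk.
  by rewrite ck// mul0r.
have := csumZ (z ^- k) h1; rewrite mulrC; apply: csum_ext => j.
by rewrite exprD; field; rewrite expf_neq0.
Qed.

Lemma ps0 c : ps c 0 (c 0%N).
Proof.
apply: (@csum_ext _ (fun k => if k is 0 then c 0%N else 0)) => [[|k]|].
- by rewrite expr0 mulr1.
- by rewrite expr0n mulr0.
rewrite -[X in csum _ X]addr0.
apply: (csum_shift (fun k => if k is 0 then c 0%N else 0) 0).1.
by apply: clim_ext (clim_cst 0) => n; rewrite /series/= big1.
Qed.

Lemma ps_cst a w : ps (fun k => if k is 0%N then a else 0) w a.
Proof.
have h : a = a * w ^+ 0 + 0 by rewrite expr0 mulr1 addr0.
rewrite /ps [X in csum _ X]h.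
apply: (csum_shift (fun k => (if k is 0%N then a else 0) * w ^+ k) 0).1.
by apply: clim_ext (clim_cst 0) => n; rewrite /series/= big1// => i _; rewrite mul0r.
Qed.

(** Zeros accumulating at 0 are enough: if the coefficients below [k] vanish, dividing by [w^k] at a
    zero [w] shows that [c k] is minus a tail of size [O(|w|)]. *)
Lemma ps_unique0 c f r : 0 < r -> (forall w, cabs w < r -> ps c w (f w)) ->
  (forall e : R, 0 < e -> exists w, [/\ w != 0, cabs w < e & f w = 0]) ->
  forall k, c k = 0.
Proof.
move=> r0 fps fz; set s := r / 2; have s0 : 0 < s by rewrite divr_gt0.
have [|K hK] := @ps_bounded_in c r (fun w h => ex_intro _ _ (fps w h)) s.
  by rewrite (ltW s0) /s; lra.
have K0 : 0 <= K by apply: le_trans (hK 0%N); rewrite mulr_ge0// expr0.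
elim/ltn_ind => k IH.
apply/eqP; rewrite -cabs_eq0; apply/eqP/le_anti; rewrite cabs_ge0 andbT.
apply/ler_addgt0Pr => e e0; rewrite add0r.
set M := 2 * (K / s ^+ k.+1); have M0 : 0 <= M by rewrite mulr_ge0// divr_ge0// exprn_ge0// ltW.
have [|w [w0 wd fw]] := fz (Num.min (s / 2) (e / (M + 1))).
  by rewrite lt_min !divr_gt0// ltr_wpDl.
move: wd; rewrite lt_min => /andP[ws we].
have wr : cabs w < r by rewrite /s in ws; lra.
have h1 := ps_shift w0 IH (fps _ wr); rewrite fw mul0r in h1.
have h2 : csum (fun j => c (j.+1 + k)%N * w ^+ j.+1) (- c k).
  apply/(csum_shift (fun j => c (j + k)%N * w ^+ j)).
  by rewrite add0n expr0 mulr1 subrr.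
have := @csum_le _ _ (fun j => (cabs w * (K / s ^+ k.+1)) * 2^-1 ^+ j) _ _ _ h2.
rewrite cabsN geo_lim; last by apply/andP; split; lra.
move=> h3; apply: le_trans (h3 _ _) _.
- move=> j; rewrite cabsM cabsX exprS mulrCA -!mulrA ler_wpM2l//.
  have := hK (j.+1 + k)%N; rewrite addSn -addnS exprD => h.
  have sj : 0 < s ^+ j by rewrite exprn_gt0.
  have sk : 0 < s ^+ k.+1 by rewrite exprn_gt0.
  apply: (@le_trans _ _ (cabs (c (j + k.+1)%N) * (s ^+ j / 2 ^+ j))).
    by rewrite ler_wpM2l// -expr_div_n lerXn2r ?nnegrE ?divr_ge0 ?(ltW s0)// ltW.
  rewrite exprVn mulrA mulrA ler_wpM2r ?invr_ge0 ?exprn_ge0// ler_pdivlMr//.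
  by rewrite -mulrA.
- by rewrite -geo_lim; [apply: geo_cvg|]; apply/andP; split; lra.
have -> : cabs w * (K / s ^+ k.+1) / (1 - 2^-1) = cabs w * M.
  rewrite /M; have -> : 1 - 2^-1 = 2^-1 :> R by lra.
  by rewrite invrK; ring.
by move: we; rewrite ltr_pdivlMr ?ltr_wpDl// => we; have := cabs_ge0 w; nra.
Qed.

Lemma csum_geo z : cabs z < 1 -> csum (fun k => z ^+ k) (1 - z)^-1.
Proof.
move=> z1; have z1' : 1 - z != 0.
  by rewrite subr_eq0; apply/eqP => h; rewrite -h cabs1 ltxx in z1.
have h : clim (fun n => z ^+ n) 0.
  apply: (@clim_le _ _ _ (fun n => cabs z ^+ n)) => [n|]; first by rewrite subr0 cabsX.
  by apply: cvg_expr; rewrite ger0_norm.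
have := climM (climB (clim_cst 1) h) (clim_cst (1 - z)^-1).
rewrite subr0 mul1r; apply: clim_ext => n; rewrite /series/= big_mkord.
by rewrite -[1 - z ^+ n]opprB subrX1 -mulNr opprB mulrC mulKf.
Qed.

End PowerSeries.

(** * Fourier coefficients on circles and Morera's theorem *)

Section Cauchy.
Context {R : realType}.
Local Notation C := R[i].
Implicit Types (f g : C -> C) (c : nat -> C) (a b z w : C) (r : R).

Definition rcont (g : R -> C) := forall t (e : R), 0 < e ->
  exists2 d : R, 0 < d & forall s, `|s - t| < d -> cabs (g s - g t) < e.

Lemma rcont_ucont (g : R -> C) : rcont g -> ucont g.
Proof.
move=> gc e e0; have [|d d0 hd] := @ccont_unif R (fun z => g (complex.Re z)) 0 1 _ e e0.
  move=> z _ e1 /(gc (complex.Re z))[d d0 hd]; exists d => // w wz; apply: hd.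
  by rewrite -ReB; apply: le_lt_trans (cabs_Re _) _.
exists d => // s t /andP[s0 s1] /andP[t0 t1] st.
have := hd s%:C t%:C; rewrite !subr0 !cabs_real -rmorphB/= cabs_real.
by rewrite (ger0_norm s0) (ger0_norm t0) => h; exact: h.
Qed.

Lemma rcontM (g h : R -> C) : rcont g -> rcont h -> rcont (fun t => g t * h t).
Proof.
move=> gc hc t e e0; set A := cabs (g t) + 1; set B := cabs (h t) + 1.
have A0 : 0 < A by rewrite ltr_wpDl.
have B0 : 0 < B by rewrite ltr_wpDl.
have [|d1 d10 h1] := gc t (Num.min 1 (e / (2 * B))).
  by rewrite lt_min ltr01 divr_gt0// mulr_gt0.
have [|d2 d20 h2] := hc t (Num.min 1 (e / (2 * A))).
  by rewrite lt_min ltr01 divr_gt0// mulr_gt0.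
exists (Num.min d1 d2); first by rewrite lt_min d10.
move=> s; rewrite lt_min => /andP[/h1 + /h2]; rewrite !lt_min => /andP[a1 a2] /andP[b1 b2].
have -> : g s * h s - g t * h t = (g s - g t) * h s + g t * (h s - h t) by ring.
apply: le_lt_trans (cabsD _ _) _; rewrite !cabsM.
have hB : cabs (h s) <= B.
  by have := cabs_lerB (h s) (h t); rewrite /B; lra.
move: a2 b2; rewrite !ltr_pdivlMr ?mulr_gt0// => a2 b2.
have := cabs_ge0 (g s - g t); have := cabs_ge0 (h s - h t); have : cabs (g t) < A by rewrite ltrDl.
nra.
Qed.

Lemma rcont_comp (f : C -> C) (g : R -> C) :
  (forall t, ccont f (g t)) -> rcont g -> rcont (fun t => f (g t)).
Proof.
move=> fc gc t e e0; have [d d0 hd] := fc t e e0; have [d' d'0 hd'] := gc t d d0.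
by exists d' => // s /hd'/hd.
Qed.

Lemma rcont_cst a : rcont (fun=> a).
Proof. by move=> t e e0; exists 1 => // s _; rewrite subrr cabs0. Qed.

Lemma rcontX (g : R -> C) n : rcont g -> rcont (fun t => g t ^+ n).
Proof.
move=> gc; elim: n => [|n IH]; first exact: rcont_cst.
by under eq_fun do rewrite exprS; exact: rcontM.
Qed.

(** [exp (2 i pi t)]: with period 1 the unit interval of [dsum] parametrises the circle, and halving
    [t] takes a square root. *)
Definition cis (t : R) : C := cexp (0 +i* (2 * pi * t)).

Lemma cisD s t : cis (s + t) = cis s * cis t.
Proof.
rewrite /cis -cexpD; congr cexp; apply/eqP; rewrite eq_complex/= addr0 eqxx/=.
by apply/eqP; ring.
Qed.

Lemma cis0 : cis 0 = 1.
Proof. by rewrite /cis mulr0 cexp0. Qed.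

Lemma cis1 : cis 1 = 1.
Proof.
by rewrite /cis /cexp/= mulr1 expR0 !mul1r mulr_natl cos2pi sin2pi.
Qed.

Lemma cis_half : cis (1 / 2) = -1.
Proof.
rewrite /cis /cexp/= expR0 !mul1r (_ : 2 * pi * 2^-1 = pi); last by field.
by rewrite cospi sinpi; apply/eqP; rewrite eq_complex/= oppr0 !eqxx.
Qed.

Lemma cabs_cis t : cabs (cis t) = 1.
Proof. by rewrite cabs_cexp/= expR0. Qed.

Lemma cisK t : cis t * cis (- t) = 1.
Proof. by rewrite -cisD subrr cis0. Qed.

Lemma rcont_cexp (g : R -> C) : rcont g -> rcont (fun t => cexp (g t)).
Proof.
apply: rcont_comp => t e e0; exact: (cdiff_continuous (cdiff_cexp _) e0).
Qed.

Lemma rcont_cis : rcont cis.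
Proof.
apply: rcont_cexp => t e e0; have p0 : 0 < 2 * pi :> R by rewrite mulr_gt0// pi_gt0.
exists (e / (2 * pi)); first by rewrite divr_gt0.
move=> s; rewrite ltr_pdivlMr// => h.
have -> : (0 +i* (2 * pi * s)) - (0 +i* (2 * pi * t)) = 0 +i* (2 * pi * (s - t)) :> C.
  by apply/eqP; rewrite eq_complex/= subr0 eqxx/=; apply/eqP; ring.
by rewrite /cabs/= expr0n/= add0r sqrtr_sqr normrM (gtr0_norm p0) mulrC.
Qed.

Lemma rcont_cisN : rcont (fun t => cis (- t)).
Proof.
move=> t e e0; have [d d0 hd] := rcont_cis (- t) e0.
by exists d => // s st; apply: hd; rewrite -opprD normrN.
Qed.

(** Exact orthogonality at a finite level: for odd [k] the two halves cancel by [E1]; for even [k]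
    they agree, and [E2] reduces to [k / 2] one level below. *)
Lemma dsum_cis0 (E : R -> C) n k : (forall t, E ((1 + t) / 2) = - E (t / 2)) ->
  (forall t, E (t / 2) ^+ 2 = E t) -> (0 < k < 2 ^ n)%N ->
  dsum n (fun t => E t ^+ k) = 0.
Proof.
move=> E1 E2; elim: n k => [|n IH] k /andP[k0 kn].
  by move: kn; rewrite expn0 ltnS leqNgt k0.
rewrite /= -dsumD; under eq_fun do rewrite E1.
rewrite -(odd_double_half k); case ok: (odd k) => /=.
  rewrite (@dsum_ext R n _ (fun=> 0)) ?dsum_cst ?mul0r// => t _.
  by rewrite add1n exprNn -signr_odd/= odd_double expr1 mulN1r subrr.
rewrite add0n (@dsum_ext R n _ (fun t => 2 * E t ^+ k./2)); last first.
  move=> t _; rewrite -mul2n !exprM sqrrN E2; ring.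
rewrite dsumZ IH ?mulr0 ?mul0r//; apply/andP; split.
  by rewrite half_gt0; case: k k0 kn ok => [|[|]].
by move: kn; rewrite expnS -{1}(odd_double_half k) ok add0n -mul2n ltn_pmul2l.
Qed.

Lemma cis_half1 t : cis ((1 + t) / 2) = - cis (t / 2).
Proof. by rewrite mulrDl cisD cis_half mulN1r. Qed.

Lemma cis_half2 t : cis (t / 2) ^+ 2 = cis t.
Proof. by rewrite expr2 -cisD; congr cis; field. Qed.

Lemma cisN_half1 t : cis (- ((1 + t) / 2)) = - cis (- (t / 2)).
Proof.
have -> : - ((1 + t) / 2) = (1 / 2 - t / 2) - 1 :> R by lra.
have h : cis (-1) = 1 by have := cisK 1; rewrite cis1 mul1r.
by rewrite cisD h mulr1 cisD cis_half mulN1r.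
Qed.

Lemma cisN_half2 t : cis (- (t / 2)) ^+ 2 = cis (- t).
Proof. by rewrite -mulNr cis_half2. Qed.

Lemma expn2_gt n : (n < 2 ^ n)%N. Proof. exact: ltn_expl. Qed.

Lemma dsum_cis_orth m k :
  clim (fun n => dsum n (fun t => cis t ^+ m * cis (- t) ^+ k)) ((m == k)%:R).
Proof.
have aux (u : nat -> C) N a : (forall n, (N <= n)%N -> u n = a) -> clim u a.
  move=> h; apply/climP => e e0; exists N => n /h ->; by rewrite subrr cabs0.
have [<-|mk] := eqVneq m k.
  apply: (aux _ 0%N) => n _; rewrite -[RHS](dsum_cst n); apply: dsum_ext => t _.
  by rewrite -exprMn cisK expr1n.
have [km|mk2] := leqP k m.
  apply: (aux _ (m - k)%N) => n hn.
  rewrite -[RHS](@dsum_cis0 cis n (m - k) cis_half1 cis_half2); last first.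
    rewrite subn_gt0 ltn_neqAle eq_sym mk km/=; apply: leq_ltn_trans hn _; exact: expn2_gt.
  apply: dsum_ext => t _; rewrite -{1}(subnK km) exprD -mulrA -exprMn cisK expr1n mulr1//.
apply: (aux _ (k - m)%N) => n hn.
rewrite -[RHS](@dsum_cis0 (fun t => cis (- t)) n (k - m) cisN_half1 cisN_half2); last first.
  by rewrite subn_gt0 mk2/=; apply: leq_ltn_trans hn _; exact: expn2_gt.
apply: dsum_ext => t _; rewrite -{1}(subnK (ltnW mk2)) exprD mulrC -mulrA -exprMn.
by rewrite (mulrC (cis (- t))) cisK expr1n mulr1.
Qed.

(** Cauchy's estimate as a Fourier coefficient: the dyadic mean of [f (p cis t) cis (- t)^k] is at
    most [M] and tends to [c k p^k] by dominated convergence. *)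
Lemma ps_coef c f r (p M : R) k : (forall w, cabs w < r -> ps c w (f w)) ->
  0 < p < r -> (forall w, cabs w = p -> cabs (f w) <= M) ->
  cabs (c k) * p ^+ k <= M.
Proof.
move=> fps /andP[p0 pr] fM; set s := (p + r) / 2.
have ps : p < s by rewrite /s; lra.
have sr : s < r by rewrite /s; lra.
have s0 : 0 < s by apply: lt_trans ps.
have [|K hK] := @ps_bounded_in R c r (fun w h => ex_intro _ _ (fps w h)) s.
  by rewrite (ltW s0).
have K0 : 0 <= K by apply: le_trans (hK 0%N); rewrite mulr_ge0// expr0.
have q01 : 0 <= p / s < 1.
  by rewrite divr_ge0 ?ltW//= ltr_pdivrMr// mul1r.
have cw t : cabs (p%:C * cis t) = p.
  by rewrite cabsM cabs_cis mulr1 cabs_real gtr0_norm.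
set u := fun n m => c m * p%:C ^+ m * dsum n (fun t => cis t ^+ m * cis (- t) ^+ k).
set U := fun n => dsum n (fun t => f (p%:C * cis t) * cis (- t) ^+ k).
have hU n : csum (u n) (U n).
  have h := @dsum_csum R n (fun t m => (cis (- t) ^+ k) * (c m * (p%:C * cis t) ^+ m))
    (fun t => cis (- t) ^+ k * f (p%:C * cis t)) _.
  rewrite /U (@dsum_ext R n _ (fun t => cis (- t) ^+ k * f (p%:C * cis t))); last first.
    by move=> t _; rewrite mulrC.
  apply: csum_ext (h _) => [m|t _].
    rewrite /u -dsumZ; apply: dsum_ext => t _; rewrite exprMn; ring.
  by apply: csumZ; apply: fps; rewrite cw.
have hl : clim U (c k * p%:C ^+ k).
  apply: (@tannery R u (fun m => c m * p%:C ^+ m * (m == k)%:R) (fun m => K * (p / s) ^+ m)) => //.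
  - move=> n m; rewrite cabsM -[leRHS]mulr1; apply: ler_pM => //.
      apply: le_trans (ps_terms p%:C m s0 hK) _; by rewrite cabs_real gtr0_norm.
    by apply: dsum_le => t _; rewrite cabsM !cabsX !cabs_cis !expr1n mulr1.
  - exact: geo_cvg.
  - by move=> m; apply: climM (clim_cst _) _; exact: dsum_cis_orth.
  - apply/climP => e e0; exists k.+1 => n kn.
    rewrite /series/= (bigD1_seq k) ?mem_index_iota ?iota_uniq//= eqxx mulr1.
    by rewrite big1 ?addr0 ?subrr ?cabs0// => i /negPf ->; rewrite mulr0.
have := @clim_cabs_le R U _ M hl; rewrite cabsM cabsX cabs_real gtr0_norm//; apply.
exists 0%N => n _; apply: dsum_le => t _.
by rewrite cabsM cabsX cabs_cis expr1n mulr1; apply: fM; rewrite cw.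
Qed.

Section Morera.
Variables (f : C -> C) (r : R).
Hypothesis r0 : 0 < r.
Hypothesis fc : con f 0 r.
Hypothesis ft : forall a b d, cabs a < r -> cabs b < r -> cabs d < r -> tri f a b d = 0.

Let D z := cabs z < r.
Let Dsub z : D z -> cabs (z - 0) < r. Proof. by rewrite subr0. Qed.
Let D0 : D 0. Proof. by rewrite /D cabs0. Qed.

Let F w := J f 0 w.

Let F00 : F 0 = 0.
Proof. by rewrite /F /J subrr mul0r. Qed.

Let FB a b : D a -> D b -> F b - F a = J f a b.
Proof.
move=> Da Db; have := ft D0 Da Db; rewrite /tri (J_rev fc (Dsub D0) (Dsub Db)).
rewrite /F => h; transitivity (J f 0 b - J f 0 a + (J f 0 a + J f a b - J f 0 b)); last by ring.
by rewrite h addr0.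
Qed.

Let seg_near a b t : 0 <= t <= 1 -> cabs (seg a b t - a) <= cabs (b - a).
Proof.
move=> /andP[t0 t1]; rewrite /seg addrAC subrr add0r cabsM cabs_real ger0_norm//.
by rewrite ler_piMl.
Qed.

Lemma J_primitive z : D z -> cdiff F z (f z).
Proof.
move=> Dz e e0; have [d d0 hd] := fc (Dsub Dz) e0.
exists (Num.min d (r - cabs z)); first by rewrite lt_min d0 subr_gt0.
move=> h; rewrite lt_min => /andP[h1 h2].
have Dzh : D (z + h) by rewrite /D; apply: le_lt_trans (cabsD _ _) _; lra.
rewrite FB//; have /= := @J_approx R f z (z + h) (f z) 0 e (seg_ucont fc (Dsub Dz) (Dsub Dzh)).
rewrite mul0r addr0 addrAC subrr add0r (mulrC h) (mulrC (cabs h)); apply => t t01.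
rewrite mul0r addr0; apply/ltW/hd; apply: le_lt_trans (seg_near _ _ t01) _.
by rewrite addrAC subrr add0r.
Qed.

Let F_cont : forall z, D z -> ccont F z.
Proof. by move=> z /J_primitive /cdiff_continuous. Qed.

Variable p : R.
Hypothesis p0 : 0 < p.
Hypothesis pr : p < r.

Let zt t := p%:C * cis t.
Let cz t : cabs (zt t) = p.
Proof. by rewrite /zt cabsM cabs_cis mulr1 cabs_real gtr0_norm. Qed.
Let Dzt t : D (zt t). Proof. by rewrite /D cz. Qed.

Let circ_pt w s t : cabs w < p -> 0 <= s <= 1 -> cabs (w + s%:C * (zt t - w)) <= p.
Proof.
move=> wp s01; have := @seg_cabs R w (zt t) 0 s p s01.
by rewrite !subr0 cz; apply => //; exact: ltW.
Qed.

(** The increment of [cis] over one mesh step, minus 1, is a factor to be divided out in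
    [circ_sum]. *)
Let cis_step_neq1 n : cis ((2 ^+ n.+1)^-1) != 1.
Proof.
elim: n => [|n IH].
  rewrite expr1 -div1r cis_half; apply/eqP => h.
  have : (2 : C) = 0 by rewrite -[2](addrK 1) -{2}h; ring.
  by move=> /eqP; rewrite pnatr_eq0.
apply/eqP => h; move/eqP: IH; apply.
have -> : (2 ^+ n.+1)^-1 = (2 ^+ n.+2)^-1 + (2 ^+ n.+2)^-1 :> R.
  by rewrite [in RHS]exprS invfM -mulrDl; field; rewrite expf_neq0.
by rewrite cisD h mulr1.
Qed.

(* Riemann sums of the exact form f(z)dz along the circles s |-> w + s(zt - w)
   telescope up to the uniform modulus of continuity of f. *)
Let circ_sum w (e : R) : cabs w < p -> 0 < e -> exists N, forall n, (N <= n)%N ->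
  forall s, 0 <= s <= 1 ->
  cabs (dsum n (fun t => zt t * f (w + s%:C * (zt t - w)))) <= e * p.
Proof.
move=> wp e0.
have [|d d0 hd] := @ccont_unif R f 0 p _ e e0.
  by move=> z hz; apply: fc; exact: le_lt_trans hz pr.
have [|d1 d10 hd1] := rcont_cis 0 (_ : 0 < d / p); first by rewrite divr_gt0.
have [N hN] := half_pow_lt d10.
exists N.+1 => n Nn s s01.
have [m nE] : exists m, n = m.+1 by case: n Nn => // m _; exists m.
have hn : (2 ^+ n)^-1 < d1.
  apply: le_lt_trans hN; rewrite lef_pV2 ?posrE ?exprn_gt0// ler_weXn2l ?ler1n//.
  exact: ltnW.
set om := cis (2 ^+ n)^-1.
have om1 : om - 1 != 0 by rewrite subr_eq0 /om nE cis_step_neq1.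
have omd : p * cabs (om - 1) < d.
  have := hd1 (2 ^+ n)^-1; rewrite subr0 ger0_norm ?invr_ge0 ?exprn_ge0// => /(_ hn).
  by rewrite cis0 ltr_pdivlMr// mulrC.
case/andP: (s01) => s0 s1.
(* The circle has collapsed to [w]; the sum is a multiple of the mean of [cis], which vanishes at a
   positive level. *)
have [->|sn0] := eqVneq s 0.
  rewrite (@dsum_ext R n _ (fun t => (f w * p%:C) * cis t ^+ 1)); last first.
    by move=> t _; rewrite mul0r addr0 expr1 /zt; ring.
  rewrite dsumZ (dsum_cis0 cis_half1 cis_half2) ?mulr0 ?cabs0 ?mulr_ge0 ?ltW//.
  by rewrite nE expnS (leq_trans (_ : 1 < 2 * 1)%N)// leq_mul2l/= expn_gt0.
have sp : 0 < s by rewrite lt_def sn0.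
pose z j := w + s%:C * (zt (j%:R / 2 ^+ n) - w).
have zS j : z j.+1 - z j = s%:C * zt (j%:R / 2 ^+ n) * (om - 1).
  rewrite /z -natr1 mulrDl div1r /zt cisD -/om; ring.
have czS j : cabs (z j.+1 - z j) = s * p * cabs (om - 1).
  by rewrite zS (cabsM _ (om - 1)) (cabsM _ (zt _)) cabs_real cz ger0_norm.
have Dz j : cabs (z j) <= p by exact: circ_pt.
have Dz' j : D (z j) by exact: le_lt_trans (Dz j) pr.
have tel : \sum_(j < 2 ^ n) (F (z j.+1) - F (z j)) = 0.
  rewrite -(big_mkord xpredT (fun j => F (z j.+1) - F (z j))) telescope_sumr//.
  rewrite /z natrX mulfV ?expf_neq0// mul0r /zt cis0 cis1 subrr//.
have st j : cabs (F (z j.+1) - F (z j) - (z j.+1 - z j) * f (z j)) <= cabs (z j.+1 - z j) * e.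
  rewrite FB//; have /= := @J_approx R f (z j) (z j.+1) (f (z j)) 0 e
     (seg_ucont fc (Dsub (Dz' j)) (Dsub (Dz' j.+1))).
  rewrite mul0r addr0; apply => t t01; rewrite mul0r addr0; apply/ltW/hd; rewrite ?subr0//.
    have := @seg_cabs R (z j) (z j.+1) 0 t p t01; rewrite !subr0; exact.
  apply: le_lt_trans (seg_near _ _ t01) _; rewrite czS.
  by apply: le_lt_trans omd; rewrite -mulrA ler_piMl// mulr_ge0// ltW.
have key : cabs (\sum_(j < 2 ^ n) (z j.+1 - z j) * f (z j)) <= (2 ^ n)%:R * (s * p * cabs (om - 1) * e).
  have -> : \sum_(j < 2 ^ n) (z j.+1 - z j) * f (z j) =
     - \sum_(j < 2 ^ n) (F (z j.+1) - F (z j) - (z j.+1 - z j) * f (z j)).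
    by rewrite big_split/= tel add0r sumrN opprK.
  rewrite cabsN; apply: le_trans (cabs_sum _ _ _) _.
  apply: (@le_trans _ _ (\sum_(j < 2 ^ n) (s * p * cabs (om - 1) * e))).
    apply: ler_sum => j _; apply: le_trans (st j) _.
    by rewrite czS.
  by rewrite sumr_const card_ord mulr_natl.
(* Consecutive points of the circle differ by [s (om - 1)] times [zt], so this is the dyadic sum up
   to a constant. The modulus of the constant is a factor of the bound in [key]; it cancels, and the
   estimate is uniform in [s]. *)
have E : \sum_(j < 2 ^ n) (z j.+1 - z j) * f (z j) =
   (s%:C * (om - 1) * 2 ^+ n) * dsum n (fun t => zt t * f (w + s%:C * (zt t - w))).
  transitivity (s%:C * (om - 1) * \sum_(j < 2 ^ n)
     zt (j%:R / 2 ^+ n) * f (w + s%:C * (zt (j%:R / 2 ^+ n) - w))).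
    by rewrite mulr_sumr; apply: eq_bigr => j _; rewrite zS -/(z j); ring.
  by rewrite dsumE; field; rewrite expf_neq0.
move: key; rewrite E !cabsM cabs_real ger0_norm// cabsX cabs2 natrX.
have q0 : 0 < s * cabs (om - 1) * 2 ^+ n by rewrite !mulr_gt0 ?exprn_gt0// cabs_gt0.
by move=> key; rewrite -(ler_pM2l q0) (le_trans key)// le_eqVlt; apply/orP; left; apply/eqP; ring.
Qed.

(** Cauchy's integral formula for the primitive: [F (zt t) - F w] is [zt t - w] times the mean of
    [f] over the segment from [w] to [zt t]. After the exchange of sums each inner sum runs over a
    circle and is small by [circ_sum]. *)
Let circ w : cabs w < p ->
  clim (fun n => dsum n (fun t => (F (zt t) - F w) * (zt t / (zt t - w)))) 0.
Proof.
move=> wp; have Dw : D w by exact: lt_trans wp pr.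
have zw t : zt t - w != 0.
  by rewrite subr_eq0; apply/eqP => h; rewrite -h cz ltxx in wp.
apply/climP => e e0; have e1 : 0 < e / (2 * p) by rewrite divr_gt0// mulr_gt0.
have [N hN] := circ_sum wp e1; exists N => n Nn; rewrite subr0.
apply: (@le_lt_trans _ _ (e / 2)); last lra.
have hm : clim (fun m => dsum n (fun t => zt t * dsum m (fun s => f (seg w (zt t) s))))
  (dsum n (fun t => (F (zt t) - F w) * (zt t / (zt t - w)))).
  have -> : dsum n (fun t => (F (zt t) - F w) * (zt t / (zt t - w))) =
      dsum n (fun t => zt t * dint (fun s => f (seg w (zt t) s))).
    apply: dsum_ext => t _; rewrite FB// /J; field; exact: zw.
  rewrite dsumE; under eq_fun do rewrite dsumE.
  apply: climM (clim_cst _); apply: clim_sum => j; apply: climM (clim_cst _) _.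
  by apply/dintP/(seg_ucont fc); exact: Dsub.
apply: (clim_cabs_le hm); exists 0%N => m _.
rewrite (@dsum_ext R n _ (fun t => dsum m (fun s => zt t * f (seg w (zt t) s)))); last first.
  by move=> t _; rewrite dsumZ.
rewrite dsum_swap; apply: dsum_le => s s01.
apply: le_trans (hN n Nn s s01) _; rewrite le_eqVlt; apply/orP; left; apply/eqP.
by field; rewrite gt_eqF.
Qed.

Let A k := dint (fun t => F (zt t) * (cis (- t) / p%:C) ^+ k).

(** The kernel [zt / (zt - w)] is expanded in powers of [w]. By [circ] the values of [F] on the
    circle may be replaced by the constant [F w], whose coefficients are known from
    orthogonality. *)
Let F_ps w : cabs w < p -> ps A w (F w).
Proof.
move=> wp; have pC0 : p%:C != 0 :> C by rewrite -cabs_gt0 cabs_real normr_gt0 gt_eqF.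
have zt0 t : zt t != 0 by rewrite -cabs_gt0 cz.
have zw t : zt t - w != 0.
  by rewrite subr_eq0; apply/eqP => h; rewrite -h cz ltxx in wp.
(* Starting from [F 0 = 0], the radius is crossed in [K] steps, each changing [F] by less than 1 by
   uniform continuity; so [K] is a bound. *)
have [M hM] : exists M, forall t, cabs (F (zt t)) <= M.
  have [|d d0 hd] := @ccont_unif R F 0 p _ 1 ltr01.
    by move=> z hz; apply: F_cont; apply: le_lt_trans pr; rewrite subr0 in hz.
  have [K hK] : exists K : nat, p < d * K%:R.
    exists (Num.truncn (p / d)).+1; rewrite mulrC -ltr_pdivrMr//; exact: truncnS_gt.
  have K0 : (0 < K)%N.
    case: K hK => //; rewrite mulr0 => h; have := lt_trans p0 h; by rewrite ltxx.
  exists K%:R => t.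
  have h j : (j <= K)%N -> cabs (F ((j%:R / K%:R)%:C * zt t)) <= j%:R.
    elim: j => [|j IH] jK; first by rewrite mul0r mul0r F00 cabs0.
    have KR : 0 < K%:R :> R by rewrite ltr0n.
    have inp i : (i <= K)%N -> cabs ((i%:R / K%:R)%:C * zt t - 0) <= p.
      move=> iK; rewrite subr0 cabsM cz cabs_real ger0_norm ?divr_ge0//.
      by rewrite ler_piMl ?(ltW p0)// ler_pdivrMr// mul1r ler_nat.
    have := hd _ _ (inp _ jK) (inp _ (ltnW jK)); rewrite -mulrBl -rmorphB/= -mulrBl -natr1.
    rewrite addrAC subrr add0r cabsM cz cabs_real div1r ger0_norm ?invr_ge0//.
    rewrite mulrC ltr_pdivrMr// => /(_ hK) h1.
    have := cabs_lerB (F (((j%:R + 1) / K%:R)%:C * zt t)) (F ((j%:R / K%:R)%:C * zt t)).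
    have := IH (ltnW jK); lra.
  have := h K (leqnn _); rewrite divff ?mul1r//.
  by rewrite pnatr_eq0 -lt0n.
have M0 : 0 <= M := le_trans (cabs_ge0 _) (hM 0).
have q01 : 0 <= cabs w / p < 1 by exact: ratio_lt1.
have etaE t : (zt t)^-1 = cis (- t) / p%:C.
  apply: (mulfI (zt0 t)); rewrite (mulfV (zt0 t)).
  transitivity ((cis t * cis (- t)) * (p%:C / p%:C)); last by rewrite /zt; ring.
  by rewrite cisK mulfV// mulr1.
have ceta t : cabs (cis (- t) / p%:C) = p^-1.
  by rewrite cabsM cabs_cis mul1r cabsV cabs_real gtr0_norm.
have kern t : csum (fun k => (cis (- t) / p%:C) ^+ k * w ^+ k) (zt t / (zt t - w)).
  have h : cabs (w / zt t) < 1 by rewrite cabsM cabsV cz; case/andP: q01.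
  have -> : zt t / (zt t - w) = (1 - w / zt t)^-1.
    by field; rewrite zt0 zw.
  by apply: csum_ext (csum_geo h) => k; rewrite -etaE -exprMn mulrC.
have gen (G : R -> C) (B : R) : (forall t, cabs (G t) <= B) ->
    (forall k, clim (fun n => dsum n (fun t => G t * (cis (- t) / p%:C) ^+ k))
       (dint (fun t => G t * (cis (- t) / p%:C) ^+ k))) ->
    exists2 l, ps (fun k => dint (fun t => G t * (cis (- t) / p%:C) ^+ k)) w l &
      clim (fun n => dsum n (fun t => G t * (zt t / (zt t - w)))) l.
  move=> GB hG; have B0 : 0 <= B := le_trans (cabs_ge0 _) (GB 0).
  set a := fun k => dint (fun t => G t * (cis (- t) / p%:C) ^+ k).
  have tb t k : cabs (G t * (cis (- t) / p%:C) ^+ k) <= B / p ^+ k.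
    by rewrite cabsM cabsX ceta exprVn; apply: ler_pM => //; rewrite invr_ge0 exprn_ge0// ltW.
  have ab k : cabs (a k * w ^+ k) <= B * (cabs w / p) ^+ k.
    rewrite cabsM cabsX expr_div_n mulrA mulrAC; apply: ler_wpM2r; first by rewrite exprn_ge0.
    apply: clim_cabs_le (hG k) _; exists 0%N => n _; apply: dsum_le => t _; exact: tb.
  have [l hl _] := csum_tail ab (geo_cvg q01).
  exists l => //.
  apply: (@tannery R (fun n k => dsum n (fun t => G t * (cis (- t) / p%:C) ^+ k) * w ^+ k)
     (fun k => a k * w ^+ k) (fun k => B * (cabs w / p) ^+ k)) => //.
  - move=> n k; rewrite cabsM cabsX expr_div_n mulrA mulrAC; apply: ler_wpM2r; first by rewrite exprn_ge0.
    by apply: dsum_le => t _; exact: tb.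
  - exact: geo_cvg.
  - by move=> k; apply: climM (clim_cst _); exact: hG.
  - move=> n; have := @dsum_csum R n (fun t k => G t * ((cis (- t) / p%:C) ^+ k * w ^+ k))
      (fun t => G t * (zt t / (zt t - w))) (fun t _ => csumZ _ (kern t)).
    apply: csum_ext => k; rewrite mulrC -dsumZ; apply: dsum_ext => t _; ring.
have rc k : rcont (fun t => (cis (- t) / p%:C) ^+ k).
  by apply/rcontX/rcontM; [exact: rcont_cisN|exact: rcont_cst].
have [l1 h1 l1c] := gen (fun t => F (zt t)) M hM (fun k => dintP (rcont_ucont
   (rcontM (rcont_comp (fun t => F_cont (Dzt t)) (rcontM (rcont_cst _) rcont_cis)) (rc k)))).
have [|l2 h2 l2c] := gen (fun=> F w) (cabs (F w)) (fun=> lexx _).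
  by move=> k; apply/dintP/rcont_ucont/rcontM => //; exact: rcont_cst.
suff -> : F w = l1 by [].
have e12 : l1 = l2.
  apply/eqP; rewrite -subr_eq0; apply/eqP.
  apply: clim_unique (climB l1c l2c) _.
  by apply: clim_ext (circ wp) => n; rewrite -dsumB; apply: dsum_ext => t _; ring.
rewrite e12; apply: csum_unique h2; apply: csum_ext (ps_cst (F w) w) => -[|k].
  congr (_ * _); apply/esym/dint_clim.
  by apply: clim_ext (clim_cst (F w)) => n; rewrite -[LHS](dsum_cst n); apply: dsum_ext => t _; rewrite expr0 mulr1.
congr (_ * _); apply/esym/dint_clim.
rewrite -[0](mulr0 (F w / p%:C ^+ k.+1)).
have h := climM (clim_cst (F w / p%:C ^+ k.+1)) (dsum_cis_orth 0 k.+1).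
apply: clim_ext h => n; rewrite -dsumZ; apply: dsum_ext => t _.
by rewrite expr0 mul1r expr_div_n; field; rewrite expf_neq0.
Qed.

Lemma morera_p : exists c, forall w, cabs w < p -> ps c w (f w).
Proof.
exists (fun k => k.+1%:R * A k.+1) => w wp.
have [l hl ld] := ps_cdiff F_ps wp.
by rewrite (cdiff_unique (J_primitive (lt_trans wp pr)) ld).
Qed.

End Morera.

Lemma ps_coef_unique c1 c2 f r : 0 < r -> (forall w, cabs w < r -> ps c1 w (f w)) ->
  (forall w, cabs w < r -> ps c2 w (f w)) -> forall k, c1 k = c2 k.
Proof.
move=> r0 h1 h2 k; apply/eqP; rewrite -subr_eq0; apply/eqP; move: k.
apply: (@ps_unique0 R _ (fun=> 0) r r0) => [w wr|e e0].
  rewrite -(subrr (f w)); apply: csum_ext (csumB (h1 w wr) (h2 w wr)) => k; ring.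
exists (e / 2)%:C; split => //; rewrite -?cabs_gt0 cabs_real gtr0_norm; lra.
Qed.

(** [morera_p] gives an expansion on each smaller disc; by uniqueness of coefficients they all
    coincide with the one on the disc of radius [r / 2]. *)
Lemma morera f r : 0 < r -> con f 0 r ->
  (forall a b d, cabs a < r -> cabs b < r -> cabs d < r -> tri f a b d = 0) ->
  exists c, forall w, cabs w < r -> ps c w (f w).
Proof.
move=> r0 fc ft.
have p1 : 0 < r / 2 by rewrite divr_gt0.
have p1r : r / 2 < r by lra.
have [c hc] := morera_p r0 fc ft p1 p1r.
exists c => w wr; set p := Num.max (r / 2) ((cabs w + r) / 2).
have pr : p < r by rewrite gt_max p1r; lra.
have pw : cabs w < p by rewrite lt_max; apply/orP; right; lra.
have p2 : r / 2 <= p by rewrite le_max lexx.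
have [c' hc'] := morera_p r0 fc ft (lt_le_trans p1 p2) pr.
have E := ps_coef_unique p1 hc (fun w h => hc' w (lt_le_trans h p2)).
by apply: csum_ext (hc' w pw) => k; rewrite E.
Qed.

End Cauchy.

(** * Holomorphic functions on discs *)

Section Holomorphic.
Context {R : realType}.
Local Notation C := R[i].
Implicit Types (f g : C -> C) (c : nat -> C) (a b z w : C) (r p : R).

Definition hol f a r := forall z, cabs (z - a) < r -> exists l, cdiff f z l.

Lemma cdiff_shift f a w l : cdiff f (a + w) l <-> cdiff (fun v => f (a + v)) w l.
Proof.
by split=> h e /h[d d0 hd]; exists d => // v /hd; rewrite addrA.
Qed.

Lemma hol_shift f a r : hol f a r -> hol (fun w => f (a + w)) 0 r.
Proof.
move=> h w; rewrite subr0 => wr; have [|l hl] := h (a + w).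
  by rewrite addrAC subrr add0r.
by exists l; apply/cdiff_shift.
Qed.

Lemma hol_con f a r : hol f a r -> con f a r.
Proof. by move=> h z /h[l /cdiff_continuous]. Qed.

Lemma hol_tri f a r : hol f a r -> forall x y z, cabs (x - a) < r -> cabs (y - a) < r ->
  cabs (z - a) < r -> tri f x y z = 0.
Proof. by move=> h x y z; exact: goursat. Qed.

Lemma hol_ps f a r : 0 < r -> hol f a r ->
  exists c, forall w, cabs w < r -> ps c w (f (a + w)).
Proof.
move=> r0 /hol_shift h; apply: (morera r0 (hol_con h)) => x y z hx hy hz.
by apply: (hol_tri h); rewrite subr0.
Qed.

Lemma ps_hol c f r : (forall w, cabs w < r -> ps c w (f w)) -> hol f 0 r.
Proof. by move=> h w; rewrite subr0 => /(ps_cdiff h)[l _ hl]; exists l. Qed.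

Lemma hol_unshift f a r : hol (fun w => f (a + w)) 0 r -> hol f a r.
Proof.
move=> h z zr; have [|l hl] := h (z - a); first by rewrite subr0.
exists l; have -> : z = a + (z - a) by ring.
exact/cdiff_shift.
Qed.

Lemma hol_eq f g a r : (forall z, cabs (z - a) < r -> f z = g z) -> hol f a r -> hol g a r.
Proof.
move=> fg h z zr; have [l hl] := h z zr; exists l.
apply: (@cdiff_eq_near _ f g z l (r - cabs (z - a))) hl; first by rewrite subr_gt0.
move=> w wz; apply: fg; have -> : w - a = (w - z) + (z - a) by ring.
by apply: le_lt_trans (cabsD _ _) _; lra.
Qed.

(** A maximum principle with loss: Cauchy's estimates bound the Taylor series by a geometric series
    of ratio [|z - a| / p]. *)
Lemma hol_est f a r p (M : R) z : hol f a r -> 0 < p < r ->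
  (forall w, cabs (w - a) = p -> cabs (f w) <= M) ->
  cabs (z - a) < p -> cabs (f z) <= M / (1 - cabs (z - a) / p).
Proof.
move=> fh /andP[p0 pr] fM zp; have [c hc] := hol_ps (lt_trans p0 pr) fh.
have hk k : cabs (c k) * p ^+ k <= M.
  apply: (ps_coef k hc); first by rewrite p0.
  by move=> w wp; apply: fM; rewrite addrAC subrr add0r.
have h1 := hc (z - a) (lt_trans zp pr); have e1 : a + (z - a) = z by ring.
rewrite e1 in h1; rewrite -geo_lim; last exact: ratio_lt1.
apply: csum_le h1; last by apply: geo_cvg; exact: ratio_lt1.
by move=> k; exact: ps_terms.
Qed.

Lemma hol_center f a r p (M : R) : hol f a r -> 0 < p < r ->
  (forall w, cabs (w - a) = p -> cabs (f w) <= M) -> cabs (f a) <= M.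
Proof.
move=> fh pr fM; have := hol_est (z := a) fh pr fM.
rewrite subrr cabs0 mul0r subr0 divr1; apply; by case/andP: pr.
Qed.

Lemma hol_identity f a r : hol f a r ->
  (forall e : R, 0 < e -> exists w, [/\ w != a, cabs (w - a) < e & f w = 0]) ->
  forall z, cabs (z - a) < r -> f z = 0.
Proof.
move=> fh fz z zr; have r0 : 0 < r := le_lt_trans (cabs_ge0 _) zr.
have [c hc] := hol_ps r0 fh.
have c0 : forall k, c k = 0.
  apply: (ps_unique0 r0 hc) => e /fz[w [wa we fw]]; exists (w - a); split => //.
    by rewrite subr_eq0.
  by have -> : a + (w - a) = w by ring.
have := hc _ zr; have -> : a + (z - a) = z by ring.
move=> h; apply: csum_unique h _; apply: (@csum_ext _ (fun=> 0)) => [k|].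
  by rewrite c0 mul0r.
by apply: clim_ext (clim_cst 0) => n; rewrite /series/= big1.
Qed.

(** [m] is the index of the first nonzero Taylor coefficient, and [g] is the sum of the series
    shifted by [m]. *)
Lemma hol_factor f a r : 0 < r -> hol f a r ->
  (exists2 z, cabs (z - a) < r & f z != 0) ->
  exists m g, [/\ hol g a r, g a != 0 &
    forall z, cabs (z - a) < r -> f z = (z - a) ^+ m * g z].
Proof.
move=> r0 fh [z0 z0r fz0]; have [c hc] := hol_ps r0 fh.
have [k ck] : exists k, c k != 0.
  apply: contrapT => h; move/eqP: fz0; apply; have := hc _ z0r.
  have -> : a + (z0 - a) = z0 by ring.
  move=> h1; apply: csum_unique h1 _; apply: (@csum_ext _ (fun=> 0)) => [k|].
    have -> : c k = 0 by apply/eqP/negPn/negP => hk; apply: h; exists k.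
    by rewrite mul0r.
  by apply: clim_ext (clim_cst 0) => n; rewrite /series/= big1.
have exk : exists k, c k != 0 by exists k.
have := ex_minnP exk => -[m cm mmin].
have cj j : (j < m)%N -> c j = 0.
  move=> jm; apply/eqP/negPn/negP => /mmin; by rewrite leqNgt jm.
pose g z := if z == a then c m else f z / (z - a) ^+ m.
exists m, g; split.
- apply: hol_unshift; apply: (@ps_hol (fun j => c (j + m)%N)) => w wr.
  have [->|w0] := eqVneq w 0.
    by rewrite addr0 /g eqxx; exact: ps0.
  have wa : a + w != a by rewrite -subr_eq0 addrAC subrr add0r.
  rewrite /g (negPf wa) addrAC subrr add0r; apply: ps_shift => //; exact: hc.
- by rewrite /g eqxx.
- move=> z zr; rewrite /g; have [->|za] := eqVneq z a.
    rewrite subrr; have := hc 0; rewrite cabs0 addr0 => /(_ r0) h.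
    have -> : f a = c 0%N by apply: csum_unique h _; exact: ps0.
    case: m {g mmin} cm cj => [|m] cm cj; first by rewrite expr0 mul1r.
    by rewrite cj// expr0n mul0r.
  by rewrite mulrC divfK// expf_neq0// subr_eq0.
Qed.

(** Uniform limits keep continuity and the vanishing of integrals over triangles; [morera] turns
    these into a power series. *)
Lemma hol_unif_lim (fn : nat -> C -> C) f a r (e : nat -> R) : 0 < r ->
  (forall n, hol (fn n) a r) -> e @ \oo --> (0 : R) ->
  (forall n z, cabs (z - a) < r -> cabs (fn n z - f z) <= e n) -> hol f a r.
Proof.
move=> r0 fnh e0 fne; apply: hol_unshift.
have fnh' n := hol_shift (fnh n).
have fne' n z : cabs z < r -> cabs (fn n (a + z) - f (a + z)) <= e n.
  by move=> zr; apply: fne; rewrite addrAC subrr add0r.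
have small (d : R) : 0 < d -> exists n, e n < d.
  move=> d0; move/cvgrPdist_lt: e0 => /(_ _ d0)[N _ hN]; exists N.
  by have := hN N (leqnn _); rewrite /= sub0r normrN; apply: le_lt_trans; exact: ler_norm.
have fc : con (fun w => f (a + w)) 0 r.
  move=> z; rewrite subr0 => zr d d0; have d3 : 0 < d / 3 by rewrite divr_gt0.
  have [n hn] := small _ d3.
  have [|d1 d10 h1] := @hol_con _ _ _ (fnh' n) z _ _ d3; first by rewrite subr0.
  exists (Num.min d1 (r - cabs z)); first by rewrite lt_min d10 subr_gt0.
  move=> w; rewrite lt_min => /andP[/h1 h2 h3].
  have wr : cabs w < r.
    have -> : w = (w - z) + z by ring.
    by apply: le_lt_trans (cabsD _ _) _; lra.
  have -> : f (a + w) - f (a + z) = (fn n (a + w) - fn n (a + z)) -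
    (fn n (a + w) - f (a + w)) + (fn n (a + z) - f (a + z)) by ring.
  apply: le_lt_trans (cabsD _ _) _.
  have := cabsB (fn n (a + w) - fn n (a + z)) (fn n (a + w) - f (a + w)).
  have := fne' n w wr; have := fne' n z zr; lra.
have [c hc] : exists c, forall w, cabs w < r -> ps c w (f (a + w)).
  apply: (morera r0 fc) => x y z xr yr zr.
  have Jn (u v : C) n : cabs u < r -> cabs v < r ->
      cabs (J (fun w => fn n (a + w)) u v - J (fun w => f (a + w)) u v) <= cabs (v - u) * e n.
    move=> ur vr; have [u0 v0] : cabs (u - 0) < r /\ cabs (v - 0) < r by rewrite !subr0.
    have h1 := dintP (seg_ucont (hol_con (fnh' n)) u0 v0).
    have h2 := dintP (seg_ucont fc u0 v0).
    rewrite /J -mulrBr cabsM ler_wpM2l//; apply: (clim_cabs_le (climB h1 h2)).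
    exists 0%N => m _; rewrite -dsumB; apply: dsum_le => t t01; apply: fne'.
    by have := seg_in t01 u0 v0; rewrite subr0.
  apply/eqP; rewrite -cabs_eq0; apply/eqP/le_anti; rewrite cabs_ge0 andbT.
  apply/ler_addgt0Pr => d d0; rewrite add0r.
  have p0 : 0 <= per x y z by rewrite /per !addr_ge0.
  have [|n hn] := small (d / (per x y z + 1)); first by rewrite divr_gt0// ltr_wpDl.
  have t0 : tri (fun w => fn n (a + w)) x y z = 0 by apply: (hol_tri (fnh' n)); rewrite subr0.
  have -> : tri (fun w => f (a + w)) x y z =
    - ((J (fun w => fn n (a + w)) x y - J (fun w => f (a + w)) x y) +
       (J (fun w => fn n (a + w)) y z - J (fun w => f (a + w)) y z) +
       (J (fun w => fn n (a + w)) z x - J (fun w => f (a + w)) z x)).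
    rewrite /tri -[LHS]subr0 -{1}t0 /tri; ring.
  rewrite cabsN; apply: le_trans (cabsD _ _) _; apply: le_trans (lerD (cabsD _ _) (lexx _)) _.
  apply: le_trans (lerD (lerD (Jn _ _ n xr yr) (Jn _ _ n yr zr)) (Jn _ _ n zr xr)) _.
  rewrite -!mulrDl -/(per x y z).
  move: hn; rewrite ltr_pdivlMr ?ltr_wpDl// => hn.
  have [en|en] := leP 0 (e n); first by nra.
  by have : per x y z * e n <= 0; [rewrite mulr_ge0_le0// ltW|lra].
exact: ps_hol hc.
Qed.

Lemma hol_primitive f a r : 0 < r -> hol f a r ->
  exists2 G, G a = 0 & forall z, cabs (z - a) < r -> cdiff G z (f z).
Proof.
move=> r0 /hol_shift fh; exists (fun z => J (fun w => f (a + w)) 0 (z - a)).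
  by rewrite subrr /J subrr mul0r.
move=> z zr.
have h := @J_primitive R (fun w => f (a + w)) r r0 (hol_con fh)
  (fun x y v hx hy hv => hol_tri fh (etrans (congr1 (fun u => cabs u < r) (subr0 _)) hx)
    (etrans (congr1 (fun u => cabs u < r) (subr0 _)) hy) (etrans (congr1 (fun u => cabs u < r) (subr0 _)) hv)) (z - a) zr.
have e1 : a + (z - a) = z by ring.
rewrite e1 in h; apply: cdiff_ext (cdiff_comp (cdiffB (cdiff_id z) (cdiff_cst a z)) h) => //.
by rewrite subr0 mulr1.
Qed.

Definition cderiv f z := xget 0 [set l | cdiff f z l].

Lemma cderivP f z l : cdiff f z l -> cdiff f z (cderiv f z).
Proof. by move=> h; rewrite /cderiv; case: xgetP => [x _ //|/(_ l)]. Qed.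

Lemma cderiv_eq f z l : cdiff f z l -> cderiv f z = l.
Proof. by move=> h; exact: cdiff_unique (cderivP h) h. Qed.

Lemma hol_deriv f a r : hol f a r -> hol (cderiv f) a r.
Proof.
have [r0|r0 _ z zr] := ltP 0 r; last first.
  by have := lt_le_trans zr r0; rewrite ltNge cabs_ge0.
move=> fh; have [c hc] := hol_ps r0 fh.
apply: hol_unshift; apply: (@ps_hol (fun k => k.+1%:R * c k.+1)) => w wr.
have [l hl hd] := ps_cdiff hc wr.
by rewrite (cderiv_eq ((cdiff_shift f a w l).2 hd)).
Qed.

Lemma cdiff0_const f a r : 0 < r -> (forall z, cabs (z - a) < r -> cdiff f z 0) ->
  forall z, cabs (z - a) < r -> f z = f a.
Proof.
move=> r0 fd z zr.
have fh : hol f a r by move=> w /fd; exists 0.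
have [c hc] := hol_ps r0 fh.
have c0 k : c k.+1 = 0.
  have h := @ps_coef_unique R (fun k => k.+1%:R * c k.+1) (fun k => if k is 0%N then 0 else 0) (fun=> 0) r r0 _ _ k.
  have : k.+1%:R * c k.+1 = 0.
    rewrite h; [by case: k {h}| |by move=> w _; exact: ps_cst].
    move=> w wr; have [l hl hd] := ps_cdiff hc wr.
    have h2 : cdiff (fun v => f (a + v)) w 0.
      by apply/cdiff_shift/fd; rewrite addrAC subrr add0r.
    by rewrite -(cdiff_unique hd h2).
  by move=> /eqP; rewrite mulf_eq0 pnatr_eq0 => /eqP.
have := hc (z - a) zr; have -> : a + (z - a) = z by ring.
have := hc 0; rewrite cabs0 addr0 => /(_ r0) h0 h1.
have -> : f a = c 0%N by apply: csum_unique h0 _; exact: ps0.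
apply: csum_unique h1 _; apply: csum_ext (ps_cst (c 0%N) (z - a)) => -[|k] //.
by rewrite c0.
Qed.

End Holomorphic.

(** * The functional equation of theta *)

Section Polya.
Context {R : realType}.
Implicit Types (x t a : R) (m h k l n u : nat).

(** The binomial expansion of [(e^(ix) + e^(-ix))^n] in real form: a product-to-sum formula in the
    induction step, then Pascal's rule. *)
Lemma cos_pow n x :
  (2 * cos x) ^+ n = \sum_(i < n.+1) 'C(n, i)%:R * cos ((n%:R - 2 * i%:R) * x).
Proof.
elim: n => [|n IH].
  by rewrite expr0 big_ord1 bin0 mulr0 subr0 mul0r cos0 mulr1.
have E (i : nat) : cos ((n%:R - 2 * i%:R) * x) * (2 * cos x) =
    cos ((n.+1%:R - 2 * i%:R) * x) + cos ((n.+1%:R - 2 * i.+1%:R) * x).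
  have -> : (n.+1%:R - 2 * i%:R) * x = (n%:R - 2 * i%:R) * x + x.
    by rewrite -natr1; ring.
  have -> : (n.+1%:R - 2 * i.+1%:R) * x = (n%:R - 2 * i%:R) * x - x.
    by rewrite -!natr1; ring.
  by rewrite cosD cosB; ring.
rewrite exprSr IH mulr_suml.
under eq_bigr => i _ do rewrite -mulrA E mulrDr.
rewrite big_split/= [in RHS]big_ord_recl/= bin0.
under [in RHS]eq_bigr => i _ do rewrite /bump/= add1n binS natrD mulrDl.
rewrite big_split/= addrA; congr (_ + _).
transitivity (\sum_(i < n.+2) 'C(n, i)%:R * cos ((n.+1%:R - 2 * i%:R) * x)).
  by rewrite [in RHS]big_ord_recr/= bin_small// mul0r addr0.
by rewrite big_ord_recl/= bin0.
Qed.

Lemma cos_pow2 m x : (2 * cos x) ^+ (2 * m) = 'C(2 * m, m)%:R +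
  2 * \sum_(u < m) 'C(2 * m, m + u.+1)%:R * cos (2 * u.+1%:R * x).
Proof.
rewrite cos_pow -(big_mkord xpredT (fun i => 'C(2 * m, i)%:R * cos (((2 * m)%:R - 2 * i%:R) * x))).
have E : (2 * m).+1 = (m + m.+1)%N by lia.
rewrite E (@big_cat_nat _ _ _ m) ?leq_addr//=.
rewrite [X in _ + X]big_ltn; last by lia.
rewrite addrCA natrM subrr mul0r cos0 mulr1; congr (_ + _).
rewrite -(big_mkord xpredT (fun u => 'C(2 * m, m + u.+1)%:R * cos (2 * u.+1%:R * x))).
rewrite [RHS]mulr_natl mulr2n; congr (_ + _).
  rewrite big_nat_rev/= add0n.
  apply: eq_big_nat => i /andP[_ im].
  congr (_%:R * cos _); last by rewrite natrB//; ring.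
  by rewrite -bin_sub; [congr 'C(_, _)|]; lia.
rewrite -{1}[m.+1]add0n big_addn; have -> : (m + m.+1 - m.+1 = m)%N by lia.
apply: eq_big_nat => i /andP[_ im]; congr (_%:R * _).
  by congr 'C(_, _); lia.
by rewrite -cosN; congr cos; rewrite addnS -!natr1 natrD; ring.
Qed.

Lemma sin_natpi n : sin (n%:R * pi : R) = 0 /\ cos (n%:R * pi : R) = (-1) ^+ n.
Proof.
elim: n => [|n [IH1 IH2]]; first by rewrite mul0r sin0 cos0.
rewrite -natr1 mulrDl mul1r (sinD (_ * _)) (cosD (_ * _)) sinpi cospi IH1 IH2 exprSr.
by split; ring.
Qed.

(** The Dirichlet kernel in the variable [2 x]; at the points [pi u / l] with [l = 2 h + 1] it sums
    [u]-th powers of the [l]-th roots of unity. *)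
Definition dirichlet h x : R := 1 + 2 * \sum_(j < h) cos (2 * j.+1%:R * x).

Lemma dirichlet_sin h x : sin x * dirichlet h x = sin ((2 * h%:R + 1) * x).
Proof.
rewrite /dirichlet; elim: h => [|h IH].
  by rewrite big_ord0 mulr0 addr0 mulr1; congr sin; ring.
rewrite big_ord_recr/= (mulrDr 2) addrA (mulrDr (sin x)) IH -(@natr1 R h).
have -> : (2 * h%:R + 1) * x = 2 * (h%:R + 1) * x - x by ring.
have -> : (2 * (h%:R + 1) + 1) * x = 2 * (h%:R + 1) * x + x by ring.
by rewrite sinB sinD; ring.
Qed.

Lemma sin_frac_neq0 l d : (0 < l)%N -> ~~ (l %| d)%N -> sin (pi * d%:R / l%:R : R) != 0.
Proof.
move=> l0 ld.
have lR : 0 < l%:R :> R by rewrite ltr0n.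
have -> : pi * d%:R / l%:R = (d %/ l)%N%:R * pi + pi * (d %% l)%N%:R / l%:R :> R.
  by rewrite {1}(divn_eq d l) natrD natrM; field; rewrite gt_eqF.
have [s0 c0] := sin_natpi (d %/ l); rewrite sinD s0 c0 mul0r add0r mulf_neq0 ?signr_eq0//.
rewrite gt_eqF// sin_gt0_pi//; have p0 := @pi_gt0 R.
have r0 : (0 < d %% l)%N by rewrite lt0n.
have rl : (d %% l < l)%N by rewrite ltn_mod.
by rewrite divr_gt0 ?mulr_gt0 ?ltr0n//= ltr_pdivrMr// ltr_pM2l// ltr_nat rl.
Qed.

(** When [l] does not divide [u], the kernel is [sin (pi u) / sin (pi u / l)], whose numerator
    vanishes. *)
Lemma dirichlet_root h u : let l := (2 * h).+1 in
  dirichlet h (pi * u%:R / l%:R) = if (l %| u)%N then l%:R else 0.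
Proof.
move=> l; have lE : l%:R = 2 * h%:R + 1 :> R by rewrite /l -natr1 natrM.
have l0 : l%:R != 0 :> R by rewrite pnatr_eq0.
case: ifP => [/dvdnP[k ->]|/negbT lu].
  rewrite /dirichlet (eq_bigr (fun=> 1)) => [|j _].
    by rewrite sumr_const card_ord lE; ring.
  have -> : 2 * j.+1%:R * (pi * (k * l)%:R / l%:R) = (2 * (j.+1 * k))%:R * pi :> R.
    by rewrite !natrM; field.
  by rewrite (sin_natpi _).2 exprM sqrrN !expr1n.
apply: (mulfI (sin_frac_neq0 (ltn0Sn _) lu)); rewrite dirichlet_sin mulr0 -lE.
have -> : l%:R * (pi * u%:R / l%:R) = u%:R * pi :> R by field.
exact: (sin_natpi u).1.
Qed.

Lemma sum_multiples (f : nat -> R) l m : (0 < l)%N ->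
  (forall r, (m < r)%N -> f r = 0) ->
  \sum_(u < m) (if (l %| u.+1)%N then f u.+1 else 0) = \sum_(k < m) f (k.+1 * l)%N.
Proof.
move=> l0 f0.
have B K : \sum_(0 <= u < K * l) (if (l %| u.+1)%N then f u.+1 else 0) =
    \sum_(k < K) f (k.+1 * l)%N.
  elim: K => [|K IH]; first by rewrite mul0n big_geq// big_ord0.
  rewrite (@big_cat_nat _ _ _ (K * l)) ?leq_mul2r ?leqnSn ?orbT//= IH big_ord_recr/=; congr (_ + _).
  rewrite -{1}[(K * l)%N]add0n big_addn; have -> : (K.+1 * l - K * l = l.-1.+1)%N.
    by rewrite -mulnBl subSnn mul1n prednK.
  rewrite big_nat_recr//= big1_seq ?add0r => [|i /andP[_]].
    have -> : (l.-1 + K * l).+1 = (K.+1 * l)%N by rewrite -addSn prednK// mulSn.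
    by rewrite dvdn_mull.
  rewrite mem_index_iota => /andP[_ il]; rewrite -addSn dvdn_addl ?dvdn_mull//.
  by rewrite gtnNdvd// -ltn_predRL.
rewrite -(B m) (@big_cat_nat _ _ _ m) ?leq_pmulr//= [X in _ = _ + X]big1_seq.
  by rewrite addr0 big_mkord.
by move=> i /andP[_]; rewrite mem_index_iota => /andP[mi _]; rewrite f0 ?if_same.
Qed.

Definition bratio m r : R := 'C(2 * m, m + r)%:R / 'C(2 * m, m)%:R.

Lemma cbin_gt0 m : 0 < 'C(2 * m, m)%:R :> R.
Proof. by rewrite ltr0n bin_gt0; lia. Qed.

Lemma bratio_gt m r : (m < r)%N -> bratio m r = 0.
Proof. by move=> mr; rewrite /bratio bin_small ?mul0r//; lia. Qed.

(* Filtering the binomial row 2m by residues modulo l = 2h+1 with l-th roots of unity. *)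
Lemma polya_identity m h : let l := (2 * h).+1 in
  'C(2 * m, m)%:R * l%:R / 4 ^+ m * (1 + 2 * \sum_(k < m) bratio m (k.+1 * l)) =
  1 + 2 * \sum_(j < h) (cos (pi * j.+1%:R / l%:R) ^+ 2) ^+ m :> R.
Proof.
move=> l; have c0 := cbin_gt0 m.
have f4 : 4 ^+ m != 0 :> R by rewrite expf_neq0.
have E x : (cos x ^+ 2) ^+ m = ('C(2 * m, m)%:R +
  2 * \sum_(u < m) 'C(2 * m, m + u.+1)%:R * cos (2 * u.+1%:R * x)) / 4 ^+ m.
  by rewrite -cos_pow2 exprM -expr_div_n; congr (_ ^+ _); field.
(* The summand 1 on the right is the contribution of the root [j = 0], expanded here in the same way
   as the others. *)
have E0 := E 0; rewrite cos0 !expr1n in E0.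
transitivity ((('C(2 * m, m)%:R + 2 * \sum_(u < m) 'C(2 * m, m + u.+1)%:R * cos (2 * u.+1%:R * 0)) / 4 ^+ m) +
  2 * \sum_(j < h) ('C(2 * m, m)%:R +
  2 * \sum_(u < m) 'C(2 * m, m + u.+1)%:R * cos (2 * u.+1%:R * (pi * j.+1%:R / l%:R))) / 4 ^+ m : R); last first.
  by rewrite -E0; congr (_ + _ * _); apply: eq_bigr => j _; rewrite E.
rewrite -[in RHS]mulr_suml big_split/= sumr_const card_ord -mulr_sumr exchange_big/=.
have -> : \sum_(u < m) 'C(2 * m, m + u.+1)%:R * cos (2 * u.+1%:R * 0) = \sum_(u < m) 'C(2 * m, m + u.+1)%:R :> R.
  by apply: eq_bigr => u _; rewrite mulr0 cos0 mulr1.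
have -> : \sum_(k < m) bratio m (k.+1 * l) =
   \sum_(u < m) (if (l %| u.+1)%N then bratio m u.+1 else 0).
  by rewrite (@sum_multiples (bratio m))// => r; exact: bratio_gt.
have D (u : 'I_m) : (if (l %| u.+1)%N then bratio m u.+1 else 0) =
   'C(2 * m, m + u.+1)%:R / ('C(2 * m, m)%:R * l%:R) * dirichlet h (pi * u.+1%:R / l%:R).
  rewrite dirichlet_root -/l /bratio; case: ifP => _; last by rewrite mulr0.
  by rewrite invfM mulrA divfK// pnatr_eq0.
rewrite (eq_bigr _ (fun (i : 'I_m) _ => D i)) /dirichlet.
have D2 (u : 'I_m) : 'C(2 * m, m + u.+1)%:R / ('C(2 * m, m)%:R * l%:R) *
   (1 + 2 * \sum_(j < h) cos (2 * j.+1%:R * (pi * u.+1%:R / l%:R))) =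
   ('C(2 * m, m)%:R * l%:R)^-1 * ('C(2 * m, m + u.+1)%:R + 2 * \sum_(j < h) 'C(2 * m, m + u.+1)%:R * cos (2 * u.+1%:R * (pi * j.+1%:R / l%:R))) :> R.
  rewrite -mulr_sumr (eq_bigr (fun j : 'I_h => cos (2 * u.+1%:R * (pi * j.+1%:R / l%:R)))).
    by ring.
  by move=> j _; congr cos; ring.
rewrite (eq_bigr _ (fun (i : 'I_m) _ => D2 i)) -mulr_sumr big_split/= -mulr_sumr.
have lE : l%:R = 2 * h%:R + 1 :> R by rewrite /l -natr1 natrM.
have l0 : l%:R != 0 :> R by rewrite pnatr_eq0.
set S1 := \sum_(u < m) _; set S2 := \sum_(u < m) _.
rewrite -[_ *+ h]mulr_natr; have -> : h%:R = (l%:R - 1) / 2 :> R by rewrite lE; field.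
by field; rewrite f4 l0 gt_eqF.
Qed.

End Polya.

(** * Gaussian limits of binomial ratios and cosine powers *)

Section ThetaLimit.
Context {R : realType}.
Implicit Types (x t a : R) (m h k l n u r : nat).

Lemma bratio0 m : bratio m 0 = 1 :> R.
Proof. by rewrite /bratio addn0 divff// gt_eqF// cbin_gt0. Qed.

Lemma bratioS m r : (r <= m)%N ->
  bratio m r.+1 = bratio m r * (1 - (2 * r%:R + 1) / (m%:R + r%:R + 1)) :> R.
Proof.
move=> rm; have c0 := @cbin_gt0 R m.
have d0 : m%:R + r%:R + 1 != 0 :> R by rewrite -natrD natr1 pnatr_eq0.
have := mul_bin_left (2 * m) (m + r); rewrite -addnS.
have -> : (2 * m - (m + r) = m - r)%N by lia.
move=> /(congr1 (fun n => n%:R : R)); rewrite !natrM natrB// addnS -natr1 natrD => h.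
rewrite /bratio addnS; apply: (mulfI d0); rewrite mulrA h.
move: ('C(2 * m, m + r)%:R : R) => B.
by field; rewrite d0 gt_eqF.
Qed.

Lemma bratio_ge0 m r : 0 <= bratio m r :> R.
Proof. by rewrite /bratio divr_ge0. Qed.

(** The ratio of consecutive entries is [1 - v <= e^(-v)], and the odd numbers [2 r + 1] add up to a
    square. Enlarging every denominator to [m + k] makes the exponents telescope. *)
Lemma bratio_le m r k : (r <= k)%N -> (k <= m)%N -> (0 < m)%N ->
  bratio m r <= expR (- (r%:R ^+ 2 / (m%:R + k%:R))) :> R.
Proof.
move=> rk km m0; elim: r rk => [|r IH] rk.
  by rewrite bratio0 expr0n/= mul0r oppr0 expR0.
have rk' := ltnW rk; have mR : 0 < m%:R :> R by rewrite ltr0n.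
have D0 : 0 < m%:R + k%:R :> R by rewrite ltr_wpDr.
have d0 : 0 < m%:R + r%:R + 1 :> R by rewrite -natrD natr1 ltr0n.
rewrite bratioS ?(leq_trans rk' km)//.
have -> : - (r.+1%:R ^+ 2 / (m%:R + k%:R)) = - (r%:R ^+ 2 / (m%:R + k%:R)) + - ((2 * r%:R + 1) / (m%:R + k%:R)) :> R.
  by rewrite -natr1; ring.
rewrite expRD; apply: ler_pM (IH rk') _ => //; first exact: bratio_ge0.
  rewrite subr_ge0 ler_pdivrMr// mul1r.
  by have : r%:R <= m%:R :> R; [rewrite ler_nat (leq_trans rk' km)|lra].
apply: le_trans (expR_ge1Dx _); rewrite lerD2l lerN2 ler_pM2l ?ltr_wpDl ?mulr_ge0//.
rewrite lef_pV2 ?posrE// -addrA natr1 lerD2l ler_nat//.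
Qed.

Lemma one_sub_ge_exp x : 0 <= x < 1 -> expR (- (x / (1 - x))) <= 1 - x.
Proof.
move=> /andP[x0 x1]; have h : 0 < 1 - x by rewrite subr_gt0.
rewrite expRN -[leRHS]invrK lef_pV2 ?posrE ?expR_gt0 ?invr_gt0//.
apply: le_trans (expR_ge1Dx _); rewrite le_eqVlt; apply/orP; left; apply/eqP.
by field; rewrite gt_eqF.
Qed.

(** The counterpart from below rests on [1 - v >= e^(- v / (1 - v))]; here [v / (1 - v)] is
    [(2 r + 1) / (m - r)], whence the denominator [m - k]. *)
Lemma bratio_ge m r k : (r <= k)%N -> (k < m)%N ->
  expR (- (r%:R ^+ 2 / (m%:R - k%:R))) <= bratio m r :> R.
Proof.
move=> rk km; elim: r rk => [|r IH] rk.
  by rewrite bratio0 expr0n/= mul0r oppr0 expR0.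
have rk' := ltnW rk; have D0 : 0 < m%:R - k%:R :> R by rewrite subr_gt0 ltr_nat.
have d0 : 0 < m%:R + r%:R + 1 :> R by rewrite -natrD natr1 ltr0n.
have rkR : r%:R + 1 <= k%:R :> R by rewrite natr1 ler_nat.
have r0 : 0 <= r%:R :> R by [].
have dr : 0 < m%:R - r%:R :> R by lra.
rewrite bratioS ?(leq_trans rk' (ltnW km))//.
have -> : - (r.+1%:R ^+ 2 / (m%:R - k%:R)) = - (r%:R ^+ 2 / (m%:R - k%:R)) + - ((2 * r%:R + 1) / (m%:R - k%:R)) :> R.
  by rewrite -natr1; ring.
rewrite expRD; apply: ler_pM (IH rk') _; rewrite ?expR_ge0//.
set v := (2 * r%:R + 1) / (m%:R + r%:R + 1).
have v01 : 0 <= v < 1 by rewrite divr_ge0 ?ltr_pdivrMr ?mul1r ?(ltW d0)//=; lra.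
apply: le_trans (one_sub_ge_exp v01); rewrite ler_expR lerN2.
have -> : v / (1 - v) = (2 * r%:R + 1) / (m%:R - r%:R).
  by rewrite /v; field; rewrite !gt_eqF//; lra.
rewrite ler_pM2l ?lef_pV2 ?posrE//; lra.
Qed.

(** Below [1 / 2] by [sin_quad]; beyond it by monotonicity, as [sin (1 / 2) >= 1 / 4] and
    [pi / 2 < 2]. The uses require linearity in [x], not a sharp slope. *)
Lemma sin_ge_lin x : 0 <= x <= pi / 2 -> x / 8 <= sin x.
Proof.
move=> /andP[x0 x1]; have [xh|xh] := leP x (1 / 2).
  have /sin_quad : `|x| <= 1 by rewrite ger0_norm//; lra.
  by rewrite ler_norml => /andP[h _]; nra.
have := @pi_gt0 R => p0; have p2 := @pihalf_lt2 R.
have h : `|1 / 2 : R| <= 1 by rewrite ger0_norm; lra.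
have := sin_quad h; rewrite ler_norml => /andP[h1 _].
have : sin (1 / 2) < sin x by rewrite ltr_sin ?in_itv/=; lra.
lra.
Qed.

Lemma cvg_lim_finite (v : nat -> R) K : (forall k, (K <= k)%N -> v k = 0) ->
  series v @ \oo --> \sum_(k < K) v k.
Proof.
move=> h; apply: (@cvg_near_cst _ _ _ _ _); exists K => // n /= Kn.
rewrite /series/= (@big_cat_nat _ _ _ K)//= [X in _ + X]big1_seq ?addr0 ?big_mkord//.
by move=> i /andP[_]; rewrite mem_index_iota => /andP[Ki _]; exact: h.
Qed.

Lemma tanneryR (u : nat -> nat -> R) (v b U : nat -> R) (l : R) :
  (forall N k, `|u N k| <= b k) -> cvgn (series b) ->
  (forall k, u N k @[N --> \oo] --> v k) ->
  (forall N, series (u N) @ \oo --> U N) -> series v @ \oo --> l -> U @ \oo --> l.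
Proof.
move=> ub cb uv uU vl; apply/clim_real.
apply: (@tannery R (fun N k => (u N k)%:C) (fun k => (v k)%:C) b) => //.
- by move=> N k; rewrite cabs_real.
- by move=> k; apply: (clim_real (fun N => u N k) (v k)).1; exact: uv.
- by move=> N; apply: (csum_real (u N) (U N)).1; exact: uU.
- exact: (csum_real v l).1.
Qed.

Definition theta_term a k : R := expR (- (a * k.+1%:R ^+ 2)).

Lemma theta_term_le a k : 0 < a -> theta_term a k <= expR (- a) * expR (- a) ^+ k.
Proof.
move=> a0; rewrite -exprS -expRM_natl ler_expR mulrN lerN2 mulrC ler_wpM2l ?(ltW a0)//.
have : 1 <= k.+1%:R :> R by rewrite ler1n.
nra.
Qed.

Lemma expN_itv a : 0 < a -> (0 : R) <= expR (- a) < 1.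
Proof. by move=> a0; rewrite expR_ge0 expR_lt1 oppr_lt0. Qed.

Lemma theta_cvg a : 0 < a -> cvgn (series (theta_term a)).
Proof.
move=> a0; apply: (@series_le_cvg _ _ (fun k => expR (- a) * expR (- a) ^+ k)) => [k|k|k|].
- exact: expR_ge0.
- by rewrite mulr_ge0 ?exprn_ge0 ?expR_ge0.
- exact: theta_term_le.
- exact/geo_cvg/expN_itv.
Qed.

Definition theta_sum a : R := limn (series (theta_term a)).
(** For [a > 0], the sum of [exp (- a n^2)] over all integers [n]. *)
Definition theta a : R := 1 + 2 * theta_sum a.

Lemma theta_sum_ge0 a : 0 < a -> 0 <= theta_sum a.
Proof.
move=> a0; apply: limr_ge; first exact: theta_cvg.
by apply: nearW => n; rewrite /series/= sumr_ge0// => k _; exact: expR_ge0.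
Qed.

Lemma theta_gt0 a : 0 < a -> 0 < theta a.
Proof. by move=> /theta_sum_ge0; rewrite /theta; lra. Qed.

Section Limit.
Variable a : R.
Hypothesis a0 : 0 < a.

Let s N : R := Num.sqrt N.+1%:R.
(** The modulus [ll N = 2 * hh N + 1] is odd and within 1 of [sqrt (a (N + 1))]. At this scale the
    binomial ratios at its multiples tend to the terms of [theta a], and the cosine powers to those
    of [theta (pi^2 / a)]. *)
Let hh N : nat := Num.truncn (Num.sqrt (a * N.+1%:R) / 2).
Let ll N : nat := (2 * hh N).+1.
Let L N : R := (ll N)%:R.
Let e N : R := (s N)^-1.

Let s0 N : 0 < s N. Proof. by rewrite sqrtr_gt0 ltr0n. Qed.
Let e0 N : 0 < e N. Proof. by rewrite invr_gt0. Qed.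
Let sqr_s N : s N ^+ 2 = N.+1%:R. Proof. by rewrite sqr_sqrtr. Qed.
Let sqr_e N : e N ^+ 2 = N.+1%:R^-1. Proof. by rewrite exprVn sqr_s. Qed.
Let s1 N : 1 <= s N. Proof. by rewrite -sqrtr1 ler_wsqrtr// ler1n. Qed.

Let L_bound N : Num.sqrt a * s N - 1 <= L N <= Num.sqrt a * s N + 1.
Proof.
have h0 : 0 <= Num.sqrt (a * N.+1%:R) / 2 by rewrite divr_ge0 ?sqrtr_ge0.
have E : Num.sqrt (a * N.+1%:R) = Num.sqrt a * s N by rewrite sqrtrM// ltW.
have h1 : (hh N)%:R <= Num.sqrt a * s N / 2 by rewrite -E truncn_le h0.
have h2 : Num.sqrt a * s N / 2 < (hh N)%:R + 1 by rewrite -E natr1; exact: truncnS_gt.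
have -> : L N = 2 * (hh N)%:R + 1 by rewrite /L /ll -natr1 natrM.
by apply/andP; split; lra.
Qed.

Let L1 N : 1 <= L N. Proof. by rewrite ler1n. Qed.

Let e_lim : e @ \oo --> (0 : R).
Proof.
have h : (fun N => Num.sqrt (N.+1%:R^-1 : R)) @ \oo --> Num.sqrt (0 : R).
  by apply: (cvg_comp _ _ (@cvg_harmonic R)); exact: sqrt_continuous.
rewrite sqrtr0 in h; apply: cvg_trans h; apply: near_eq_cvg; apply: nearW => N.
by rewrite /e /s sqrtrV.
Qed.

Let Le_lim : (fun N => L N * e N) @ \oo --> Num.sqrt a.
Proof.
apply/cvgrPdist_le => d d0; move/cvgrPdist_le : e_lim => /(_ d d0).
apply: filterS => N; rewrite sub0r normrN (gtr0_norm (e0 N)); apply: le_trans.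
have [/andP[h1 h2] se] : (Num.sqrt a * s N - 1 <= L N <= Num.sqrt a * s N + 1) /\ s N * e N = 1.
  by split; [exact: L_bound|rewrite mulfV// gt_eqF].
have -> : Num.sqrt a - L N * e N = (Num.sqrt a * s N - L N) * e N by rewrite mulrBl -mulrA se mulr1.
rewrite normrM (gtr0_norm (e0 N)) ler_piMl ?(ltW (e0 N))// ler_norml.
by apply/andP; split; lra.
Qed.

Let L2_ge N : a * N.+1%:R / 4 <= L N ^+ 2.
Proof.
have -> : a * N.+1%:R = (Num.sqrt a * s N) ^+ 2 by rewrite exprMn sqr_s sqr_sqrtr// ltW.
have h0 : 0 <= Num.sqrt a * s N by rewrite mulr_ge0 ?sqrtr_ge0// ltW.
have /andP[h1 _] := L_bound N; have := L1 N; nra.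
Qed.

Let L2_le N : L N ^+ 2 <= (Num.sqrt a + 1) ^+ 2 * N.+1%:R.
Proof.
rewrite -sqr_s -exprMn ler_pXn2r ?nnegrE ?mulr_ge0 ?addr_ge0 ?sqrtr_ge0 ?(ltW (s0 N))//.
by have /andP[_ h1] := L_bound N; have := s1 N; rewrite mulrDl mul1r; lra.
Qed.

Let U1 N := \sum_(k < N.+1) bratio N.+1 (k.+1 * ll N) : R.
Let U2 N := \sum_(j < hh N) (cos (pi * j.+1%:R / L N) ^+ 2) ^+ N.+1.

Let U1_lim : U1 @ \oo --> theta_sum a.
Proof.
have q : 0 < a / 8 by rewrite divr_gt0.
pose u N k : R := bratio N.+1 (k.+1 * ll N).
have u0 N k : (N.+1 <= k)%N -> u N k = 0.
  by move=> Nk; apply: bratio_gt; rewrite /ll; nia.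
apply: (@tanneryR u (theta_term a) (fun k => expR (- (a / 8)) * expR (- (a / 8)) ^+ k)).
- move=> N k; rewrite ger0_norm ?bratio_ge0// -exprS -expRM_natl.
  have [kN|kN] := leqP (k.+1 * ll N) N.+1; last by rewrite /u bratio_gt// expR_ge0.
  (* For [r = (k + 1) L <= N + 1] the exponent [r^2 / (N + 1 + r)] is at least [r^2 / (2 (N + 1))],
     and [L^2 >= a (N + 1) / 4] makes this at least [(k + 1) a / 8]. *)
  apply: le_trans (bratio_le (leqnn _) kN (ltn0Sn _)) _.
  rewrite ler_expR mulrN lerN2 natrM -/(L N).
  have N0 : 0 < N.+1%:R :> R by rewrite ltr0n.
  have k1 : 1 <= k.+1%:R :> R by rewrite ler1n.
  have kN' : k.+1%:R * L N <= N.+1%:R by rewrite -natrM ler_nat.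
  have kL0 : 0 <= k.+1%:R * L N by rewrite mulr_ge0.
  rewrite ler_pdivlMr ?ltr_wpDr//.
  apply: (@le_trans _ _ (k.+1%:R * (a / 8) * (2 * N.+1%:R))).
    by rewrite ler_wpM2l ?mulr_ge0 ?(ltW q)//; lra.
  have := L2_ge N => h; rewrite exprMn.
  have : k.+1%:R * (a * N.+1%:R / 4) <= k.+1%:R ^+ 2 * L N ^+ 2.
    apply: ler_pM => //; first by rewrite divr_ge0// mulr_ge0// ltW.
    by rewrite expr2; nra.
  lra.
- exact/geo_cvg/expN_itv.
- move=> k; rewrite /theta_term.
  pose r N : R := k.+1%:R * (L N * e N).
  have r_lim : r @ \oo --> k.+1%:R * Num.sqrt a by apply: cvgM => //; exact: cvg_cst.
  have re_lim : (fun N => r N * e N) @ \oo --> (0 : R).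
    by rewrite -(mulr0 (k.+1%:R * Num.sqrt a)); exact: cvgM.
  have r2 : (k.+1%:R * Num.sqrt a) ^+ 2 = a * k.+1%:R ^+ 2 by rewrite exprMn sqr_sqrtr ?ltW// mulrC.
  have lim_up : (fun N => expR (- (r N ^+ 2 / (1 + r N * e N)))) @ \oo --> expR (- (a * k.+1%:R ^+ 2)).
    apply: continuous_cvg; first exact: continuous_expR.
    apply: cvgN; rewrite -r2 -[X in _ --> X]divr1 -[X in _ / X]addr0; apply: cvgM.
      exact: cvgM.
    by apply: cvgV; [rewrite addr0 oner_neq0|exact: (cvgD (cvg_cst _) re_lim)].
  have lim_lo : (fun N => expR (- (r N ^+ 2 / (1 - r N * e N)))) @ \oo --> expR (- (a * k.+1%:R ^+ 2)).
    apply: continuous_cvg; first exact: continuous_expR.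
    apply: cvgN; rewrite -r2 -[X in _ --> X]divr1 -[X in _ / X]subr0; apply: cvgM.
      exact: cvgM.
    by apply: cvgV; [rewrite subr0 oner_neq0|exact: (cvgB (cvg_cst _) re_lim)].
  (* The Gaussian bounds are taken with cutoff equal to the index [(k + 1) ll N]. As this is of
     order [sqrt N], the denominators [N + 1] plus or minus it agree in the limit. *)
  apply: squeeze_cvgr lim_lo lim_up.
  have : \forall N \near \oo, r N * e N < 1.
    move/cvgrPdist_lt : re_lim => /(_ 1 ltr01); apply: filterS => N.
    rewrite sub0r normrN; exact: le_lt_trans (ler_norm _).
  apply: filterS => N rN.
  have N0 : 0 < N.+1%:R :> R by rewrite ltr0n.
  have rE : r N * e N = (k.+1 * ll N)%:R / N.+1%:R.
    by rewrite /r natrM -/(L N) -sqr_e expr2; ring.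
  have r2E : r N ^+ 2 = (k.+1 * ll N)%:R ^+ 2 / N.+1%:R.
    by rewrite /r natrM -/(L N) -sqr_e; ring.
  have kN : (k.+1 * ll N < N.+1)%N by rewrite -(ltr_nat R) -[ltRHS]mul1r -ltr_pdivrMr// -rE.
  have E1 : r N ^+ 2 / (1 + r N * e N) = (k.+1 * ll N)%:R ^+ 2 / (N.+1%:R + (k.+1 * ll N)%:R).
    by rewrite rE r2E; field; rewrite !gt_eqF ?ltr_wpDr//.
  have E2 : r N ^+ 2 / (1 - r N * e N) = (k.+1 * ll N)%:R ^+ 2 / (N.+1%:R - (k.+1 * ll N)%:R).
    rewrite rE r2E; have : (k.+1 * ll N)%:R < N.+1%:R :> R by rewrite ltr_nat.
    move: N0 ((k.+1 * ll N)%:R) => + K; move: (N.+1%:R) => M M0 KM.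
    by field; rewrite !gt_eqF ?subr_gt0.
  by rewrite E1 E2 bratio_ge// bratio_le// ltnW.
- move=> N; exact: (cvg_lim_finite (u0 N)).
- exact: theta_cvg.
Qed.

Let U2_lim : U2 @ \oo --> theta_sum (pi ^+ 2 / a).
Proof.
have p0 := @pi_gt0 R; have p2 := @pi_ge2 R.
have A0 : 0 < (Num.sqrt a + 1) ^+ 2 by rewrite exprn_gt0// ltr_wpDl ?sqrtr_ge0.
(* [64] is the square of the 8 in [sin x >= x / 8], and [(sqrt a + 1)^2] comes from [L2_le];
   together they give [(N + 1) (x / 8)^2 >= q (j + 1)]. *)
pose q := ((Num.sqrt a + 1) ^+ 2 * 64)^-1.
have q0 : 0 < q by rewrite invr_gt0 mulr_gt0.
pose u N j : R := if (j < hh N)%N then (cos (pi * j.+1%:R / L N) ^+ 2) ^+ N.+1 else 0.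
have L0 N : 0 < L N by exact: lt_le_trans ltr01 (L1 N).
have ca0 : 0 < pi ^+ 2 / a by rewrite divr_gt0 ?exprn_gt0.
have u0 N j : (hh N <= j)%N -> u N j = 0 by rewrite /u ltnNge => ->.
apply: (@tanneryR u (theta_term (pi ^+ 2 / a)) (fun k => expR (- q) * expR (- q) ^+ k)).
- move=> N j; rewrite -exprS -expRM_natl /u; case: ifP => jh; last by rewrite normr0 expR_ge0.
  rewrite ger0_norm; last by rewrite exprn_ge0// sqr_ge0.
  rewrite cos2sin2; set x := pi * j.+1%:R / L N.
  have x0 : 0 <= x by rewrite divr_ge0 ?mulr_ge0 ?(ltW p0) ?(ltW (L0 N)).
  have xp : x <= pi / 2.
    rewrite /x ler_pdivrMr// -mulrA ler_pM2l// mulrC ler_pdivlMr// mulrC -natrM /L /ll ler_nat; lia.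
  have sx := sin_ge_lin (_ : 0 <= x <= pi / 2); rewrite x0 xp in sx; have {}sx := sx isT.
  have s2 : (x / 8) ^+ 2 <= sin x ^+ 2 by rewrite ler_pXn2r ?nnegrE//; lra.
  have c0 : 0 <= 1 - sin x ^+ 2 by rewrite -cos2sin2 sqr_ge0.
  have h1 : 1 - sin x ^+ 2 <= expR (- (x / 8) ^+ 2).
    by apply: le_trans (expR_ge1Dx _); rewrite lerD2l lerN2.
  apply: le_trans (_ : expR (- (x / 8) ^+ 2) ^+ N.+1 <= _).
    by rewrite ler_pXn2r ?nnegrE ?expR_ge0.
  rewrite -expRM_natl ler_expR !mulrN lerN2 /x /q.
  have j1 : 1 <= j.+1%:R :> R by rewrite ler1n.
  have := L2_le N; set A := (Num.sqrt a + 1) ^+ 2 => hA.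
  have hj : j.+1%:R <= (pi * j.+1%:R) ^+ 2 :> R.
    have hp : j.+1%:R <= pi * j.+1%:R :> R by rewrite ler_peMl//; lra.
    by rewrite (le_trans hp)// expr2 ler_peMl ?mulr_ge0 ?(ltW p0)// (le_trans j1 hp).
  have N0 : 0 <= N.+1%:R :> R by [].
  have LN := L0 N; move: j1 hj hA N0 LN A0; rewrite -/A.
  move: (j.+1%:R : R) (N.+1%:R : R) (L N) A => J n l B J1 hJ hl n0 l0 B0.
  have -> : n * (pi * J / l / 8) ^+ 2 = n * (pi * J) ^+ 2 / (64 * l ^+ 2).
    by field; rewrite gt_eqF.
  rewrite ler_pdivlMr ?mulr_gt0 ?exprn_gt0// mulrAC ler_pdivrMr ?mulr_gt0//.
  have h2 : 0 <= (B * n - l ^+ 2) * J by rewrite mulr_ge0 ?subr_ge0// (le_trans ler01).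
  have h3 := ler_wpM2l (mulr_ge0 (ltW B0) n0) hJ.
  move: h2 h3; rewrite (mulrC (B * n) ((pi * J) ^+ 2)).
  move: ((pi * J) ^+ 2) (l ^+ 2) => X Y; lra.
- exact/geo_cvg/expN_itv.
- move=> j; rewrite /theta_term.
  pose y N : R := pi * j.+1%:R / (L N * e N).
  have sa : 0 < Num.sqrt a by rewrite sqrtr_gt0.
  have y_lim : y @ \oo --> pi * j.+1%:R / Num.sqrt a.
    by apply: cvgM; [exact: cvg_cst|apply: cvgV => //; rewrite gt_eqF].
  have ye_lim : (fun N => y N * e N) @ \oo --> (0 : R).
    by rewrite -(mulr0 (pi * j.+1%:R / Num.sqrt a)); exact: cvgM.
  have y2 : (pi * j.+1%:R / Num.sqrt a) ^+ 2 = pi ^+ 2 / a * j.+1%:R ^+ 2.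
    by rewrite expr_div_n exprMn sqr_sqrtr ?(ltW a0)// mulrAC.
  have lim_up : (fun N => expR (- (y N ^+ 2 * (1 - y N * e N) ^+ 2))) @ \oo --> expR (- (pi ^+ 2 / a * j.+1%:R ^+ 2)).
    apply: continuous_cvg; first exact: continuous_expR.
    apply: cvgN; rewrite -y2 -[X in _ --> X]mulr1 -[X in _ * X](expr1n _ 2) -[X in _ * X ^+ 2]subr0.
    have h : (fun N => 1 - y N * e N) @ \oo --> (1 - 0 : R) by exact: (cvgB (cvg_cst _) ye_lim).
    by apply: cvgM; [exact: (cvgM y_lim y_lim)|exact: (cvgM h h)].
  have lim_lo : (fun N => expR (- (y N ^+ 2 / (1 - (y N * e N) ^+ 2)))) @ \oo --> expR (- (pi ^+ 2 / a * j.+1%:R ^+ 2)).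
    apply: continuous_cvg; first exact: continuous_expR.
    apply: cvgN; rewrite -y2 -[X in _ --> X]divr1 -[X in _ / X]subr0 -[X in _ - X](mulr0 0).
    apply: cvgM; first exact: (cvgM y_lim y_lim).
    apply: cvgV; first by rewrite mulr0 subr0 oner_neq0.
    exact: (cvgB (cvg_cst _) (cvgM ye_lim ye_lim)).
  apply: squeeze_cvgr lim_lo lim_up.
  have h1 : \forall N \near \oo, y N * e N < 1.
    move/cvgrPdist_lt : ye_lim => /(_ 1 ltr01); apply: filterS => N.
    rewrite sub0r normrN; exact: le_lt_trans (ler_norm _).
  have h2 : \forall N \near \oo, (j < hh N)%N.
    have : \forall N \near \oo, 2 * (j.+1%:R + 1) <= Num.sqrt a * s N.
      move/cvgrPdist_lt : e_lim => /(_ (Num.sqrt a / (2 * (j.+1%:R + 1)))).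
      have j0 : 0 < 2 * (j.+1%:R + 1) :> R by rewrite mulr_gt0// ltr_wpDl.
      rewrite divr_gt0// => /(_ isT); apply: filterS => N.
      rewrite sub0r normrN (gtr0_norm (e0 N)) ltr_pdivlMr// /e mulrC ltr_pdivrMr// => /ltW //.
    apply: filterS => N hN; have /andP[h _] := L_bound N.
    have : (j.+1%:R : R) < (hh N).+1%:R by move: h; rewrite /L /ll -!natr1 natrM; move: hN; rewrite -natr1; lra.
    by rewrite ltr_nat.
  apply: filterS2 h1 h2 => N yN jh; rewrite /u jh.
  set x := pi * j.+1%:R / L N.
  have xE : y N * e N = x by rewrite /y /x; field; rewrite !gt_eqF.
  have x2 : y N ^+ 2 = N.+1%:R * x ^+ 2.
    have se : s N * e N = 1 by rewrite /e mulfV ?gt_eqF.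
    rewrite -xE -sqr_s; move: (y N) (s N) (e N) se => Y S E SE.
    by rewrite -exprMn mulrCA SE mulr1.
  have x0 : 0 <= x by rewrite divr_ge0 ?mulr_ge0 ?(ltW p0) ?(ltW (L0 N)).
  have x1 : x < 1 by rewrite -xE.
  have hs : x * (1 - x) <= sin x.
    have /sin_quad : `|x| <= 1 by rewrite ger0_norm// ltW.
    by rewrite ler_norml => /andP[h _]; nra.
  have hsle : sin x <= x by apply: le_trans (ler_norm _) _; apply: le_trans (sin_le_id _) _; rewrite ger0_norm.
  have x10 : 0 <= x * (1 - x) by rewrite mulr_ge0// subr_ge0 ltW.
  have sl : (x * (1 - x)) ^+ 2 <= sin x ^+ 2.
    by rewrite ler_pXn2r ?nnegrE//; exact: le_trans hs.
  have su : sin x ^+ 2 <= x ^+ 2.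
    by rewrite ler_pXn2r ?nnegrE//; exact: le_trans hs.
  have xx : x ^+ 2 < 1 by nra.
  have c0 : 0 <= 1 - sin x ^+ 2 by rewrite -cos2sin2 sqr_ge0.
  clearbody x; rewrite cos2sin2 xE x2.
  have E1 t : expR (- (N.+1%:R * t)) = expR (- t) ^+ N.+1 by rewrite -expRM_natl mulrN.
  rewrite -[N.+1%:R * x ^+ 2 / _]mulrA -[N.+1%:R * x ^+ 2 * _]mulrA !E1.
  apply/andP; split.
    rewrite ler_pXn2r ?nnegrE ?expR_ge0//.
    have h := @one_sub_ge_exp (x ^+ 2); rewrite sqr_ge0 xx in h.
    by apply: le_trans (h isT) _; rewrite lerD2l lerN2.
  rewrite ler_pXn2r ?nnegrE ?expR_ge0//; apply: le_trans (expR_ge1Dx _).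
  by rewrite lerD2l lerN2 -exprMn.
- move=> N; rewrite /U2 (_ : \sum_(j < hh N) _ = \sum_(j < hh N) u N j).
    exact: (cvg_lim_finite (u0 N)).
  by apply: eq_bigr => j _; rewrite /u ltn_ord.
- exact: theta_cvg.
Qed.

(** The sequence on the left does not involve [a], so the limit on the right is the same for every
    [a]. *)
Lemma polya_limit :
  (fun N => 'C(2 * N.+1, N.+1)%:R / 4 ^+ N.+1 * Num.sqrt N.+1%:R : R) @ \oo -->
  theta (pi ^+ 2 / a) / (Num.sqrt a * theta a).
Proof.
have sa : 0 < Num.sqrt a by rewrite sqrtr_gt0.
have t0 := theta_gt0 a0.
have h : (fun N => (1 + 2 * U2 N) / (L N * e N * (1 + 2 * U1 N))) @ \oo -->
    theta (pi ^+ 2 / a) / (Num.sqrt a * theta a).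
  have aff (U : nat -> R) (l : R) : U @ \oo --> l -> (fun N => 1 + 2 * U N) @ \oo --> 1 + 2 * l.
    by move=> h; apply: cvgD; [exact: cvg_cst|apply: cvgM; [exact: cvg_cst|exact: h]].
  apply: cvgM; first exact: (aff _ _ U2_lim).
  apply: cvgV; first by rewrite mulf_neq0 ?gt_eqF.
  exact: (cvgM Le_lim (aff _ _ U1_lim)).
apply: cvg_trans h; apply: near_eq_cvg; apply: nearW => N.
rewrite /U2 /L -(polya_identity N.+1 (hh N)) -/(U1 N) -/(ll N) -/(L N).
have u0 : 0 < 1 + 2 * U1 N.
  by rewrite ltr_wpDr// mulr_ge0// sumr_ge0// => k _; exact: bratio_ge0.
have L0 : 0 < L N by exact: lt_le_trans ltr01 (L1 N).
rewrite -/(s N) /e; field.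
by rewrite !gt_eqF.
Qed.

End Limit.

Lemma theta_fe a : 0 < a -> theta (pi ^+ 2 / a) = Num.sqrt (a / pi) * theta a.
Proof.
move=> a0; have p0 := @pi_gt0 R.
have h1 := polya_limit a0; have h2 := polya_limit p0.
have h3 : theta (pi ^+ 2 / a) / (Num.sqrt a * theta a) =
    theta (pi ^+ 2 / pi) / (Num.sqrt pi * theta pi).
  exact: (cvg_unique _ h1 h2).
(* At [a = pi] the two theta values cancel, which identifies the common limit as [1 / sqrt pi]. *)
rewrite expr2 mulfK ?gt_eqF// -expr2 in h3.
have tp := theta_gt0 p0; have ta := theta_gt0 a0.
have [sa sp] : 0 < Num.sqrt a /\ 0 < Num.sqrt pi :> R by rewrite !sqrtr_gt0.
have {}h3 : theta (pi ^+ 2 / a) / (Num.sqrt a * theta a) = (Num.sqrt pi)^-1.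
  by rewrite h3; field; rewrite !gt_eqF.
rewrite sqrtrM ?(ltW a0)// sqrtrV ?(ltW p0)//.
apply: (mulIf (_ : (Num.sqrt a * theta a)^-1 != 0)); first by rewrite invr_eq0 mulf_neq0 ?gt_eqF.
by rewrite h3; field; rewrite !gt_eqF.
Qed.

End ThetaLimit.

(** * The Mellin transform of theta *)

Section RealIntegrals.
Variable R : realType.
Implicit Types (f g : R -> R).

Notation mu := (@lebesgue_measure R).
Local Notation "'\intR' f" := (\int[mu]_(u in [set: R]) (f u)%:E)%E (at level 10, f at level 9).

Lemma measurable_continuous f (D : set R) : continuous f -> measurable D ->
  measurable_fun D (EFin \o f).
Proof.
move=> cf mD; apply/measurable_EFinP; apply: measurable_funTS.
exact: continuous_measurable_fun.
Qed.

Let J n : set R := `[(- n.+1%:R : R), (n.+1%:R : R)]%classic.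

Lemma intR_exhaust f : continuous f -> (forall u, 0 <= f u) ->
  (fun n : nat => \int[mu]_(u in J n) (f u)%:E)%E @ \oo --> \intR f.
Proof.
move=> cf f0.
have -> : [set: R] = \bigcup_n J n.
  apply/seteqP; split=> // u _; exists (Num.bound u) => //; rewrite /J/= in_itv/= -ler_norml.
  by apply: le_trans (ltW (archi_boundP (normr_ge0 u))) _; rewrite ler_nat /Num.bound normr_id.
have h : {homo J : n m / (n <= m)%N >-> (n <= m)%O}.
  move=> n m nm; apply/subsetPset => u; rewrite /J/= !in_itv/= => /andP[h1 h2].
  have : n.+1%:R <= m.+1%:R :> R by rewrite ler_nat.
  by move=> h; apply/andP; split; [apply: le_trans h1; rewrite lerN2|exact: le_trans h].
have mJ n : measurable (J n) by exact: measurable_itv.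
have mf n : measurable_fun (J n) (EFin \o f) by exact: measurable_continuous.
have ef n u : J n u -> (0 <= (EFin \o f) u)%E by rewrite lee_fin.
refine (@ge0_nondecreasing_set_cvg_integral _ (measurableTypeR R) R J (EFin \o f) mu h mJ mf ef).
Qed.

(** Integration by parts for nonnegative integrands: on each compact [J n] the two integrals differ
    by the increment of [F], and monotone convergence carries the value, together with its
    finiteness, from [g] to [f]. *)
Lemma intR_FTC f g (F : R -> R) (y l : R) : continuous f -> continuous g ->
  (forall u, 0 <= f u) -> (forall u, 0 <= g u) ->
  (forall u : R, is_derive u (1 : R) F (f u - g u)) ->
  (fun n : nat => F n.+1%:R - F (- n.+1%:R)) @ \oo --> l ->
  \intR g = y%:E -> \intR f = (y + l)%:E.
Proof.
move=> cf cg f0 g0 dF Fl gy.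
have cF : continuous F.
  by move=> u; apply/differentiable_continuous/derivable1_diffP; have := dF u => -[].
have key n : (\int[mu]_(u in J n) (f u)%:E = \int[mu]_(u in J n) (g u)%:E
    + (F n.+1%:R - F (- n.+1%:R))%:E)%E.
  have ab : - n.+1%:R < n.+1%:R :> R by rewrite gtrN ?ltr0n.
  have cI h : continuous h -> mu.-integrable (J n) (EFin \o h).
    by move=> ch; apply: continuous_compact_integrable; [exact: segment_compact|exact: continuous_subspaceT].
  have h : (\int[mu]_(u in J n) (f u)%:E - \int[mu]_(u in J n) (g u)%:E =
     (F n.+1%:R)%:E - (F (- n.+1%:R))%:E)%E.
    rewrite -integralB_EFin ?cI//; last exact: measurable_itv.
    apply: (@continuous_FTC2 R (fun u => f u - g u) F _ _ ab).
    - by apply: continuous_subspaceT => u; apply: cvgB; [exact: cf|exact: cg].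
    - split=> [u _||].
      + by have := dF u => -[].
      + exact/cvg_at_right_filter/cF.
      + exact/cvg_at_left_filter/cF.
    - by move=> u _; rewrite derive1E; have := dF u => -[].
  rewrite EFinB -h addeC subeK// ge0_fin_numE; last by apply: integral_ge0 => u _; rewrite lee_fin.
  by have /integrableP[_] := cI _ cg; under eq_integral do rewrite /= ger0_norm//.
have h1 := intR_exhaust cf f0; have h2 := intR_exhaust cg g0.
rewrite gy in h2; apply: (cvg_unique _ h1) => //.
rewrite (_ : (fun n => _) = (fun n : nat => \int[mu]_(u in J n) (g u)%:E
    + (F n.+1%:R - F (- n.+1%:R))%:E)%E); last exact/funext.
rewrite EFinD; apply: cvgeD => //.
exact: (@cvg_comp _ _ _ _ EFin _ _ _ Fl).
Qed.
End RealIntegrals.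

(** * The Gamma integral and its logarithmic convexity *)

Section GammaIntegral.
Variable R : realType.

Notation mu := (@lebesgue_measure R).
Local Notation "'\intR' f" := (\int[mu]_(u in [set: R]) (f u)%:E)%E (at level 10, f at level 9).
Implicit Types a b x : R.

(* The Gamma integrand after the substitution [t = exp u]. *)
Definition gam a (u : R) : R := expR (a * u - expR u).

Lemma gam_ge0 a u : 0 <= gam a u. Proof. exact: expR_ge0. Qed.

Lemma gam_cont a : continuous (gam a).
Proof.
move=> u; apply: (@continuous_comp _ _ _ (fun u => a * u - expR u) expR); last exact: continuous_expR.
by apply: cvgB; [apply: cvgM; [exact: cvg_cst|exact: cvg_id]|exact: continuous_expR].
Qed.

Lemma gam_derive a u : is_derive u (1 : R) (gam a) (a * gam a u - gam (a + 1) u).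
Proof.
have h : is_derive u (1 : R) (fun u => a * u - expR u) (a *: 1 - expR u).
  by apply: is_deriveB; apply: is_deriveZ.
have h2 := @is_derive1_comp R expR (fun u => a * u - expR u) u _ _ (is_derive_expR _) h.
suff -> : a * gam a u - gam (a + 1) u = expR (a * u - expR u) * (a *: 1 - expR u) by exact: h2.
rewrite scaler1 /gam mulrDl mul1r (_ : a * u + u - expR u = (a * u - expR u) + u); last by ring.
by rewrite (expRD (a * u - expR u)); ring.
Qed.

Lemma expR_lim0 : (fun n : nat => expR (- n.+1%:R) : R) @ \oo --> (0 : R).
Proof.
have h : `|expR (- 1)| < 1 :> R by rewrite ger0_norm ?expR_ge0// expR_lt1 ltrN10.
rewrite (_ : (fun n : nat => _) = (fun n => expR (- 1) * expR (- 1) ^+ n)); last first.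
  by apply/funext => n; rewrite -exprS -expRM_natl mulrN1.
by rewrite -(mulr0 (expR (- 1))); apply: cvgM; [exact: cvg_cst|exact: cvg_expr].
Qed.

Lemma gam_bd a : 0 < a -> (fun n : nat => gam a n.+1%:R - gam a (- n.+1%:R)) @ \oo --> (0 : R).
Proof.
move=> a0; rewrite -[X in _ --> X](subr0 0); apply: cvgB.
  (* From [exp N >= 1 + N^2 / 2]; completing the square in [(a + 1) N - N^2 / 2] gives this
     constant. *)
  pose C := expR ((a + 1) ^+ 2 / 2).
  have h : (fun n : nat => C * expR (- n.+1%:R)) @ \oo --> (0 : R).
    by rewrite -(mulr0 C); apply: cvgM; [exact: cvg_cst|exact: expR_lim0].
  apply: (squeeze_cvgr _ (cvg_cst 0) h); apply: nearW => n; rewrite gam_ge0/= /C -expRD ler_expR.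
  have := @expR_ge1Dxn R n.+1%:R 1 (ler0n _ _).
  rewrite (_ : 2`! = 2)%N//; move: (n.+1%:R) => N.
  have := sqr_ge0 (a + 1 - N); rewrite !expr2; lra.
have h : (fun n : nat => expR (- (a * n.+1%:R))) @ \oo --> (0 : R).
  have e1 : `|expR (- a)| < 1 :> R by rewrite ger0_norm ?expR_ge0// expR_lt1 oppr_lt0.
  rewrite (_ : (fun n : nat => _) = (fun n => expR (- a) * expR (- a) ^+ n)); last first.
    by apply/funext => n; rewrite -exprS -expRM_natl; congr expR; ring.
  by rewrite -(mulr0 (expR (- a))); apply: cvgM; [exact: cvg_cst|exact: cvg_expr].
apply: (squeeze_cvgr _ (cvg_cst 0) h); apply: nearW => n; rewrite gam_ge0/= ler_expR.
by have := expR_ge0 (- n.+1%:R : R); lra.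
Qed.

Lemma gamS a y : 0 < a -> \intR (gam (a + 1)) = y%:E -> \intR (gam a) = (y / a)%:E.
Proof.
move=> a0 hy.
have h : \intR (fun u => a * gam a u) = (y + 0)%:E.
  apply: (intR_FTC _ _ _ _ (gam_derive a) (gam_bd a0) hy).
  - by move=> u; apply: cvgM; [exact: cvg_cst|exact: gam_cont].
  - exact: gam_cont.
  - by move=> u; rewrite mulr_ge0 ?gam_ge0 ?ltW.
  - exact: gam_ge0.
have : (a%:E * \intR (gam a) = y%:E)%E.
  rewrite -ge0_integralZl_EFin//; last 3 first.
  - by move=> u _; rewrite lee_fin gam_ge0.
  - by apply: measurable_continuous => //; exact: gam_cont.
  - exact: ltW.
  by rewrite addr0 in h; rewrite -h; apply: eq_integral => u _; rewrite EFinM.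
move=> /(congr1 (fun z => (a^-1)%:E * z)%E); rewrite muleA -EFinM mulVf ?gt_eqF// mul1e.
by rewrite -EFinM mulrC.
Qed.

Lemma gamD1 a y : 0 < a -> \intR (gam a) = y%:E -> \intR (gam (a + 1)) = (a * y)%:E.
Proof.
move=> a0 hy; have -> : a * y = a * y + - 0 by rewrite oppr0 addr0.
have ha : \intR (fun u => a * gam a u) = (a * y)%:E.
  rewrite EFinM -hy -ge0_integralZl_EFin//; last exact: ltW.
  - by move=> u _; rewrite lee_fin gam_ge0.
  - by apply: measurable_continuous => //; exact: gam_cont.
apply: (intR_FTC (F := fun u => - gam a u) _ _ _ _ _ _ ha).
- exact: gam_cont.
- by move=> u; apply: cvgM; [exact: cvg_cst|exact: gam_cont].
- exact: gam_ge0.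
- by move=> u; rewrite mulr_ge0 ?gam_ge0 ?ltW.
- by move=> u; rewrite -opprB; apply: is_deriveN; exact: gam_derive.
- rewrite (_ : (fun n => _) = (fun n : nat => - (gam a n.+1%:R - gam a (- n.+1%:R)))).
    by apply: cvgN; exact: gam_bd.
  by apply/funext => n; rewrite opprB addrC opprK.
Qed.

Lemma gam1 : \intR (gam 1) = 1%:E.
Proof.
rewrite -[1 in RHS]add0r.
apply: (@intR_FTC _ _ (cst 0) (fun u => - expR (- expR u))).
- exact: gam_cont.
- exact: cst_continuous.
- exact: gam_ge0.
- by [].
- move=> u; rewrite subr0.
  have h : is_derive u (1 : R) (fun u => - expR u) (- expR u) by apply: is_deriveN.
  have h2 := @is_derive1_comp R expR (fun u => - expR u) u _ _ (is_derive_expR _) h.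
  have h3 := is_deriveN h2.
  suff -> : gam 1 u = - (expR (- expR u) * - expR u) by exact: h3.
  by rewrite /gam mul1r expRD; ring.
- have hA : (fun n : nat => - expR (- expR n.+1%:R) : R) @ \oo --> - (0 : R).
    apply: cvgN; apply: (squeeze_cvgr _ (cvg_cst 0) expR_lim0); apply: nearW => n.
    rewrite expR_ge0/= ler_expR lerN2; have := expR_ge1Dx (n.+1%:R : R); lra.
  have hB : (fun n : nat => - expR (- expR (- n.+1%:R)) : R) @ \oo --> - (expR (- 0) : R).
    apply: cvgN; apply: continuous_cvg; first exact: continuous_expR.
    exact: (cvgN expR_lim0).
  have hC : (fun n : nat => - expR (- expR n.+1%:R) - - expR (- expR (- n.+1%:R))) @ \oo -->
      (- 0 - - expR (- 0) : R) by apply: cvgB.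
  have e1 : - 0 - - expR (- 0) = 1 :> R by rewrite oppr0 expR0; ring.
  by rewrite e1 in hC; exact: hC.
- by apply: integral0.
Qed.

(** Convexity of the exponential between 0 and [v], from the tangent at [x v]. *)
Lemma expR_young x v : 0 <= x -> x <= 1 -> expR (x * v) <= 1 - x + x * expR v.
Proof.
move=> x0 x1.
have h1 := expR_ge1Dx ((1 - x) * v); have h2 := expR_ge1Dx (- (x * v)).
have e1 : expR v = expR (x * v) * expR ((1 - x) * v) by rewrite -expRD; congr expR; ring.
have e2 : expR (x * v) * expR (- (x * v)) = 1 by rewrite expRN mulfV// gt_eqF ?expR_gt0.
have e0 := expR_gt0 (x * v).
have k1 := ler_wpM2l (ltW e0) h1; have k2 := ler_wpM2l (ltW e0) h2.
rewrite -e1 in k1; rewrite e2 in k2.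
have k3 := ler_wpM2l x0 k1; have x1' : 0 <= 1 - x by lra.
have k4 := ler_wpM2l x1' k2; lra.
Qed.

(** Logarithmic convexity, [Gamma (b + x) <= b^x Gamma b]: [expR_young] at [v = u - ln b] bounds the
    integrand by a combination of those for [b] and [b + 1]. *)
Lemma gam_squeeze b x y : 0 < b -> 0 <= x -> x <= 1 -> \intR (gam b) = y%:E ->
  \intR (gam (b + 1)) = (b * y)%:E ->
  exists2 z, \intR (gam (b + x)) = z%:E & z <= expR (x * ln b) * y.
Proof.
move=> b0 x0 x1 hy hy1.
pose A := (1 - x) * expR (x * ln b); pose B := x * expR (x * ln b) / b.
have A0 : 0 <= A by rewrite mulr_ge0 ?expR_ge0 ?subr_ge0.
have B0 : 0 <= B by rewrite mulr_ge0 ?invr_ge0 ?(ltW b0)// mulr_ge0 ?expR_ge0.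
have cA c a : continuous (fun u => c * gam a u).
  by move=> u; apply: cvgM; [exact: cvg_cst|exact: gam_cont].
have mA c a : measurable_fun [set: R] (EFin \o (fun u => c * gam a u)).
  by apply: measurable_continuous => //; exact: cA.
have pA c a u : 0 <= c -> 0 <= c * gam a u by move=> c0; rewrite mulr_ge0 ?gam_ge0.
have IA c a z : 0 <= c -> \intR (gam a) = z%:E -> \intR (fun u => c * gam a u) = (c * z)%:E.
  move=> c0 hz; rewrite EFinM -hz -ge0_integralZl_EFin//.
  - by move=> u _; rewrite lee_fin gam_ge0.
  - by apply: measurable_continuous => //; exact: gam_cont.
have h : (\intR (gam (b + x)) <= (A * y + B * (b * y))%:E)%E.
  rewrite EFinD -(IA _ _ _ A0 hy) -(IA _ _ _ B0 hy1) -ge0_integralD//.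
  - apply: ge0_le_integral => //.
    + by move=> u _; rewrite lee_fin gam_ge0.
    + by apply: measurable_continuous => //; exact: gam_cont.
    + by apply: emeasurable_funD; exact: mA.
    + move=> u _; rewrite -EFinD lee_fin /A /B /gam.
      have h := expR_young (u - ln b) x0 x1.
      have h2 := ler_wpM2l (expR_ge0 (x * ln b + (b * u - expR u))) h.
      rewrite -expRD in h2; rewrite (_ : x * ln b + _ + _ = (b + x) * u - expR u) in h2; last by ring.
      apply: le_trans h2 _.
      have eb : expR (u - ln b) = expR u / b by rewrite expRD expRN lnK// posrE.
      have e2 : expR ((b + 1) * u - expR u) = expR (b * u - expR u) * expR u.
        by rewrite -expRD; congr expR; ring.
      rewrite eb e2 (expRD (x * ln b)) le_eqVlt; apply/orP; left; apply/eqP; field.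
      by rewrite gt_eqF.
  - by move=> u _; rewrite lee_fin pA.
  - exact: mA.
  - by move=> u _; rewrite lee_fin pA.
  - exact: mA.
have h0 : (0 <= \intR (gam (b + x)))%E by apply: integral_ge0 => u _; rewrite lee_fin gam_ge0.
have fin : \intR (gam (b + x)) \is a fin_num.
  by rewrite ge0_fin_numE// (le_lt_trans h)// ltry.
exists (fine (\intR (gam (b + x)))); first by rewrite fineK.
rewrite -lee_fin fineK//; apply: le_trans h _; rewrite lee_fin /A /B le_eqVlt; apply/orP; left.
by apply/eqP; field; rewrite gt_eqF.
Qed.

End GammaIntegral.

(** * Gauss's product for Gamma *)

Section GammaProduct.
Variable R : realType.
Notation mu := (@lebesgue_measure R).
Local Notation "'\intR' f" := (\int[mu]_(u in [set: R]) (f u)%:E)%E (at level 10, f at level 9).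
Implicit Types x : R.

Lemma gam_shift x y n : 0 < x -> \intR (gam x) = y%:E ->
  \intR (gam (n%:R + x)) = (y * \prod_(k < n) (k%:R + x))%:E.
Proof.
move=> x0 hy; elim: n => [|n IH]; first by rewrite big_ord0 mulr1 add0r.
rewrite -natr1 addrAC (gamD1 _ IH) ?ltr_wpDl// big_ord_recr /=; congr (_%:E).
by ring.
Qed.

Lemma gam_nat n : \intR (gam n.+1%:R) = n`!%:R%:E.
Proof.
have := gam_shift n ltr01 (gam1 R); rewrite natr1 => ->; congr (_%:E).
rewrite mul1r fact_prod big_add1 /= big_mkord natr_prod.
by apply: eq_bigr => k _; rewrite natr1.
Qed.

(** Partial products of Gauss's formula for [1 / Gamma (x + 1)], with the power of [n + 1] written
    as an exponential. *)
Definition gprod x n : R := \prod_(k < n) (1 + x / k.+1%:R) * expR (- (x * ln n.+1%:R)).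

(** [g] is [Gamma (x + 1)]. Applied from [n + 1] to [n + 1 + x], [gam_squeeze] gives the upper bound
    1; applied from [n + 1 + x] to [n + 2], it gives the lower bound [1 - 1 / (n + 1)]. *)
Lemma gprod_lim x : 0 < x -> x < 1 -> exists2 g : R, \intR (gam x) = (g / x)%:E &
  (fun n => gprod x n * g) @ \oo --> (1 : R).
Proof.
move=> x0 x1.
have [g hg g1] := gam_squeeze ltr01 (ltW x0) (ltW x1) (gam1 R) (gamD1 ltr01 (gam1 R)).
rewrite addrC in hg; exists g; first exact: gamS.
have x10 : 0 < x + 1 by rewrite addr_gt0.
have prodE n : \prod_(k < n) (k%:R + (x + 1)) = n`!%:R * \prod_(k < n) (1 + x / k.+1%:R).
  rewrite fact_prod big_add1 /= big_mkord natr_prod -big_split/=; apply: eq_bigr => k _.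
  by rewrite -natr1; field; rewrite natr1.
have up n : gprod x n * g <= 1.
  have [z hz z1] := gam_squeeze (ltr0Sn R n) (ltW x0) (ltW x1) (gam_nat n) (gamD1 (ltr0Sn R n) (gam_nat n)).
  have := gam_shift n x10 hg; rewrite (_ : n%:R + (x + 1) = n.+1%:R + x); last by rewrite -natr1; ring.
  rewrite hz => -[zE]; rewrite zE prodE in z1.
  have nf : 0 < n`!%:R :> R by rewrite ltr0n fact_gt0.
  rewrite /gprod expRN mulrAC ler_pdivrMr ?expR_gt0// mul1r -(ler_pM2l nf).
  by move: z1; rewrite mulrC -mulrA (mulrC _ g) [n`!%:R * expR _]mulrC.
have lo n : 1 - n.+1%:R^-1 <= gprod x n * g.
  have b0 : 0 < n.+1%:R + x by rewrite addr_gt0.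
  have hb := gam_shift n x10 hg.
  rewrite (_ : n%:R + (x + 1) = n.+1%:R + x) in hb; last by rewrite -natr1; ring.
  have [||z] := gam_squeeze b0 (_ : 0 <= 1 - x) (_ : 1 - x <= 1) hb (gamD1 b0 hb); [lra|lra|].
  rewrite (_ : n.+1%:R + x + (1 - x) = n.+2%:R); last by rewrite -[n.+2%:R]natr1; ring.
  rewrite gam_nat => -[<-]; rewrite prodE factS natrM => h.
  have nf : 0 < n`!%:R :> R by rewrite ltr0n fact_gt0.
  have n1 : 0 < n.+1%:R :> R by [].
  have {h} : n.+1%:R <= expR ((1 - x) * ln (n.+1%:R + x)) * (g * \prod_(k < n) (1 + x / k.+1%:R)).
    by rewrite -(ler_pM2l nf); move: h; rewrite mulrC mulrA mulrCA !mulrA.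
  set Q := g * _ => h.
  rewrite /gprod mulrAC [_ * g]mulrC -/Q.
  have eL : expR (ln n.+1%:R) = n.+1%:R :> R by rewrite lnK// posrE.
  have hl : ln (n.+1%:R + x) <= ln n.+1%:R + n.+1%:R^-1.
    rewrite -[leRHS]expRK ler_ln ?posrE ?expR_gt0// expRD eL.
    have := ler_wpM2l (ltW n1) (expR_ge1Dx (n.+1%:R^-1 : R)); rewrite mulrDr mulfV ?gt_eqF//.
    lra.
  have h2 : expR (ln n.+1%:R) <= expR ((1 - x) * (ln n.+1%:R + n.+1%:R^-1)) * Q.
    rewrite eL; apply: le_trans h _; rewrite ler_wpM2r ?ler_expR ?ler_wpM2l ?subr_ge0 ?(ltW x1)//.
    rewrite /Q mulr_ge0//; first by rewrite -lee_fin -hg integral_ge0// => u _; rewrite lee_fin gam_ge0.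
    by rewrite prodr_ge0// => k _; rewrite addr_ge0// divr_ge0// ltW.
  have h3 := ler_wpM2r (expR_ge0 (- ((1 - x) * (ln n.+1%:R + n.+1%:R^-1)))) h2.
  rewrite -expRD mulrAC -expRD addrN expR0 mul1r in h3.
  have h4 := ler_wpM2r (expR_ge0 (- (x * ln n.+1%:R))) h3.
  apply: le_trans _ h4; rewrite -expRD.
  apply: le_trans (expR_ge1Dx _); rewrite mulrDr.
  have : 0 <= n.+1%:R^-1 * x by rewrite mulr_ge0 ?invr_ge0// ltW.
  by move: (n.+1%:R^-1) (ln n.+1%:R) => i l; lra.
have hinv : (fun n : nat => 1 - n.+1%:R^-1) @ \oo --> (1 : R).
  by rewrite -[X in _ --> X]subr0; apply: cvgB; [exact: cvg_cst|exact: cvg_harmonic].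
have hc : (fun _ : nat => (1 : R)) @ \oo --> (1 : R) by exact: cvg_cst.
apply: squeeze_cvgr hinv hc.
by apply: nearW => n; rewrite lo up.
Qed.
End GammaProduct.

(** * Riemann's integral for zeta and its moments *)

Section Mellin.
Variable R : realType.
Notation mu := (@lebesgue_measure R).
Local Notation "'\intR' f" := (\int[mu]_(u in [set: R]) (f u)%:E)%E (at level 10, f at level 9).
Implicit Types x r : R.

Lemma nneseries_real (u : nat -> R) (l : R) : series u @ \oo --> l ->
  (\sum_(0 <= n <oo) (u n)%:E = l%:E)%E.
Proof.
move=> ul; apply/cvg_lim => //.
rewrite (_ : (fun n => _) = EFin \o series u); first exact: (@cvg_comp _ _ _ _ EFin _ _ _ ul).
by apply/funext => n; rewrite /series/= sumEFin.
Qed.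

Lemma series_nneseries (u : nat -> R) (l : R) : (forall n, 0 <= u n) ->
  (\sum_(0 <= n <oo) (u n)%:E = l%:E)%E -> series u @ \oo --> l.
Proof.
move=> u0 ul.
have h : cvgn (fun n => \sum_(0 <= i < n) (u i)%:E)%E.
  by apply: is_cvg_nneseries => n _ _; rewrite lee_fin.
have h2 : (fun n => \sum_(0 <= i < n) (u i)%:E)%E @ \oo --> l%:E by rewrite -ul.
have /fine_cvgP[_] := h2.
rewrite (_ : _ \o _ = series u)//.
by apply/funext => n; rewrite /series/= sumEFin.
Qed.

Lemma cosh_series (y : R) :
  series (fun k => 2 * y ^+ (2 * k) / (2 * k)`!%:R) @ \oo --> expR y + expR (- y).
Proof.
have h (z : R) : series (exp_coeff z) @ \oo --> expR z by exact: is_cvg_series_exp_coeff.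
have h2 : (fun n => series (exp_coeff y) (2 * n)%N + series (exp_coeff (- y)) (2 * n)%N) @ \oo
    --> expR y + expR (- y).
  have d : (fun n : nat => (2 * n)%N) @ \oo --> \oo.
    by apply/cvgnyPge => N; exists N => // n /=; lia.
  by apply: cvgD; apply: (cvg_comp _ _ d); exact: h.
rewrite (_ : series _ = (fun n => series (exp_coeff y) (2 * n)%N + series (exp_coeff (- y)) (2 * n)%N))//.
apply/funext; elim=> [|n IH]; first by rewrite muln0 /series/= !big_geq// addr0.
rewrite seriesS IH (_ : 2 * n.+1 = (2 * n).+2)%N; last by lia.
rewrite !seriesS /exp_coeff /= [(- y) ^+ _]exprS [y ^+ (2 * n).+1]exprS (exprM (- y)) sqrrN -exprM.
by rewrite !mulNr; ring.
Qed.

(** The theta series at [exp u] without its constant term; in the variable [u] the functional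
    equation is a reflection at 0. *)
Definition wtheta (u : R) : R := theta_sum (pi * expR u).
Definition wterm n (u : R) : R := theta_term (pi * expR u) n.

Lemma pi_exp_gt0 u : 0 < pi * expR u :> R. Proof. by rewrite mulr_gt0 ?pi_gt0 ?expR_gt0. Qed.

Lemma wterm_ge0 n u : 0 <= wterm n u. Proof. exact: expR_ge0. Qed.

Lemma id_cont : continuous (fun u : R => u). Proof. by move=> u; exact: cvg_id. Qed.

Lemma expR_lin_cont a : continuous (fun u : R => expR (a * u)).
Proof.
move=> u; apply: (@continuous_comp _ _ _ (fun u : R => a * u) expR); last exact: continuous_expR.
by apply: cvgM; [exact: cvg_cst|exact: cvg_id].
Qed.

Lemma wtermE u : (\sum_(0 <= n <oo) (wterm n u)%:E = (wtheta u)%:E)%E.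
Proof. exact/nneseries_real/theta_cvg/pi_exp_gt0. Qed.

Lemma wtheta_ge0 u : 0 <= wtheta u. Proof. exact/theta_sum_ge0/pi_exp_gt0. Qed.

Lemma wterm_cont n : continuous (wterm n).
Proof.
move=> u; apply: (@continuous_comp _ _ _ (fun u => - (pi * expR u * n.+1%:R ^+ 2)) expR); last exact: continuous_expR.
apply: cvgN; apply: cvgM; last exact: cvg_cst.
by apply: cvgM; [exact: cvg_cst|exact: continuous_expR].
Qed.

(** [wtheta] is handled as a countable sum of continuous nonnegative functions, so that
    measurability and the exchange with the integral come together. The inner function [v] allows
    for a reflected argument. *)
Lemma int_wtheta (D : set R) (f v : R -> R) : measurable D -> continuous f -> (forall u, 0 <= f u) ->
  continuous v ->
  measurable_fun D (fun u => (f u * wtheta (v u))%:E) /\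
  (\int[mu]_(u in D) (f u * wtheta (v u))%:E =
   \sum_(0 <= n <oo) \int[mu]_(u in D) (f u * wterm n (v u))%:E)%E.
Proof.
move=> mD cf f0 cv.
have E u : ((f u * wtheta (v u))%:E = \sum_(0 <= n <oo) (f u * wterm n (v u))%:E)%E.
  rewrite EFinM -wtermE -nneseriesZl; last by move=> n _; rewrite lee_fin wterm_ge0.
  by apply: eq_eseriesr => n _; rewrite EFinM.
have mt n : measurable_fun D (fun u => (f u * wterm n (v u))%:E).
  apply: measurable_continuous => // u; apply: cvgM; first exact: cf.
  by apply: (@continuous_comp _ _ _ v (wterm n)); [exact: cv|exact: wterm_cont].
have t0 n u : D u -> (0 <= (f u * wterm n (v u))%:E)%E by rewrite lee_fin mulr_ge0// wterm_ge0.
split; last by rewrite -integral_nneseries//; apply: eq_integral => u _; exact: E.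
rewrite (_ : (fun u => _) = (fun u => \sum_(0 <= n <oo) (f u * wterm n (v u))%:E)%E); last exact/funext.
by apply: ge0_emeasurable_sum => // n u Du _; exact: t0.
Qed.

Lemma wtheta_fe u : wtheta (- u) = expR (u / 2) * wtheta u + (expR (u / 2) - 1) / 2.
Proof.
have := theta_fe (pi_exp_gt0 u); have p0 := @pi_gt0 R.
have -> : pi ^+ 2 / (pi * expR u) = pi * expR (- u) :> R.
  rewrite expRN; have := expR_gt0 u; move: (expR u) => E E0.
  have [p1 E1] : pi != 0 :> R /\ E != 0 by rewrite !gt_eqF.
  move: (pi : R) p1 => q q1; by field; rewrite q1 E1.
rewrite [pi * expR u / pi]mulrAC mulfV ?gt_eqF// mul1r.
have -> : Num.sqrt (expR u) = expR (u / 2).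
  have -> : expR u = expR (u / 2) ^+ 2 by rewrite expr2 -expRD; congr expR; field.
  by rewrite sqrtr_sqr ger0_norm ?expR_ge0.
rewrite /theta -/(wtheta u) -/(wtheta (- u)).
by move: (wtheta u) (wtheta (- u)) (expR (u / 2)) => a b c; lra.
Qed.

Lemma wtheta_le u : 0 <= u -> wtheta u <= expR (- expR u).
Proof.
move=> u0; have p2 := @pi_ge2 R.
have e1 : 1 <= expR u by apply: le_trans (expR_ge1Dx u); lra.
apply: limr_le; first exact/theta_cvg/pi_exp_gt0.
(* [1 - 2^-n] is a geometric partial sum. With [N = n + 1], [u >= 0] and [pi >= 2] give
   [pi e^u N^2 >= e^u + N], so the term of index [n] is at most [exp (- e^u)] times [2^-N]. *)
apply: nearW => n; apply: (@le_trans _ _ (expR (- expR u) * (1 - 2^-1 ^+ n))); last first.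
  by rewrite ler_piMr ?expR_ge0// gerBl exprn_ge0.
elim: n => [|n IH]; first by rewrite /series/= big_geq// subrr mulr0.
rewrite seriesS.
suff : wterm n u <= expR (- expR u) * 2^-1 ^+ n.+1.
  by move: IH; rewrite exprS /wterm; lra.
have h2 : expR (- 1) <= 2^-1 :> R.
  rewrite expRN lef_pV2 ?posrE ?expR_gt0//.
  by have := expR_ge1Dx (1 : R); lra.
apply: le_trans (_ : expR (- expR u) * expR (- 1) ^+ n.+1 <= _).
  rewrite -expRM_natl -expRD ler_expR /wterm /theta_term -mulr_natl mulrN1 -opprD lerN2.
  have n1 : 1 <= n.+1%:R :> R by rewrite ler1n.
  move: (n.+1%:R) n1 => N n1; rewrite mulr1.
  have h3 : 0 <= N * (N - 1) by rewrite mulr_ge0//; lra.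
  have h4 : 1 + N <= pi * N ^+ 2.
    have : 2 * N ^+ 2 <= pi * N ^+ 2 by rewrite ler_wpM2r// sqr_ge0.
    rewrite expr2 in h3 *; nra.
  have h5 := ler_wpM2l (expR_ge0 u) h4.
  have : 0 <= (expR u - 1) * N by rewrite mulr_ge0//; lra.
  rewrite mulrAC; lra.
by rewrite ler_wpM2l ?expR_ge0// ler_pXn2r ?nnegrE ?expR_ge0.
Qed.

Lemma gam_scale x (c : R) : 0 < x -> 0 < c ->
  \intR (fun u => expR (x * u - c * expR u)) = ((expR (- (x * ln c)))%:E * \intR (gam x))%E.
Proof.
move=> x0 c0; pose F (u : R) := u + ln c.
have dF (u : R) : is_derive u (1 : R) F 1.
  have h : is_derive u (1 : R) F (1 + 0) by apply: is_deriveD.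
  by rewrite addr0 in h.
have dFE : F^`()%classic = cst 1.
  by apply/funext => u; rewrite derive1E; have := dF u => -[].
have E : \intR (gam x) = (\int[mu]_(u in [set: R]) (((gam x \o F) * F^`()%classic) u)%:E)%E.
  apply: increasing_ge0_integration_by_substitutionT.
  - by move=> a b; rewrite /F ltrD2r.
  - by rewrite dFE; exact: cst_continuous.
  - by rewrite dFE; exact: is_cvg_cst.
  - by rewrite dFE; exact: is_cvg_cst.
  - by move=> u; have := dF u => -[].
  - by apply: cvg_addrr_Ny.
  - by apply: cvg_addrr.
  - exact: gam_cont.
  - exact: gam_ge0.
have cFG : continuous ((gam x \o F) * F^`()%classic).
  move=> u; apply: cvgM; last by rewrite dFE; exact: cvg_cst.
  apply: (@continuous_comp _ _ _ F (gam x)); last exact: gam_cont.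
  by apply: cvgD; [exact: cvg_id|exact: cvg_cst].
have pFG (u : R) : [set: R] u -> (0 <= (((gam x \o F) * F^`()%classic) u)%:E)%E.
  by move=> _; rewrite lee_fin dFE /GRing.mul/= mulr1 gam_ge0.
rewrite E -(ge0_integralZl_EFin mu measurableT pFG (measurable_continuous cFG measurableT) (expR_ge0 _)).
apply: eq_integral => u _; rewrite dFE -EFinM (_ : ((gam x \o F) * cst 1) u = gam x (F u)); last by rewrite /GRing.mul/= mulr1.
rewrite /gam /F -expRD [expR (u + _)]expRD lnK ?posrE//.
by congr (expR _)%:E; ring.
Qed.

Definition halfline : set R := `[(0 : R), +oo[%classic.

Lemma mhalf : measurable halfline. Proof. exact: measurable_itv. Qed.

Lemma halfP u : halfline u -> 0 <= u.
Proof. by rewrite /halfline/= in_itv/= andbT. Qed.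

(** The coefficient of [r^(2 k)] in [mell r u], which is [2 e^(u/4) cosh (r u / 2)]; its integral
    against [wtheta] is the [c_k] of the expansion of [xi]. *)
Definition mom_fun k (u : R) : R := 2 * expR (4^-1 * u) * (2^-1 * u) ^+ (2 * k) / (2 * k)`!%:R.
Definition mom k : \bar R := (\int[mu]_(u in halfline) (mom_fun k u * wtheta u)%:E)%E.

Lemma mom_fun_ge0 k u : 0 <= mom_fun k u.
Proof.
rewrite /mom_fun exprM; apply: mulr_ge0; last by rewrite invr_ge0.
by apply: mulr_ge0; [rewrite mulr_ge0 ?expR_ge0|rewrite exprn_ge0// sqr_ge0].
Qed.

Lemma mom_fun_cont k : continuous (mom_fun k).
Proof.
move=> u; apply: cvgM; last exact: cvg_cst.
apply: cvgM; first by apply: cvgM; [exact: cvg_cst|exact: expR_lin_cont].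
apply: (@continuous_comp _ _ _ (fun u : R => 2^-1 * u) (fun u : R => u ^+ (2 * k))); last exact: exprn_continuous.
by apply: cvgM; [exact: cvg_cst|exact: cvg_id].
Qed.

(** With [r = s - 1/2] the two products are [e^(s u / 2)] and [e^((1 - s) u / 2)]: the Mellin kernel
    folded by the functional equation. *)
Definition mell r u : R := expR (4^-1 * u) * (expR (r / 2 * u) + expR (- (r / 2) * u)).

Lemma mell_ge0 r u : 0 <= mell r u.
Proof. by rewrite mulr_ge0 ?addr_ge0 ?expR_ge0. Qed.

(** Only even powers of [r] occur, so all terms are nonnegative and the sum may be exchanged with
    the integral in the extended reals. *)
Lemma mom_series r : (\sum_(0 <= k <oo) ((r ^+ (2 * k))%:E * mom k) =
  \int[mu]_(u in halfline) (mell r u * wtheta u)%:E)%E.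
Proof.
have r0 k : 0 <= r ^+ (2 * k) by rewrite exprM exprn_ge0// sqr_ge0.
have mm k : measurable_fun halfline (fun u => (mom_fun k u * wtheta u)%:E).
  have [] := int_wtheta mhalf (@mom_fun_cont k) (mom_fun_ge0 k) id_cont => //.
have m0 k u : halfline u -> (0 <= (mom_fun k u * wtheta u)%:E)%E.
  by rewrite lee_fin mulr_ge0 ?mom_fun_ge0 ?wtheta_ge0.
transitivity (\sum_(0 <= k <oo) \int[mu]_(u in halfline) ((r ^+ (2 * k))%:E * (mom_fun k u * wtheta u)%:E))%E.
  by apply: eq_eseriesr => k _; exact/esym/(ge0_integralZl_EFin mu mhalf (m0 k) (mm k) (r0 k)).
rewrite -integral_nneseries//; last 3 first.
- exact: mhalf.
- move=> k; have c1 : continuous (fun u => r ^+ (2 * k) * mom_fun k u).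
    by move=> u; apply: cvgM; [exact: cvg_cst|exact: mom_fun_cont].
  have p1 u : 0 <= r ^+ (2 * k) * mom_fun k u by rewrite mulr_ge0 ?mom_fun_ge0.
  have [h _] := int_wtheta mhalf c1 p1 id_cont.
  rewrite (_ : (fun u => _) = (fun u => (r ^+ (2 * k) * mom_fun k u * wtheta u)%:E)); first exact: h.
  by apply/funext => u; rewrite -EFinM mulrA.
- by move=> k u hu; rewrite mule_ge0// ?lee_fin// -lee_fin; exact: m0.
apply: eq_integral => u _.
have h := nneseries_real (@cosh_series (r / 2 * u)).
have -> : mell r u * wtheta u = (expR (r / 2 * u) + expR (- (r / 2 * u))) * (expR (4^-1 * u) * wtheta u).
  by rewrite /mell mulNr; ring.
rewrite EFinM -h.
rewrite [LHS](_ : _ = \sum_(0 <= k <oo) ((expR (4^-1 * u) * wtheta u)%:E * (2 * (r / 2 * u) ^+ (2 * k) / (2 * k)`!%:R)%:E))%E.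
  have c0 k : true -> (0 <= (2 * (r / 2 * u) ^+ (2 * k) / (2 * k)`!%:R)%:E)%E.
    move=> _; rewrite lee_fin exprM; apply: mulr_ge0; last by rewrite invr_ge0.
    by apply: mulr_ge0 => //; rewrite exprn_ge0// sqr_ge0.
  by rewrite [RHS]muleC; exact: (nneseriesZl _ _ c0).
apply: eq_eseriesr => k _; rewrite -!EFinM /mom_fun; congr (_%:E).
have -> : (r / 2 * u) ^+ (2 * k) = r ^+ (2 * k) * (2^-1 * u) ^+ (2 * k) by rewrite -exprMn mulrA.
move: (r ^+ _) ((2^-1 * u) ^+ _) (expR _) (((2 * k)`!%:R)^-1) => a b c d; ring.
Qed.

(** The kernel is at most [2 e^((N + 1) u)] and [wtheta] at most [exp (- e^u)]. The product is a
    Gamma integrand, and this is the source of the factorial in the growth bound. *)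
Lemma mell_le r N u : 0 <= r -> r / 2 + 4^-1 <= N.+1%:R -> 0 <= u ->
  mell r u * wtheta u <= 2 * gam N.+1%:R u.
Proof.
move=> r0 rN u0.
have h := wtheta_le u0.
have e1 : mell r u <= 2 * expR (N.+1%:R * u).
  have a : expR (- (r / 2) * u) <= expR (r / 2 * u).
    rewrite ler_expR mulNr; have : 0 <= r / 2 * u by rewrite mulr_ge0// divr_ge0.
    by lra.
  apply: (@le_trans _ _ (expR (4^-1 * u) * (2 * expR (r / 2 * u)))).
    by rewrite ler_wpM2l ?expR_ge0//; lra.
  rewrite mulrCA -expRD ler_wpM2l// ler_expR.
  have := ler_wpM2r u0 rN; lra.
apply: le_trans (ler_pM (mell_ge0 _ _) (wtheta_ge0 _) e1 h) _.
by rewrite -mulrA -expRD /gam.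
Qed.

Lemma mell_cont r : continuous (mell r).
Proof.
by move=> u; apply: cvgM; [|apply: cvgD]; exact: expR_lin_cont.
Qed.

Lemma mmell r (D : set R) : measurable D -> measurable_fun D (fun u => (mell r u * wtheta u)%:E).
Proof.
by move=> mD; have [] := int_wtheta mD (@mell_cont r) (mell_ge0 r) id_cont.
Qed.

Lemma int_mell_le r N : 0 <= r -> r / 2 + 4^-1 <= N.+1%:R ->
  (\int[mu]_(u in halfline) (mell r u * wtheta u)%:E <= (2 * N`!%:R)%:E)%E.
Proof.
move=> r0 rN.
have c2 : continuous (fun u : R => 2 * gam N.+1%:R u).
  by move=> u; apply: cvgM; [exact: cvg_cst|exact: gam_cont].
have g0 (u : R) : 0 <= 2 * gam N.+1%:R u by rewrite mulr_ge0// gam_ge0.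
apply: (@le_trans _ _ (\int[mu]_(u in halfline) (2 * gam N.+1%:R u)%:E)%E).
  apply: ge0_le_integral; first exact: mhalf.
  - by move=> u _; rewrite lee_fin mulr_ge0 ?mell_ge0 ?wtheta_ge0.
  - by apply: mmell; exact: mhalf.
  - by apply: measurable_continuous => //; exact: mhalf.
  - by move=> u /halfP u0; rewrite lee_fin mell_le.
apply: (@le_trans _ _ (\intR (fun u => 2 * gam N.+1%:R u))).
  apply: ge0_subset_integral => //; first exact: mhalf.
  - exact: measurable_continuous.
  - by move=> u _; rewrite lee_fin.
rewrite EFinM -gam_nat -ge0_integralZl_EFin//.
- by move=> u _; rewrite lee_fin gam_ge0.
- by apply: measurable_continuous => //; exact: gam_cont.
Qed.

Lemma mom_ge0 k : (0 <= mom k)%E.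
Proof. by apply: integral_ge0 => u _; rewrite lee_fin mulr_ge0 ?mom_fun_ge0 ?wtheta_ge0. Qed.

Definition cm k : R := fine (mom k).

Lemma cm_ge0 k : 0 <= cm k. Proof. exact/fine_ge0/mom_ge0. Qed.

Lemma momE k : mom k = (cm k)%:E.
Proof.
rewrite /cm fineK// ge0_fin_numE ?mom_ge0//.
(* At [r = 1] the series of moments has nonnegative terms and a finite sum, so each moment is
   finite. *)
have h := @int_mell_le 1 1 ler01 ltac:(lra).
rewrite -mom_series in h; apply: le_lt_trans (ltry (2 * 1`!%:R : R)); apply: le_trans h.
have t0 j : (0 <= (1 ^+ (2 * j))%:E * mom j)%E by rewrite expr1n mul1e mom_ge0.
apply: (@le_trans _ _ (\sum_(0 <= j < k.+1) ((1 ^+ (2 * j))%:E * mom j))%E).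
  by rewrite big_nat_recr//= expr1n mul1e leeDr// sume_ge0// => j _; rewrite -(mul1e (mom j)) -(expr1n _ (2 * j)).
exact: nneseries_lim_ge.
Qed.

Lemma cm_series r N : 0 <= r -> r / 2 + 4^-1 <= N.+1%:R ->
  exists2 l : R, series (fun k => cm k * r ^+ (2 * k)) @ \oo --> l & l <= 2 * N`!%:R.
Proof.
move=> r0 rN; have h := int_mell_le r0 rN.
have t0 k : 0 <= cm k * r ^+ (2 * k) by rewrite mulr_ge0 ?cm_ge0// exprn_ge0.
have E : (\sum_(0 <= k <oo) (cm k * r ^+ (2 * k))%:E = \int[mu]_(u in halfline) (mell r u * wtheta u)%:E)%E.
  by rewrite -mom_series; apply: eq_eseriesr => k _; rewrite momE -EFinM mulrC.
have fin : (\int[mu]_(u in halfline) (mell r u * wtheta u)%:E)%E \is a fin_num.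
  rewrite ge0_fin_numE; first exact: le_lt_trans h (ltry _).
  by apply: integral_ge0 => u _; rewrite lee_fin mulr_ge0 ?mell_ge0 ?wtheta_ge0.
exists (fine (\int[mu]_(u in halfline) (mell r u * wtheta u)%:E)%E).
  by apply: series_nneseries => //; rewrite fineK.
by rewrite -lee_fin fineK.
Qed.

Lemma cm0_gt0 : 0 < cm 0.
Proof.
rewrite -lte_fin -momE /mom.
pose I : set R := `[(0 : R), (1 : R)]%classic.
have mI : measurable I by exact: measurable_itv.
pose c : R := 2 * expR (- (pi * expR 1)).
have c0 : 0 < c by rewrite mulr_gt0 ?expR_gt0.
have mm (D : set R) : measurable D -> measurable_fun D (fun u => (mom_fun 0 u * wtheta u)%:E).
  by move=> mD; have [] := int_wtheta mD (@mom_fun_cont 0) (mom_fun_ge0 0) id_cont.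
have m0 u : (0 <= (mom_fun 0 u * wtheta u)%:E)%E.
  by rewrite lee_fin mulr_ge0 ?mom_fun_ge0 ?wtheta_ge0.
apply: (@lt_le_trans _ _ (\int[mu]_(u in I) (mom_fun 0 u * wtheta u)%:E)%E); last first.
  apply: ge0_subset_integral => //; first exact: mhalf.
  - by apply: mm; exact: mhalf.
  - by move=> u; rewrite /I /halfline /= !in_itv/= andbT => /andP[].
apply: (@lt_le_trans _ _ (\int[mu]_(u in I) (cst c%:E u))%E).
  have -> : (\int[mu]_(u in I) (cst c%:E u) = c%:E * mu I)%E by exact: integral_cst.
  by rewrite /I lebesgue_measure_itv/= lte_fin ltr01 sube0 mule1 lte_fin.
apply: ge0_le_integral => //.
- by move=> u _; rewrite lee_fin ltW.
- exact: mm.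
- move=> u; rewrite /I/= in_itv/= => /andP[u0 u1]; rewrite lee_fin /mom_fun muln0 expr0 fact0 mulr1 divr1.
  apply: ler_pM; rewrite ?expR_ge0//.
    by rewrite ler_peMr//; apply: le_trans (expR_ge1Dx _); have : 0 <= 4^-1 * u by [rewrite mulr_ge0]; lra.
  apply: (@le_trans _ _ (series (wterm^~ u) 1)).
    rewrite /series/= big_nat1 /wterm /theta_term ler_expR lerN2 expr1n mulr1.
    by rewrite ler_wpM2l ?ler_expR// ltW// pi_gt0.
  apply: nondecreasing_cvgn_le; last exact/theta_cvg/pi_exp_gt0.
  by apply: nondecreasing_series => k _ _; exact: wterm_ge0.
Qed.

Lemma mellin x g l : 2^-1 < x -> x < 1 -> \intR (gam x) = g%:E ->
  series (fun k => cm k * (2 * x - 2^-1) ^+ (2 * k)) @ \oo --> l ->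
  series (fun n => expR (- (x * ln (pi * n.+1%:R ^+ 2))) * g) @ \oo --> (2 * x * (2 * x - 1))^-1 + l.
Proof.
move=> xl xr hg hl; have x0 : 0 < x by lra.
have y0 : 0 < x - 2^-1 by lra.
have y1 : 0 < 2 * x - 1 by lra.
have k1 : (x - 2^-1)^-1 * (2^-1 - x) = -1.
  by rewrite -[2^-1 - x]opprB mulrN mulVf ?gt_eqF.
have k2 : x^-1 * - x = -1 by rewrite mulrN mulVf ?gt_eqF.
have le1 : - x <= 2^-1 - x by lra.
pose p u : R := (expR ((2^-1 - x) * u) - expR (- x * u)) / 2.
have p0 u : 0 <= u -> 0 <= p u.
  by move=> u0; rewrite divr_ge0// subr_ge0 ler_expR ler_wpM2r.
have g0 : 0 <= g by rewrite -lee_fin -hg integral_ge0// => u _; rewrite lee_fin gam_ge0.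
apply: series_nneseries; first by move=> n; rewrite mulr_ge0 ?expR_ge0.
have ce := expR_lin_cont.
have e0 (a u : R) : 0 <= expR (a * u) by exact: expR_ge0.
pose f u := expR (x * u) * wtheta u.
have f0 u : 0 <= f u by rewrite mulr_ge0 ?wtheta_ge0.
have mf (D : set R) : measurable D -> measurable_fun D (fun u => (f u)%:E).
  by move=> mD; have [] := int_wtheta mD (ce x) (e0 x) id_cont.
transitivity (\intR f).
  rewrite /f; have [_ ->] := int_wtheta measurableT (ce x) (e0 x) id_cont.
  apply: eq_eseriesr => n _; rewrite EFinM -hg -gam_scale//; last first.
    by rewrite mulr_gt0 ?pi_gt0// exprn_gt0.
  apply: eq_integral => u _; rewrite /wterm /theta_term -expRD; congr (expR _)%:E; ring.
pose N : set R := `]-oo, (0 : R)]%classic.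
pose N' : set R := `]-oo, (0 : R)[%classic.
have mN' : measurable N' by exact: measurable_itv.
have mN : measurable N by exact: measurable_itv.
have TE : [set: R] = N' `|` halfline.
  by apply/seteqP; split=> // u _; rewrite /N' /halfline /= !in_itv/= andbT; case: ltP; [left|right].
have hm := mhalf.
rewrite TE ge0_integral_setU//; last 3 first.
- by rewrite -TE; exact: mf.
- by move=> u _; rewrite lee_fin.
- apply/disj_setPS => u [] ; rewrite /N' /halfline /= !in_itv/= andbT => h1 h2.
  by move: (lt_le_trans h1 h2); rewrite ltxx.
(* The reflection is carried out term by term, on the continuous functions [wterm n], and then
   summed again. *)
have EN : (\int[mu]_(u in N') (f u)%:E = \int[mu]_(u in halfline) (expR (- x * u) * wtheta (- u))%:E)%E.
  rewrite /N' integral_itv_bndo_bndc; last exact: mf.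
  have [_ h1] := int_wtheta mN (ce x) (e0 x) id_cont.
  have cN : continuous (fun u : R => - u) by move=> u; apply: cvgN; exact: cvg_id.
  have [_ h2] := int_wtheta hm (ce (- x)) (e0 (- x)) cN.
  rewrite [LHS]h1 h2; apply: eq_eseriesr => n _.
  have cG : continuous (fun u : R => expR (x * u) * wterm n u).
    by move=> u; apply: cvgM; [exact: ce|exact: wterm_cont].
  have := @ge0_integration_by_substitutionNy R (fun u : R => expR (x * u) * wterm n u) 0.
  rewrite oppr0 => ->; last 2 first.
  - exact: continuous_subspaceT.
  - by move=> u _; exact: (mulr_ge0 (e0 x u) (wterm_ge0 n u)).
  by apply: eq_integral => u _; rewrite /= mulrN mulNr.
have cp : continuous p.
  by move=> u; apply: cvgM; [apply: cvgB; exact: ce|exact: cvg_cst].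
pose q u : R := expR ((2^-1 - x) * u) * wtheta u.
have mq : measurable_fun halfline (fun u => (q u)%:E).
  by have [] := int_wtheta hm (ce (2^-1 - x)) (e0 (2^-1 - x)) id_cont.
have q0 u : 0 <= q u by rewrite mulr_ge0 ?wtheta_ge0.
have mp : measurable_fun halfline (fun u => (p u)%:E) by exact: measurable_continuous.
(* The functional equation splits the reflected half into [q], which joins [f] to form
   [mell (2 x - 1/2)], and the elementary [p], whose integral is the polar term
   [1 / (2 x (2 x - 1))]. *)
have EH : (\int[mu]_(u in halfline) (expR (- x * u) * wtheta (- u))%:E =
  \int[mu]_(u in halfline) (p u)%:E + \int[mu]_(u in halfline) (q u)%:E)%E.
  have pq u : halfline u -> (0 <= (q u)%:E)%E by rewrite lee_fin.
  have pp u : halfline u -> (0 <= (p u)%:E)%E by rewrite lee_fin => /halfP; exact: p0.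
  rewrite -(ge0_integralD mu hm pp mp pq mq).
  apply: eq_integral => u _; rewrite -EFinD wtheta_fe; congr (_%:E).
  have e1 : expR ((2^-1 - x) * u) = expR (- x * u) * expR (u / 2) by rewrite -expRD; congr expR; ring.
  by rewrite /p /q e1; field.
rewrite [X in (X + _)%E]EN [X in (X + _)%E]EH -addeA EFinD; congr (_ + _)%E; last first.
  have pq u : halfline u -> (0 <= (q u)%:E)%E by rewrite lee_fin.
  have pf u : halfline u -> (0 <= (f u)%:E)%E by rewrite lee_fin.
  rewrite -(ge0_integralD mu hm pq mq pf (mf _ hm)).
  rewrite -(nneseries_real hl).
  transitivity (\int[mu]_(u in halfline) (mell (2 * x - 2^-1) u * wtheta u)%:E)%E.
    apply: eq_integral => u _; rewrite -EFinD /q /f /mell mulrDr -!expRD -mulrDl addrC.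
    by congr ((expR _ + expR _) * _)%:E; field.
  by rewrite -mom_series; apply: eq_eseriesr => k _; rewrite momE -EFinM mulrC.
pose F u : R := (- (expR ((2^-1 - x) * u) / (x - 2^-1)) + expR (- x * u) / x) / 2.
have dE (a : R) (u : R) : is_derive u (1 : R) (fun u : R => expR (a * u)) (a * expR (a * u)).
  have h : is_derive u (1 : R) (fun u : R => a * u) (a *: 1) by exact: is_deriveZ.
  have := @is_derive1_comp R expR (fun u => a * u) u _ _ (is_derive_expR _) h.
  by rewrite scaler1 mulrC.
have dF (u : R) : is_derive u (1 : R) F (p u).
  have h : is_derive u (1 : R) F ((2 : R)^-1 *: (- ((x - 2^-1)^-1 *: ((2^-1 - x) * expR ((2^-1 - x) * u))) + x^-1 *: (- x * expR (- x * u)))).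
    rewrite (_ : F = (fun u => 2^-1 *: (- ((x - 2^-1)^-1 *: expR ((2^-1 - x) * u)) + x^-1 *: expR (- x * u)))).
      by apply: is_deriveZ; apply: is_deriveD.
    by apply/funext => v; rewrite /F /GRing.scale/=; ring.
  suff -> : p u = (2 : R)^-1 *: (- ((x - 2^-1)^-1 *: ((2^-1 - x) * expR ((2^-1 - x) * u))) + x^-1 *: (- x * expR (- x * u))) by [].
  rewrite /p /GRing.scale/= [(x - 2^-1)^-1 * _]mulrA k1 [x^-1 * _]mulrA k2 !mulN1r opprK.
  exact: mulrC.
have cF : continuous F.
  by move=> u; apply/differentiable_continuous/derivable1_diffP; have := dF u => -[].
have elim (a : R) : 0 < a -> (fun u : R => expR (- a * u)) @ +oo --> (0 : R).
  move=> a0; rewrite (_ : (fun u => _) = (fun u => expR (- (a * u)))); last by apply/funext => u; rewrite mulNr.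
  apply: (cvg_comp (fun u => a * u) (fun u => expR (- u))); last exact: cvgr_expR.
  apply: gt0_cvgMry => //; exact: cvg_id.
rewrite (@ge0_continuous_FTC2y R p F 0 0 p0).
- rewrite -EFinB; congr (_%:E); rewrite /F !mulr0 expR0; field.
  by rewrite !gt_eqF.
- exact: continuous_subspaceT.
- have h1 := elim _ y0; have h2 := elim _ x0.
  rewrite (_ : 0 = (- (0 / (x - 2^-1)) + 0 / x) / 2); last by rewrite !mul0r oppr0 addr0 mul0r.
  apply: cvgM; last exact: cvg_cst.
  apply: cvgD; last by apply: cvgM; [exact: h2|exact: cvg_cst].
  apply: cvgN; apply: cvgM; last exact: cvg_cst.
  by rewrite opprB in h1.
- by move=> u _; have := dF u => -[].
- exact/cvg_at_right_filter/cF.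
- by move=> u _; rewrite derive1E; have := dF u => -[].
Qed.

End Mellin.

(** * The functions xi and zeta *)

Section Xi.
Variable R : realType.
Local Notation C := R[i].
Implicit Types (s z : C) (r : R).

Lemma cabs_half1 : cabs (2^-1 : C) = 2^-1.
Proof. by rewrite cabsV cabs2. Qed.

Definition Iterm z k : C := (cm R k)%:C * z ^+ (2 * k).
Definition Ifun s : C := xget 0 [set l | csum (Iterm (s - 2^-1)) l].

Lemma cm_cvg r : 0 <= r -> cvgn (series (fun k => cm R k * r ^+ (2 * k))).
Proof.
move=> r0; pose N := Num.bound (r / 2 + 4^-1).
have h : r / 2 + 4^-1 <= N.+1%:R :> R.
  apply: (@le_trans _ _ N%:R); last by rewrite ler_nat.
  by apply/ltW; have := archi_boundP (_ : 0 <= r / 2 + 4^-1); apply; rewrite addr_ge0// divr_ge0.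
by have [l h1 _] := cm_series r0 h; apply/cvg_ex; exists l.
Qed.

Lemma Iterm_le z r k : cabs z <= r -> cabs (Iterm z k) <= cm R k * r ^+ (2 * k).
Proof.
move=> zr; rewrite /Iterm cabsM cabs_real cabsX ger0_norm ?cm_ge0//.
by rewrite ler_wpM2l ?cm_ge0// lerXn2r ?nnegrE// (le_trans _ zr).
Qed.

Lemma IfunP s : csum (Iterm (s - 2^-1)) (Ifun s).
Proof.
have [l hl _] := csum_tail (fun k => Iterm_le k (lexx _)) (cm_cvg (cabs_ge0 (s - 2^-1))).
by apply: (@xgetPex _ 0 [set l | csum (Iterm (s - 2^-1)) l]); exists l.
Qed.

Lemma Ifun_eq s l : csum (Iterm (s - 2^-1)) l -> Ifun s = l.
Proof. exact/csum_unique/IfunP. Qed.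

Definition entire (f : C -> C) := forall z, exists l, cdiff f z l.

Lemma entire_hol f a r : entire f -> hol f a r. Proof. by move=> h z _; exact: h. Qed.

Lemma hol_entire f : (forall r, 0 < r -> hol f 0 r) -> entire f.
Proof.
move=> h z; apply: (h (cabs z + 1)); first by rewrite ltr_wpDl.
by rewrite subr0 ltrDl.
Qed.

Lemma Ifun_entire : entire Ifun.
Proof.
move=> s; have r0 : 0 < cabs (s - 2^-1) + 1 by rewrite ltr_wpDl.
have hc := cm_cvg (ltW r0); set r := cabs _ + 1 in r0 hc *.
apply: (@hol_unif_lim _ (fun n z => series (Iterm (z - 2^-1)) n) Ifun 2^-1 r
  (fun n => limn (series (fun k => cm R k * r ^+ (2 * k))) - series (fun k => cm R k * r ^+ (2 * k)) n)) => //.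
- move=> n z _; rewrite /series/=; eexists.
  apply: cdiff_sum => i; apply: cdiffM; first exact: cdiff_cst.
  apply: (@cdiff_comp _ (fun z => z - 2^-1) (fun z => z ^+ (2 * i))).
    by apply: cdiffB; [exact: cdiff_id|exact: cdiff_cst].
  exact: cdiffX.
- rewrite -(subrr (limn (series (fun k => cm R k * r ^+ (2 * k))))).
  by apply: cvgB; [exact: cvg_cst|exact: hc].
- move=> n z hz; rewrite cabs_subC; apply: csum_tail_le => //.
    by move=> k; apply: Iterm_le; exact: ltW.
  exact: IfunP.
- by rewrite ltrDl.
Qed.

Lemma Ifun_sym s : Ifun (1 - s) = Ifun s.
Proof.
apply: Ifun_eq; apply: csum_ext (IfunP s) => k; rewrite /Iterm; congr (_ * _).
rewrite (_ : 1 - s - 2^-1 = - (s - 2^-1)); last by field.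
by rewrite !exprM sqrrN.
Qed.

Local Notation cj := (@conjc R).

Lemma cjM (z w : C) : cj (z * w) = cj z * cj w. Proof. exact: rmorphM. Qed.
Lemma cjD (z w : C) : cj (z + w) = cj z + cj w. Proof. exact: rmorphD. Qed.
Lemma cjB (z w : C) : cj (z - w) = cj z - cj w. Proof. exact: rmorphB. Qed.
Lemma cjX (z : C) n : cj (z ^+ n) = cj z ^+ n. Proof. exact: rmorphXn. Qed.
Lemma cj1 : cj 1 = 1. Proof. exact: rmorph1. Qed.
Lemma cj_real (x : R) : cj (x%:C) = x%:C. Proof. exact: conjc_real. Qed.

Lemma cj_half : cj (2^-1) = 2^-1.
Proof. by apply: etrans (fmorphV _ _) _; rewrite rmorph_nat. Qed.

Lemma clim_conj (u : nat -> C) l : clim u l -> clim (fun n => cj (u n)) (cj l).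
Proof.
rewrite /clim; apply: cvg_trans; apply: near_eq_cvg; apply: nearW => n.
by rewrite -cjB; apply/esym/cabs_conj.
Qed.

Lemma Ifun_conj s : Ifun (cj s) = cj (Ifun s).
Proof.
apply: Ifun_eq; rewrite /csum; apply: clim_ext (clim_conj (IfunP s)) => n.
rewrite /series/= rmorph_sum/=; apply: eq_bigr => k _.
by rewrite /Iterm cjM cj_real cjX cjB cj_half.
Qed.

Lemma Ifun_real (x : R) : exists2 y : R, Ifun x%:C = y%:C & cm R 0 <= y.
Proof.
have hc := cm_cvg (normr_ge0 (x - 2^-1)); exists (limn (series (fun k => cm R k * `|x - 2^-1| ^+ (2 * k)))).
  apply: Ifun_eq; apply: csum_ext (_ : csum (fun k => (cm R k * `|x - 2^-1| ^+ (2 * k))%:C) _).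
    move=> k; rewrite /Iterm rmorphM rmorphXn/= exprM -rmorphXn/= real_normK ?num_real//.
    by rewrite rmorphXn/= rmorphB/= fmorphV rmorph_nat -exprM.
  by apply/csum_real; exact: hc.
have := @nondecreasing_cvgn_le _ (series (fun k => cm R k * `|x - 2^-1| ^+ (2 * k))) _ hc 1%N.
have -> : cm R 0 = series (fun k => cm R k * `|x - 2^-1| ^+ (2 * k)) 1%N.
  by rewrite /series/= big_nat1 muln0 expr0 mulr1.
apply.
by apply: nondecreasing_series => k _ _; rewrite mulr_ge0 ?cm_ge0// exprn_ge0.
Qed.

(* This is the paper's [xi], by [rzeta_is_zeta] below. *)
Definition xi s : C := 1 + s * (s - 1) * Ifun s.

Lemma xi_entire : entire xi.
Proof.
move=> s; have [l hl] := Ifun_entire s; eexists.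
apply: cdiffD; first exact: cdiff_cst.
apply: cdiffM; last exact: hl.
apply: cdiffM; first exact: cdiff_id.
by apply: cdiffB; [exact: cdiff_id|exact: cdiff_cst].
Qed.

Lemma xi1 : xi 1 = 1. Proof. by rewrite /xi subrr mulr0 mul0r addr0. Qed.

Lemma xi_sym s : xi (1 - s) = xi s.
Proof. by rewrite /xi Ifun_sym; ring. Qed.

Lemma xi_conj s : xi (cj s) = cj (xi s).
Proof. by rewrite /xi Ifun_conj cjD !cjM cjB !cj1. Qed.

(** Outside the open interval [x (x - 1) >= 0], and [Ifun x >= 0] since its terms are nonnegative at
    real points; so [xi x >= 1]. *)
Lemma xi_real_neq0 (x : R) : x <= 0 \/ 1 <= x -> xi x%:C != 0.
Proof.
move=> hx; have [y hy y0] := Ifun_real x.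
have -> : xi x%:C = (1 + x * (x - 1) * y)%:C.
  by rewrite /xi hy rmorphD rmorph1 !rmorphM rmorphB/= rmorph1.
have y0' : 0 <= y by apply: le_trans y0; exact: cm_ge0.
suff : 0 < 1 + x * (x - 1) * y by move=> h; rewrite eq_complex/= gt_eqF.
have : 0 <= x * (x - 1) by case: hx => h; nra.
by move=> h; have := mulr_ge0 h y0'; lra.
Qed.

Lemma xi_deriv1 : exists2 k : R, 0 < k & cdiff xi 1 k%:C.
Proof.
have [y hy y0] := Ifun_real 1; exists y; first exact: lt_le_trans (cm0_gt0 R) y0.
have [l hl] := Ifun_entire 1.
have h1 : cdiff (fun s : C => s - 1) 1 (1 - 0) by apply: cdiffB; [exact: cdiff_id|exact: cdiff_cst].
have h2 := cdiffD (cdiff_cst (1 : C) 1) (cdiffM (cdiffM (cdiff_id (1 : C)) h1) hl).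
by apply: cdiff_ext h2 => //; rewrite -hy; ring.
Qed.

Lemma Ifun_le s r N : cabs (s - 2^-1) <= r -> r / 2 + 4^-1 <= N.+1%:R ->
  cabs (Ifun s) <= 2 * N`!%:R.
Proof.
move=> hr hN; have r0 : 0 <= r by exact: le_trans hr.
have [l h1 h2] := cm_series r0 hN; apply: le_trans h2.
rewrite -(cvg_lim _ h1)//; apply: csum_le (IfunP s); first by move=> k; exact: Iterm_le.
by apply/cvg_ex; exists l.
Qed.

Lemma fact_le_pow n : (n`! <= n ^ n)%N.
Proof.
elim: n => // n IH; rewrite factS expnS leq_mul2l /=; apply: leq_trans IH _.
by case: n => // n; rewrite leq_exp2r.
Qed.

(* As [8 ^ j = (4 ^ j) ^ (3 / 2)], the order of growth is at most 3/2. *)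
Lemma xi_growth : exists2 c : R, 0 < c &
  forall j s, cabs (s - 1) <= 4 ^+ j -> cabs (xi s) <= expR (c * 8 ^+ j).
Proof.
exists 20; first by [].
move=> j s hs.
have p4 : 1 <= 4 ^+ j :> R by rewrite exprn_ege1//; lra.
have p2 : 1 <= 2 ^+ j :> R by rewrite exprn_ege1//; lra.
have e8 : 8 ^+ j = 4 ^+ j * 2 ^+ j :> R by rewrite -exprMn; congr (_ ^+ _); ring.
have e4 : 4 ^+ j = 2 ^+ j * 2 ^+ j :> R by rewrite -exprMn; congr (_ ^+ _); ring.
(* The radius as an integer: [Ifun_le] then gives [2 N!], and [N! <= N^N = 4^(j 4^j)]. *)
pose N := (4 ^ j)%N.
have NE : N%:R = 4 ^+ j :> R by rewrite natrX.
have h1 : cabs (s - 2^-1) <= 4 ^+ j + 1.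
  rewrite (_ : s - 2^-1 = (s - 1) + 2^-1); last by field.
  by apply: le_trans (cabsD _ _) _; rewrite cabs_half1; lra.
have hI : cabs (Ifun s) <= 2 * N`!%:R.
  by apply: (Ifun_le h1); rewrite -(natr1 N) NE; lra.
have hf : N`!%:R <= expR (2 * j%:R * 4 ^+ j) :> R.
  apply: (@le_trans _ _ (4 ^+ j ^+ N)); first by rewrite -NE -natrX ler_nat fact_le_pow.
  have e42 : 4 <= expR 2 :> R.
    have := expR_ge1Dx (1 : R); rewrite (_ : expR 2 = expR 1 * expR 1); last by rewrite -expRD; congr expR; ring.
    by nra.
  rewrite -exprM; apply: (@le_trans _ _ (expR 2 ^+ (j * N))).
    by rewrite lerXn2r ?nnegrE ?expR_ge0.
  by rewrite -expRM_natl natrM NE ler_expR; lra.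
(* The logarithm of the radius is absorbed here, [j 4^j <= 8^j]; this is where the exponent 3/2
   comes from. *)
have jle : j%:R <= 2 ^+ j :> R by rewrite -natrX ler_nat ltnW// ltn_expl.
have s2 : cabs s <= 4 ^+ j + 1.
  by rewrite -[s](subrK 1); apply: le_trans (cabsD _ _) _; rewrite cabs1; lra.
have hx : cabs (xi s) <= 1 + (4 ^+ j + 1) * 4 ^+ j * (2 * N`!%:R).
  apply: le_trans (cabsD _ _) _; rewrite cabs1 lerD2l !cabsM.
  by apply: ler_pM => //; [rewrite mulr_ge0|apply: ler_pM].
apply: le_trans hx _.
have f1 : 1 <= N`!%:R :> R by rewrite ler1n fact_gt0.
apply: (@le_trans _ _ (5 * (4 ^+ j * 4 ^+ j) * N`!%:R)).
  have h44 : 4 ^+ j <= 4 ^+ j * 4 ^+ j :> R by rewrite ler_peMl// (le_trans ler01).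
  move: (4 ^+ j) (N`!%:R) p4 f1 h44 => a b a1 b1 ab.
  have : 1 <= a * a * b by rewrite -[leLHS]mulr1 ler_pM// (le_trans a1).
  have : a * b <= a * a * b by rewrite ler_wpM2r// (le_trans ler01).
  lra.
have h8 : 2 ^+ j <= 8 ^+ j :> R by rewrite e8 ler_peMl// (le_trans ler01).
have h5 : 5 * (4 ^+ j * 4 ^+ j) <= expR (9 * 2 ^+ j) :> R.
  have g1 := @expR_ge1Dx R (2 ^+ j); have g5 := @expR_ge1Dx R (5 * 2 ^+ j).
  rewrite e4 (_ : expR (9 * 2 ^+ j) = expR (5 * 2 ^+ j) * expR (2 ^+ j) ^+ 4); last first.
    by rewrite -expRM_natl -expRD; congr expR; ring.
  apply: ler_pM => //; first by lra.
  rewrite (_ : _ * _ = (2 ^+ j) ^+ 4); last by ring.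
  by rewrite lerXn2r ?nnegrE ?expR_ge0//; lra.
apply: le_trans (ler_pM _ _ h5 hf) _ => //.
rewrite -expRD ler_expR.
have : j%:R * 4 ^+ j <= 8 ^+ j :> R.
  by rewrite e8 mulrC ler_wpM2l// (le_trans ler01).
by rewrite -mulrA; move: h8 p2; move: (8 ^+ j) (2 ^+ j) (j%:R * 4 ^+ j) => a b c; lra.
Qed.

End Xi.

(** * The entire function 1 / Gamma (z + 1) *)

Section GammaReciprocal.
Variable R : realType.
Local Notation C := R[i].
Implicit Types (s z : C) (r : R).

(** A Gauss factor times [((n + 1) / (n + 2))^z], which makes it [1 + O(1 / n^2)]; these powers
    telescope to the one in [gprod]. *)
Definition gfac n z : C := (1 + z / n.+1%:R) * cexp (- (z * (ln n.+2%:R - ln n.+1%:R)%:C)).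

(* Partial products of [z |-> 1 / Gamma (z + 1)]. *)
Definition gp n z : C := \prod_(k < n) gfac k z.

Lemma gpS n z : gp n.+1 z = gp n z * gfac n z.
Proof. by rewrite /gp big_ord_recr. Qed.

Lemma gp_real n (x : R) : gp n x%:C = (gprod x n)%:C.
Proof.
elim: n => [|n IH]; first by rewrite /gp /gprod !big_ord0 ln1 mulr0 oppr0 expR0 mulr1.
rewrite gpS IH /gprod big_ord_recr/= /gfac.
have -> : - (x%:C * (ln n.+2%:R - ln n.+1%:R)%:C) = (- (x * (ln n.+2%:R - ln n.+1%:R)))%:C :> C.
  by rewrite rmorphN rmorphM.
rewrite cexp_real.
have -> : 1 + x%:C / n.+1%:R = (1 + x / n.+1%:R)%:C :> C.
  by rewrite rmorphD rmorph1 rmorphM fmorphV rmorph_nat.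
rewrite -!rmorphM; congr (_%:C).
have -> : expR (- (x * ln n.+2%:R)) = expR (- (x * ln n.+1%:R)) * expR (- (x * (ln n.+2%:R - ln n.+1%:R))).
  by rewrite -expRD; congr expR; ring.
by rewrite /=; ring.
Qed.

Lemma gfac_entire n : entire (gfac n).
Proof.
move=> z; eexists; apply: cdiffM.
  by apply: cdiffD; [exact: cdiff_cst|apply: cdiffM; [exact: cdiff_id|exact: cdiff_cst]].
apply: (@cdiff_comp _ (fun z => - (z * (ln n.+2%:R - ln n.+1%:R)%:C)) (@cexp R)); last exact: cdiff_cexp.
by apply: cdiffN; apply: cdiffM; [exact: cdiff_id|exact: cdiff_cst].
Qed.

Lemma entire_prod (I : Type) (s : seq I) (f : I -> C -> C) :
  (forall i, entire (f i)) -> entire (fun z => \prod_(i <- s) f i z).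
Proof.
move=> hf z; elim: s => [|i s [l IH]].
  by exists 0; apply: cdiff_ext (cdiff_cst 1 z) => // w; rewrite big_nil.
have [k hk] := hf i z; eexists.
by apply: cdiff_ext (cdiffM hk IH) => // w; rewrite big_cons.
Qed.

(** The terms of order [1 / m] cancel, because [ln (1 + 1/m)] lies between [1/m - 1/m^2] and [1/m].
    The coefficient 7 is 1 from the product of the linear terms plus 6 from the remainder of the
    exponential. *)
Lemma gfac_near1 n z r : cabs z <= r -> 2 * r <= n.+1%:R ->
  cabs (gfac n z - 1) <= (r + 7 * r ^+ 2) / n.+1%:R ^+ 2.
Proof.
move=> zr rn; have r0 : 0 <= r by exact: le_trans zr.
set m : R := n.+1%:R; have m1 : 1 <= m by rewrite ler1n.
have m0 : 0 < m by lra.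
pose d : R := ln n.+2%:R - ln n.+1%:R.
have dle : d <= m^-1.
  rewrite /d lerBlDl -[leRHS]expRK ler_ln ?posrE ?expR_gt0// expRD lnK ?posrE//.
  have := ler_wpM2l (ltW m0) (expR_ge1Dx m^-1); rewrite mulrDr mulfV ?gt_eqF// mulr1.
  by rewrite -[n.+2%:R]natr1 -/m.
have dge : m^-1 - m^-1 ^+ 2 <= d.
  have h : m^-1 - m^-1 ^+ 2 <= (m + 1)^-1.
    rewrite -[leRHS]mul1r ler_pdivlMr; last by lra.
    rewrite (_ : _ * _ = 1 - m^-1 ^+ 2); first by rewrite gerBl sqr_ge0.
    by field; rewrite gt_eqF.
  apply: le_trans h _; rewrite /d -lerN2 opprB.
  have m2 : 0 < m + 1 by lra.
  rewrite lerBlDl -[leRHS]expRK ler_ln ?posrE ?expR_gt0// expRD lnK ?posrE//.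
  rewrite -[n.+2%:R]natr1 -/m.
  have := ler_wpM2l (ltW m2) (expR_ge1Dx (- (m + 1)^-1)); rewrite mulrDr mulr1 mulrN mulfV ?gt_eqF//.
  by rewrite addrK.
have d0 : 0 <= d.
  apply: le_trans dge; rewrite subr_ge0 expr2 ler_piMr ?invr_ge0 ?(ltW m0)//.
  by rewrite invf_le1.
pose E := cexp (- (z * d%:C)) - 1 - (- (z * d%:C)).
have cd : cabs (- (z * d%:C)) = cabs z * d by rewrite cabsN cabsM cabs_real ger0_norm.
have zd : cabs z * d <= r / m by apply: ler_pM.
have hE : cabs E <= 4 * (r / m) ^+ 2.
  apply: le_trans (cexp_quad _) _; rewrite cd.
    by apply: le_trans zd _; rewrite ler_pdivrMr//; move: rn; rewrite -/m; lra.
  by rewrite ler_wpM2l// lerXn2r ?nnegrE ?mulr_ge0// invr_ge0 ltW.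
have mE : n.+1%:R = m%:C :> C by rewrite rmorph_nat.
have -> : gfac n z - 1 = z * (m^-1 - d)%:C - z ^+ 2 * (d / m)%:C + E * (1 + z / m%:C).
  rewrite /gfac mE -/d /E; move: (cexp _) => e.
  rewrite rmorphB rmorphM fmorphV/=; ring.
have zm : cabs (1 + z / m%:C) <= 3 / 2.
  apply: le_trans (cabsD _ _) _; rewrite cabs1 cabsM cabsV cabs_real gtr0_norm//.
  have : cabs z / m <= 1 / 2 by rewrite ler_pdivrMr//; move: rn; rewrite -/m; lra.
  by move: (cabs z / m) => t; lra.
apply: le_trans (cabsD _ _) _; apply: le_trans (lerD (cabsB _ _) (lexx _)) _.
rewrite (cabsM z) (cabsM (z ^+ 2)) (cabsM E) (cabsX z) !cabs_real (ger0_norm (_ : 0 <= d / m)); last by rewrite divr_ge0// ltW.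
rewrite ger0_norm ?subr_ge0//.
have t1 : cabs z * (m^-1 - d) <= r * m^-1 ^+ 2.
  by apply: ler_pM => //; [rewrite subr_ge0|rewrite lerBlDr addrC -lerBlDr].
have t2 : cabs z ^+ 2 * (d / m) <= r ^+ 2 * m^-1 ^+ 2.
  apply: ler_pM; rewrite ?sqr_ge0//; first by rewrite divr_ge0// ltW.
    by rewrite lerXn2r ?nnegrE.
  by rewrite expr2 ler_wpM2r// invr_ge0 ltW.
have t3 : cabs E * cabs (1 + z / m%:C) <= 4 * (r / m) ^+ 2 * (3 / 2) by apply: ler_pM.
have -> : (r + 7 * r ^+ 2) / m ^+ 2 = r * m^-1 ^+ 2 + r ^+ 2 * m^-1 ^+ 2 + 4 * (r / m) ^+ 2 * (3 / 2).
  by field; rewrite gt_eqF.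
exact: (lerD (lerD t1 t2) t3).
Qed.

Lemma inv_sq_le n : (n.+2%:R : R) ^- 2 <= n.+1%:R^-1 - n.+2%:R^-1.
Proof.
rewrite -[n.+2%:R]natr1; have : 0 < n.+1%:R :> R by [].
move: (n.+1%:R) => m m0.
have -> : m^-1 - (m + 1)^-1 = (m * (m + 1))^-1 by field; rewrite !gt_eqF//; lra.
by rewrite lef_pV2 ?posrE ?mulr_gt0 ?exprn_gt0//; try lra; rewrite expr2 ler_wpM2r//; lra.
Qed.

Lemma gp_tail r : 0 < r -> exists N (Q : C -> C), [/\ hol Q 0 r,
  forall z, cabs z < r -> cabs (Q z - 1) <= 1 / 2 &
  forall z, cabs z < r -> clim (fun m => gp (m + N) z) (gp N z * Q z)].
Proof.
move=> r0; pose K := r + 7 * r ^+ 2.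
have K0 : 0 < K by rewrite addr_gt0// mulr_gt0// exprn_gt0.
(* [N >= 2 r] makes [gfac_near1] available for all later factors. [N >= 4 K] gives [b 0 <= 1 / 4],
   which keeps the partial products within [1 / 2] of 1 in the induction [qb]. *)
pose N := (Num.bound (2 * r + 4 * K)).
have hN : 2 * r + 4 * K <= N%:R.
  by apply/ltW; have := archi_boundP (_ : 0 <= 2 * r + 4 * K); apply; rewrite addr_ge0 ?mulr_ge0 ?ltW.
have N0 : 0 < N%:R :> R by apply: lt_le_trans hN; rewrite addr_gt0 ?mulr_gt0.
pose q m z := \prod_(k < m) gfac (k + N) z.
pose b m : R := K * ((m + N)%:R)^-1.
have qS m z : q m.+1 z = q m z * gfac (m + N) z by rewrite /q big_ord_recr.
have b0 m : 0 <= b m by rewrite mulr_ge0 ?invr_ge0 ?(ltW K0).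
have b4 : b 0%N <= 1 / 4.
  by rewrite /b add0n ler_pdivrMr//; lra.
have step m z : cabs z < r -> cabs (gfac (m + N) z - 1) <= b m - b m.+1.
  move=> /ltW zr; apply: le_trans (gfac_near1 zr _) _.
    have : N%:R <= (m + N).+1%:R :> R by rewrite ler_nat; lia.
    by lra.
  rewrite -/K /b -mulrBr ler_wpM2l ?(ltW K0)//.
  have [M hM] : exists M, (m + N = M.+1)%N.
    by exists (m + N).-1; rewrite prednK// addn_gt0; move: N0; rewrite ltr0n => ->; rewrite orbT.
  by rewrite addSn hM inv_sq_le.
have qb m z : cabs z < r -> cabs (q m z - 1) <= 2 * (b 0%N - b m) /\ cabs (q m z) <= 2.
  move=> zr; elim: m => [|m [IH1 IH2]].
    by rewrite /q big_ord0 !subrr cabs0 mulr0 cabs1; split=> //; lra.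
  have h1 : cabs (q m.+1 z - 1) <= 2 * (b 0%N - b m.+1).
    rewrite qS (_ : _ - 1 = (q m z - 1) + q m z * (gfac (m + N) z - 1)); last by ring.
    apply: le_trans (cabsD _ _) _; rewrite cabsM.
    have := ler_pM (cabs_ge0 _) (cabs_ge0 _) IH2 (step m z zr); lra.
  split=> //; rewrite -[q m.+1 z](subrK 1); apply: le_trans (cabsD _ _) _; rewrite cabs1.
  have := b0 m.+1; lra.
have b_lim : (fun m => 2 * b m) @ \oo --> (0 : R).
  rewrite -(mulr0 2) -[X in 2 * X](mulr0 K); apply: cvgM; first exact: cvg_cst.
  apply: cvgM; first exact: cvg_cst.
  have [M NM] : exists M, N = M.+1 by exists N.-1; rewrite prednK//; move: N0; rewrite ltr0n.
  rewrite (_ : (fun m : nat => _) = (fun m => (m + M).+1%:R^-1)); last by apply/funext => m; rewrite NM addnS.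
  apply: (@cvg_comp _ _ _ (fun m => (m + M)%N) (fun n : nat => n.+1%:R^-1 : R)); last exact: cvg_harmonic.
  exact: cvg_addnr.
have qc m n z : cabs z < r -> (m <= n)%N -> cabs (q n z - q m z) <= 2 * b m - 2 * b n.
  move=> zr; elim: n => [|n IH]; first by rewrite leqn0 => /eqP ->; rewrite !subrr cabs0.
  rewrite leq_eqVlt => /predU1P[->|]; first by rewrite !subrr cabs0.
  rewrite ltnS => /IH {}IH.
  rewrite qS (_ : _ - _ = (q n z - q m z) + q n z * (gfac (n + N) z - 1)); last by ring.
  apply: le_trans (cabsD _ _) _; rewrite cabsM.
  have := ler_pM (cabs_ge0 _) (cabs_ge0 _) (qb n z zr).2 (step n z zr); lra.
have lim z : cabs z < r -> exists2 l, clim (q^~ z) l & forall m, cabs (l - q m z) <= 2 * b m.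
  move=> zr; apply: (clim_cauchy (b := fun m => 2 * b m)) b_lim => m n mn.
  by apply: le_trans (qc m n z zr mn) _; have := b0 n; lra.
pose Q z := xget 0 [set l | clim (q^~ z) l].
have QP z : cabs z < r -> clim (q^~ z) (Q z).
  by move=> /lim[l hl _]; apply: (@xgetPex _ 0 [set l | clim (q^~ z) l]); exists l.
have QB z m : cabs z < r -> cabs (q m z - Q z) <= 2 * b m.
  by move=> zr; have [l hl h] := lim z zr; rewrite cabs_subC -(clim_unique hl (QP z zr)).
exists N, Q; split.
- apply: (@hol_unif_lim _ q Q 0 r (fun m => 2 * b m)) => //.
    by move=> m; apply: entire_hol; rewrite /q; apply: entire_prod => k; exact: gfac_entire.
  by move=> m z; rewrite subr0; exact: QB.
- move=> z zr; apply: clim_cabs_le (climB (QP z zr) (clim_cst 1)) _.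
  by exists 0%N => m _; apply: le_trans (qb m z zr).1 _; have := b0 m; lra.
- move=> z zr; apply: clim_ext (climM (clim_cst (gp N z)) (QP z zr)) => m.
  by elim: m => [|m IH]; [rewrite /q big_ord0 mulr1|rewrite addSn gpS -IH qS mulrA].
Qed.

Definition rgam z : C := xget 0 [set l | clim (gp^~ z) l].

Lemma rgamE r : 0 < r -> exists N (Q : C -> C), [/\ hol Q 0 r,
  forall z, cabs z < r -> Q z != 0 &
  forall z, cabs z < r -> clim (gp^~ z) (rgam z) /\ rgam z = gp N z * Q z].
Proof.
move=> /gp_tail[N [Q [hQ Q1 Ql]]]; exists N, Q; split=> //.
  move=> z zr; apply/eqP => Qz; have := Q1 z zr.
  by rewrite Qz sub0r cabsN cabs1; lra.
move=> z zr; have h : clim (gp^~ z) (gp N z * Q z).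
  apply/climP => e e0; have [M hM] := (climP _ _).1 (Ql z zr) e e0.
  exists (M + N)%N => n hn; rewrite -(subnK (_ : (N <= n)%N)); last by lia.
  by apply: hM; lia.
have h2 : clim (gp^~ z) (rgam z).
  by apply: (@xgetPex _ 0 [set l | clim (gp^~ z) l]); exists (gp N z * Q z).
by split=> //; exact: clim_unique h2 h.
Qed.

Lemma rgam_entire : entire rgam.
Proof.
apply: hol_entire => r r0; have [N [Q [hQ _ hE]]] := rgamE r0.
apply: (@hol_eq _ (fun z => gp N z * Q z)).
  by move=> z; rewrite subr0 => /hE[_ ->].
move=> z zr; have [l hl] := hQ z zr.
have [k hk] : exists k, cdiff (gp N) z k by apply: entire_prod => k; exact: gfac_entire.
by eexists; exact: (cdiffM hk hl).
Qed.

Lemma rgam_neq0 z : (forall k : nat, z != - k.+1%:R) -> rgam z != 0.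
Proof.
move=> hz; have r0 : 0 < cabs z + 1 by rewrite ltr_wpDl.
have [N [Q [_ Q0 hE]]] := rgamE r0; have zr : cabs z < cabs z + 1 by rewrite ltrDl.
have [_ ->] := hE z zr; rewrite mulf_neq0 ?Q0//; apply/prodf_neq0 => k _.
rewrite mulf_neq0 ?cexp_neq0//.
have k0 : k.+1%:R != 0 :> C by rewrite pnatr_eq0.
apply: contraNneq (hz k) => h; apply/eqP; apply: (mulIf (invr_neq0 k0)).
by rewrite mulNr mulfV//; apply/eqP; rewrite -addr_eq0 addrC h.
Qed.

Lemma rgam_real (x g : R) : (fun n => gprod x n * g) @ \oo --> (1 : R) -> rgam x%:C * g%:C = 1.
Proof.
move=> h; have r0 : 0 < cabs (x%:C : C) + 1 by rewrite ltr_wpDl.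
have [N [Q [_ _ hE]]] := rgamE r0.
have [h1 _] : clim (gp^~ x%:C) (rgam x%:C) /\ rgam x%:C = gp N x%:C * Q x%:C.
  by apply: hE; rewrite ltrDl.
apply: clim_unique (climM h1 (clim_cst g%:C)) _.
move/clim_real : h; apply: clim_ext => n.
by rewrite gp_real -rmorphM.
Qed.

End GammaReciprocal.

(** * An explicit zeta function and its identification *)

Section ZetaFormula.
Variable R : realType.
Local Notation C := R[i].
Implicit Types (s z w : C) (r x : R).

(** The formula for [xi] solved for zeta; writing [s Gamma (s/2)] as [2 Gamma (s/2 + 1)] cancels the
    factor [s] and leaves [s - 1] as the only denominator. *)
Definition rzeta s : C := xi s * cexp (s / 2 * (ln pi)%:C) * rgam (s / 2) / (2 * (s - 1)).

Lemma rzeta_cdiff s : s != 1 -> exists l, cdiff rzeta s l.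
Proof.
move=> s1; have h2 : cdiff (fun z : C => z / 2) s (s * 0 + 2^-1 * 1).
  by apply: cdiffM; [exact: cdiff_id|exact: cdiff_cst].
have [l hl] := xi_entire s; have [k hk] := rgam_entire (s / 2).
eexists; apply: cdiffM; last first.
  apply: cdiffV; first by rewrite mulf_neq0 ?pnatr_eq0// subr_eq0.
  apply: cdiffM; first exact: cdiff_cst.
  by apply: cdiffB; [exact: cdiff_id|exact: cdiff_cst].
apply: cdiffM; last exact: (cdiff_comp h2 hk).
apply: cdiffM; first exact: hl.
apply: (@cdiff_comp _ (fun z => z / 2 * (ln pi)%:C) (@cexp R)); last exact: cdiff_cexp.
by apply: cdiffM; [exact: h2|exact: cdiff_cst].
Qed.

Definition dterm s n : C := cexp (- (s * (ln n.+1%:R)%:C)).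

Lemma clog_real x : 0 < x -> clog (x%:C : C) = (ln x)%:C.
Proof.
move=> x0; rewrite /clog cabs_real gtr0_norm// /carg /= lexx cabs_real gtr0_norm//.
by rewrite divff ?gt_eqF// acos1.
Qed.

Lemma cpow_nat n s : cpow (n.+1%:R : C) (- s) = dterm s n.
Proof.
have e : n.+1%:R = (n.+1%:R : R)%:C :> C by rewrite rmorph_nat.
by rewrite /cpow pnatr_eq0 /= e clog_real// mulNr.
Qed.

Lemma cabs_dterm s n : cabs (dterm s n) = expR (- (complex.Re s * ln n.+1%:R)).
Proof. by rewrite /dterm cabs_cexp; case: s => a b /=; rewrite mulr0 subr0. Qed.

(** On this interval [mellin] and [gprod_lim] both apply to [y = x / 2]; the identity theorem
    extends the equality from here. *)
Lemma real_zeta x : 1 < x -> x < 2 ->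
  csum (dterm x%:C) (rzeta x%:C) /\ cvgn (series (fun n => expR (- (x * ln n.+1%:R)))).
Proof.
move=> x1 x2; pose y := x / 2.
have [y1 y2] : 2^-1 < y /\ y < 1 by rewrite /y; split; lra.
have y0 : 0 < y by lra.
have [g hg hP] := gprod_lim y0 y2.
have Pg := rgam_real hP.
have g0 : g != 0.
  by apply/eqP => g0; move/eqP: Pg; rewrite g0 mulr0 eq_sym oner_eq0.
have hc := @cm_cvg R `|2 * y - 2^-1| (normr_ge0 _).
have hl : series (fun k => cm R k * (2 * y - 2^-1) ^+ (2 * k)) @ \oo -->
    limn (series (fun k => cm R k * `|2 * y - 2^-1| ^+ (2 * k))).
  rewrite (_ : (fun k => _) = (fun k => cm R k * `|2 * y - 2^-1| ^+ (2 * k))); first exact: hc.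
  by apply/funext => k; rewrite !exprM real_normK ?num_real.
have hM := mellin y1 y2 hg hl; set L := limn _ in hl hM.
have xE : x = 2 * y by rewrite /y mulrC divfK.
have IE : Ifun x%:C = L%:C.
  apply: Ifun_eq; move/csum_real: hl; apply: csum_ext => k.
  by rewrite /Iterm xE rmorphM rmorphXn/= rmorphB/= fmorphV rmorph_nat.
(* [A] is [pi^(x/2) / Gamma (x/2)], since [g] is [Gamma (y + 1)]; it undoes the factors in
   [mellin]. *)
pose A := expR (y * ln pi) * (y / g).
have lp (n : nat) : ln (pi * n.+1%:R ^+ 2) = ln pi + 2 * ln n.+1%:R :> R.
  by rewrite lnM ?posrE ?pi_gt0 ?exprn_gt0// lnXn// mulr_natl.
have hS : series (fun n => expR (- (x * ln n.+1%:R))) @ \oo --> A * ((2 * y * (2 * y - 1))^-1 + L).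
  have h := cvgM (cvg_cst A) hM.
  rewrite (_ : series _ = (fun n => A * series (fun n => expR (- (y * ln (pi * n.+1%:R ^+ 2))) * (g / y)) n)).
    exact: h.
  apply/funext => n; rewrite /series/= mulr_sumr; apply: eq_bigr => k _.
  rewrite lp /A xE.
  have -> : expR (- (2 * y * ln k.+1%:R)) = expR (y * ln pi) * expR (- (y * (ln pi + 2 * ln k.+1%:R))).
    by rewrite -expRD; congr expR; ring.
  by field; rewrite g0 gt_eqF.
split; last by apply/cvg_ex; eexists; exact: hS.
move/csum_real : hS => hS.
have -> : rzeta x%:C = (A * ((2 * y * (2 * y - 1))^-1 + L))%:C.
  have PE : rgam y%:C = (g^-1)%:C.
    apply: (mulIf (_ : g%:C != 0 :> C)); first by rewrite eq_complex /= eqxx andbT.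
    by rewrite Pg -rmorphM mulVf.
  have y2E : x%:C / 2 = y%:C :> C by rewrite rmorphM fmorphV rmorph_nat.
  have lE : y%:C * (ln pi)%:C = (y * ln pi)%:C :> C.
    by rewrite (rmorphM _ y).
  have xiE : xi x%:C = (1 + x * (x - 1) * L)%:C.
    by rewrite /xi IE rmorphD rmorph1 !rmorphM rmorphB/= rmorph1.
  have dE : 2 * (x%:C - 1) = (2 * (x - 1))%:C :> C.
    by rewrite rmorphM rmorph_nat rmorphB rmorph1.
  rewrite /rzeta y2E lE PE cexp_real xiE dE -fmorphV -!rmorphM; congr (_%:C).
  rewrite /= /A xE; field; rewrite g0 !gt_eqF//; lra.
apply: csum_ext hS => n; rewrite /dterm -cexp_real; congr cexp.
by rewrite rmorphN rmorphM.
Qed.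

Definition dsum_zeta s : C := xget 0 [set l | csum (dterm s) l].

Lemma dterm_le x s n : x <= complex.Re s -> cabs (dterm s n) <= expR (- (x * ln n.+1%:R)).
Proof.
move=> xs; rewrite cabs_dterm ler_expR lerN2 ler_wpM2r//.
by rewrite ln_ge0// ler1n.
Qed.

Lemma between1 x : 1 < x -> exists y : R, [/\ 1 < y, y < 2 & y < x].
Proof.
move=> x1; exists (1 + Num.min (x - 1) 1 / 2).
have : 0 < Num.min (x - 1) 1 by rewrite lt_min ltr01 andbT subr_gt0.
have : Num.min (x - 1) 1 <= x - 1 by rewrite ge_min lexx.
have : Num.min (x - 1) 1 <= 1 by rewrite ge_min lexx orbT.
by move: (Num.min _ _) => m h1 h2 h3; split; lra.
Qed.

Lemma dsum_zetaP s : 1 < complex.Re s -> csum (dterm s) (dsum_zeta s).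
Proof.
move=> s1; have [y [y1 y2 ys]] := between1 s1.
have [l hl _] := csum_tail (fun n => dterm_le n (ltW ys)) (real_zeta y1 y2).2.
by apply: (@xgetPex _ 0 [set l | csum (dterm s) l]); exists l.
Qed.

Lemma dterm_entire n : entire (dterm^~ n).
Proof.
move=> z; eexists.
apply: (@cdiff_comp _ (fun z => - (z * (ln n.+1%:R)%:C)) (@cexp R)); last exact: cdiff_cexp.
by apply: cdiffN; apply: cdiffM; [exact: cdiff_id|exact: cdiff_cst].
Qed.

Lemma dsum_zeta_cdiff s : 1 < complex.Re s -> exists l, cdiff dsum_zeta s l.
Proof.
move=> s1; have [y [y1 y2 ys]] := between1 s1.
have hc := (real_zeta y1 y2).2.
have r0 : 0 < complex.Re s - y by rewrite subr_gt0.
have re z : cabs (z - s) < complex.Re s - y -> y <= complex.Re z.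
  move=> h; have := le_lt_trans (cabs_Re _) h; rewrite ReB ltr_norml => /andP[]; lra.
apply: (@hol_unif_lim _ (fun n z => series (dterm z) n) dsum_zeta s (complex.Re s - y)
  (fun n => limn (series (fun n => expR (- (y * ln n.+1%:R)))) - series (fun n => expR (- (y * ln n.+1%:R))) n)) => //.
- move=> n z _; rewrite /series/=.
  have [d hd] : exists d : nat -> C, forall i, cdiff (dterm^~ i) z (d i).
    by have /choice[d hd] := fun i => dterm_entire i z; exists d.
  by eexists; apply: cdiff_sum => i; exact: hd.
- rewrite -(subrr (limn (series (fun n => expR (- (y * ln n.+1%:R)))))).
  by apply: cvgB; [exact: cvg_cst|exact: hc].
- move=> n z zr; rewrite cabs_subC; apply: csum_tail_le => //.
    by move=> k; apply: dterm_le; exact: re.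
  by apply: dsum_zetaP; apply: lt_le_trans y1 (re _ zr).
- by rewrite subrr cabs0.
Qed.

(* Discs [|z - c| < c - 1] with [c - 1] growing geometrically exhaust the half-plane. *)
Lemma dsum_zetaE s : 1 < complex.Re s -> dsum_zeta s = rzeta s.
Proof.
have inhalf (c : R) z : cabs (z - c%:C) < c - 1 -> 1 < complex.Re z.
  move=> h; have := le_lt_trans (cabs_Re _) h; rewrite ReB/= ltr_norml => /andP[]; lra.
have neq1 z : 1 < complex.Re z -> z != 1.
  by move=> h; apply/eqP => z1; move: h; rewrite z1 /= ltxx.
pose f z := dsum_zeta z - rzeta z.
have hf z : 1 < complex.Re z -> exists l, cdiff f z l.
  move=> h; have [a ha] := dsum_zeta_cdiff h; have [b hb] := rzeta_cdiff (neq1 z h).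
  by exists (a - b); exact: cdiffB.
have base x : 1 < x -> x < 2 -> f x%:C = 0.
  move=> x1 x2; apply/eqP; rewrite subr_eq0; apply/eqP.
  exact: csum_unique (dsum_zetaP (_ : 1 < complex.Re x%:C)) (real_zeta x1 x2).1.
(* The first disc has diameter [(1, 2)], the range of [real_zeta]. The ratio [3 / 2] puts each new
   centre at half the radius of the preceding disc, where [f] is already known to vanish. *)
pose c n : R := 1 + 2^-1 * (3 / 2) ^+ n.
have c1 n : 2^-1 <= c n - 1.
  by rewrite /c addrAC subrr add0r ler_peMr// exprn_ege1//; lra.
have cS n : c n.+1 - c n = (c n - 1) / 2 by rewrite /c exprS; field.
have key n z : cabs (z - (c n)%:C) < c n - 1 -> f z = 0.
  elim: n z => [|n IH] z hz.
    apply: (@hol_identity _ f (c 0%N)%:C (c 0%N - 1)) hz.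
      by move=> w /inhalf; exact: hf.
    move=> e e0; pose d := Num.min e (4^-1) / 2.
    have m0 : 0 < Num.min e 4^-1 by rewrite lt_min e0/= invr_gt0.
    have me : Num.min e 4^-1 <= e by rewrite ge_min lexx.
    have m4 : Num.min e 4^-1 <= 4^-1 by rewrite ge_min lexx orbT.
    exists (c 0%N + d)%:C; have d0 : 0 < d by rewrite divr_gt0.
    have E : (c 0%N + d)%:C - (c 0%N)%:C = d%:C :> C by rewrite -rmorphB addrC addKr.
    split.
    + by rewrite -subr_eq0 E eq_complex/= gt_eqF.
    + by rewrite E cabs_real gtr0_norm// /d; lra.
    + by apply: base; rewrite /c expr0 /d; move: (Num.min _ _) m0 me m4 => m; lra.
  apply: (@hol_identity _ f (c n.+1)%:C (c n.+1 - 1)) hz.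
    by move=> w /inhalf; exact: hf.
  move=> e e0; have q0 : 0 < (c n - 1) / 2 by have := c1 n; lra.
  pose d := Num.min e ((c n - 1) / 2) / 2.
  have m0 : 0 < Num.min e ((c n - 1) / 2) by rewrite lt_min e0 q0.
  have me : Num.min e ((c n - 1) / 2) <= e by rewrite ge_min lexx.
  have m4 : Num.min e ((c n - 1) / 2) <= (c n - 1) / 2 by rewrite ge_min lexx orbT.
  exists (c n.+1 + d)%:C; have d0 : 0 < d by rewrite divr_gt0.
  have E : (c n.+1 + d)%:C - (c n.+1)%:C = d%:C :> C by rewrite -rmorphB addrC addKr.
  split.
  - by rewrite -subr_eq0 E eq_complex/= gt_eqF.
  - by rewrite E cabs_real gtr0_norm// /d; lra.
  - apply: IH; rewrite -rmorphB cabs_real addrAC cS gtr0_norm; last by rewrite addr_gt0.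
    by rewrite /d; move: (Num.min _ _) m0 me m4 => m; lra.
move=> s1; apply/eqP; rewrite -subr_eq0; apply/eqP.
suff [n hn] : exists n, cabs (s - (c n)%:C) < c n - 1 by exact: key hn.
(* The condition that [s] lies in the disc of centre [c n], squared and simplified. *)
have : \forall n \near \oo, (complex.Re s - 1) ^+ 2 + complex.Im s ^+ 2 < 2 * (complex.Re s - 1) * (c n - 1).
  have hp : 0 < complex.Re s - 1 by rewrite subr_gt0.
  pose Y := ((complex.Re s - 1) ^+ 2 + complex.Im s ^+ 2) / (complex.Re s - 1).
  have [N hN] : exists N : nat, Y < (3 / 2) ^+ N.
    exists (2 * Num.bound Y)%N; apply: (@lt_le_trans _ _ (Num.bound Y)%:R).
      by apply: archi_boundP; apply: divr_ge0; [rewrite addr_ge0 ?sqr_ge0|exact: ltW].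
    rewrite exprM; apply: (@le_trans _ _ (2 ^+ Num.bound Y)).
      by rewrite -natrX ler_nat ltnW// ltn_expl.
    by rewrite lerXn2r ?nnegrE//; lra.
  exists N => // n /= Nn; rewrite /c addrAC subrr add0r.
  have : (3 / 2) ^+ N <= (3 / 2) ^+ n :> R by rewrite ler_weXn2l//; lra.
  move: hN; rewrite /Y ltr_pdivrMr// => h1 h2; apply: lt_le_trans h1 _.
  by have := ler_wpM2r (ltW hp) h2; lra.
move=> [n _ hn]; exists n; have {hn} := hn n (leqnn _).
have h0 : 0 <= c n - 1 by have := c1 n; lra.
move=> h; rewrite -(@ltr_pXn2r _ 2) ?nnegrE// cabs_sqr ReB ImB /= subr0.
by move: (complex.Re s) (complex.Im s) (c n) h => a b d; rewrite !expr2; lra.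
Qed.

Lemma rzeta_is_zeta : is_riemann_zeta (rzeta : R[i]^o -> R[i]^o).
Proof.
split=> [s /rzeta_cdiff h|s s1]; first by apply/derivableC.
rewrite -dsum_zetaE//; have /clim_cvg := dsum_zetaP s1.
rewrite (_ : (fun n => cpow _ _) = dterm s)//.
by apply/funext => n; rewrite cpow_nat.
Qed.

Lemma zeta_unique (f : C -> C) : is_riemann_zeta (f : R[i]^o -> R[i]^o) ->
  forall s, s != 1 -> f s = rzeta s.
Proof.
move=> [fd fs]; pose g z := f z - rzeta z.
have gd z : z != 1 -> exists l, cdiff g z l.
  move=> z1; have /derivableC[a ha] := fd z z1; have [b hb] := rzeta_cdiff z1.
  by exists (a - b); exact: cdiffB.
have g2 z : 1 < complex.Re z -> g z = 0.
  move=> z1; apply/eqP; rewrite subr_eq0 -dsum_zetaE//; apply/eqP.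
  apply: clim_unique (dsum_zetaP z1); apply/clim_cvg.
  rewrite (_ : dterm z = (fun n => cpow n.+1%:R (- z))); first exact: fs.
  by apply/funext => n; rewrite cpow_nat.
(* The disc of centre [2 + i Y] and radius [sqrt (1 + Y^2)] has 1 on its boundary and meets the
   half-plane where [g] vanishes; [Y] is chosen so that the disc contains [z]. *)
have gI z : complex.Im z != 0 -> g z = 0.
  case: z => a b /= b0.
  pose Y : R := ((a - 2) ^+ 2 + b ^+ 2) / b.
  have bY : b * Y = (a - 2) ^+ 2 + b ^+ 2 by rewrite /Y mulrC divfK.
  pose r := Num.sqrt (1 + Y ^+ 2).
  have r1 : 1 <= r by rewrite -[leLHS]sqrtr1 ler_wsqrtr// lerDl sqr_ge0.
  have r2 : r ^+ 2 = 1 + Y ^+ 2 by rewrite sqr_sqrtr// addr_ge0// sqr_ge0.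
  have r0 : 0 <= r by lra.
  apply: (@hol_identity _ g (2 +i* Y) r).
  - move=> w hw; apply: gd; apply/eqP => w1; move: hw.
    rewrite w1 -(@ltr_pXn2r _ 2) ?nnegrE// cabs_sqr ReB ImB r2 /= !expr2; lra.
  - move=> e e0; exists ((2 + e / 2) +i* Y).
    have E : (2 + e / 2) +i* Y - 2 +i* Y = (e / 2)%:C :> C.
      by apply/eqP; rewrite eq_complex/= addrN eqxx andbT addrAC addrN add0r.
    split.
    + by rewrite -subr_eq0 E eq_complex/= gt_eqF// divr_gt0.
    + by rewrite E cabs_real gtr0_norm ?divr_gt0//; lra.
    + by apply: g2 => /=; lra.
  - rewrite -(@ltr_pXn2r _ 2) ?nnegrE// cabs_sqr ReB ImB r2 /=.
    have := sqr_ge0 (a - 2); have := exprn_even_gt0 (n := 2) b; rewrite b0 orbT => /(_ isT).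
    by move: bY; rewrite !expr2; lra.
move=> s s1; apply/eqP; rewrite -subr_eq0 -/(g s).
have [b0|/gI ->//] := eqVneq (complex.Im s) 0.
(* A real point other than 1 is a limit of nonreal ones, so continuity settles it. *)
apply/negPn/negP => gs; have [l /cdiff_continuous hc] := gd s s1.
have [|d d0 hd] := hc (cabs (g s)); first by rewrite cabs_gt0.
have := hd (s + (0 +i* (d / 2))); rewrite addrC addKr gI.
  rewrite sub0r cabsN ltxx => h; suff : false by []; apply: h.
  apply: le_lt_trans (cabs_ReIm _) _; rewrite /= normr0 add0r gtr0_norm ?divr_gt0//; lra.
by rewrite ImD b0 add0r/= gt_eqF// divr_gt0.
Qed.

(** [get] returns a function meeting the specification because [rzeta] meets it; uniqueness then
    fixes the values off 1. *)
Lemma zetaE s : s != 1 -> zeta (s : R[i]^o) = rzeta s.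
Proof.
move=> s1; apply: (@zeta_unique (@zeta R)) => //.
by apply: (@getPex _ [set f | is_riemann_zeta f]); exists (rzeta : R[i]^o -> R[i]^o); exact: rzeta_is_zeta.
Qed.

(** Apart from [xi], the only factor of [rzeta] that can vanish is [rgam (s / 2)], and its zeros are
    trivial. Conversely [xi] is nonzero at 1 and at the negative even integers, by [xi_real_neq0]
    for the latter. *)
Lemma nontrivial_zeroE z : nontrivial_zero (z : R[i]^o) <-> xi z = 0.
Proof.
split=> [[z1 z0 zt]|z0].
  move: z0; rewrite zetaE// /rzeta => /eqP; rewrite !mulf_eq0 invr_eq0 (negPf (cexp_neq0 _)) orbF.
  rewrite mulf_eq0 pnatr_eq0 subr_eq0 (negPf z1) !orbF.
  case/orP => [/eqP//|/eqP h]; exfalso; move/eqP: h; apply/negP; apply: rgam_neq0 => k.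
  apply: contraNneq (zt k) => h; apply/eqP; rewrite -[z](divfK (_ : 2 != 0)) ?pnatr_eq0//.
  by rewrite h natrM mulrC mulrN.
have z1 : z != 1 by apply/eqP => h; move/eqP: z0; rewrite h xi1 oner_eq0.
split=> //; first by rewrite zetaE// /rzeta z0 !mul0r.
move=> n; apply/eqP => h; move/eqP: z0; apply/negP.
have -> : z = (- (2 * n.+1)%:R : R)%:C by rewrite h rmorphN rmorph_nat.
by apply: xi_real_neq0; left; rewrite oppr_le0.
Qed.

(** A local factor without zero at [z]: multiplicities are defined through zeta but computed with
    [xi]. *)
Lemma zeta_xi z : nontrivial_zero (z : R[i]^o) -> exists2 u : C -> C,
  u z != 0 & exists2 e : R, 0 < e & hol u z e /\
    forall s, cabs (s - z) < e -> zeta (s : R[i]^o) = xi s * u s.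
Proof.
move=> nz; have [z1 _ zt] := nz.
have hP : rgam (z / 2) != 0.
  apply: rgam_neq0 => k; apply: contraNneq (zt k) => h; apply/eqP.
  by rewrite -[z](divfK (_ : 2 != 0)) ?pnatr_eq0// h natrM mulrC mulrN.
exists (fun s => cexp (s / 2 * (ln pi)%:C) * rgam (s / 2) / (2 * (s - 1))).
  by rewrite !mulf_neq0 ?cexp_neq0// invr_neq0// mulf_neq0 ?pnatr_eq0// subr_eq0.
have e0 : 0 < cabs (z - 1) by rewrite cabs_gt0 subr_eq0.
have ne s : cabs (s - z) < cabs (z - 1) -> s != 1.
  by move=> h; apply/eqP => s1; move: h; rewrite s1 cabs_subC ltxx.
exists (cabs (z - 1)) => //; split=> s /ne s1.
  have h2 : cdiff (fun z : C => z / 2) s (s * 0 + 2^-1 * 1).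
    by apply: cdiffM; [exact: cdiff_id|exact: cdiff_cst].
  have [k hk] := rgam_entire (s / 2).
  eexists; apply: cdiffM; last first.
    apply: cdiffV; first by rewrite mulf_neq0 ?pnatr_eq0// subr_eq0.
    apply: cdiffM; first exact: cdiff_cst.
    by apply: cdiffB; [exact: cdiff_id|exact: cdiff_cst].
  apply: cdiffM; last exact: (cdiff_comp h2 hk).
  apply: (@cdiff_comp _ (fun z => z / 2 * (ln pi)%:C) (@cexp R)); last exact: cdiff_cexp.
  by apply: cdiffM; [exact: h2|exact: cdiff_cst].
by rewrite zetaE// /rzeta !mulrA.
Qed.

End ZetaFormula.

(** * Zeros of xi *)

Section ZeroOrders.
Variable R : realType.
Local Notation C := R[i].
Local Notation cj := (@conjc R).
Implicit Types (f g h : C -> C) (s z w : C) (r e : R) (m n : nat).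

Lemma near_point z e : 0 < e -> exists w : C, [/\ w != z, cabs (w - z) < e & cabs (w - z) = e / 2].
Proof.
move=> e0; exists (z + (e / 2)%:C); have e2 : 0 < e / 2 by rewrite divr_gt0.
rewrite [z + _ - z]addrC addKr cabs_real gtr0_norm//; split=> //; last by lra.
by rewrite -subr_eq0 [z + _ - z]addrC addKr eq_complex/= gt_eqF.
Qed.

(** Away from [z] one may cancel to get [g = (s - z)^(n - m) h], and continuity forces [g z = 0]. *)
Lemma order_lt_contra g h z e m n : 0 < e -> (m < n)%N ->
  (exists l, cdiff g z l) -> (exists l, cdiff h z l) -> g z != 0 ->
  (forall s, cabs (s - z) < e -> (s - z) ^+ m * g s = (s - z) ^+ n * h s) -> False.
Proof.
move=> e0 mn [a ha] [b hb] gz E.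
pose k s := g s - (s - z) ^+ (n - m) * h s.
have [l hk] : exists l, cdiff k z l.
  eexists; apply: cdiffB; first exact: ha.
  apply: cdiffM; last exact: hb.
  apply: (@cdiff_comp _ (fun s => s - z) (fun s => s ^+ (n - m))); last exact: cdiffX.
  by apply: cdiffB; [exact: cdiff_id|exact: cdiff_cst].
have kz : k z = g z by rewrite /k subrr expr0n subn_eq0 leqNgt mn mul0r subr0.
have g0 : 0 < cabs (g z) by rewrite cabs_gt0.
have [d d0 hd] := cdiff_continuous hk g0.
have m0 : 0 < Num.min d e by rewrite lt_min d0.
have [w [wz wm _]] := near_point z m0.
have := hd w (lt_le_trans wm _); rewrite kz ge_min lexx => /(_ isT).
suff -> : k w = 0 by rewrite sub0r cabsN ltxx.
apply/eqP; rewrite subr_eq0; apply/eqP; apply: (mulfI (_ : (w - z) ^+ m != 0)).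
  by rewrite expf_neq0// subr_eq0.
rewrite mulrA -exprD subnKC ?(ltnW mn)// E//.
by apply: lt_le_trans wm _; rewrite ge_min lexx orbT.
Qed.

Lemma order_unique g h z e m n : 0 < e ->
  (exists l, cdiff g z l) -> (exists l, cdiff h z l) -> g z != 0 -> h z != 0 ->
  (forall s, cabs (s - z) < e -> (s - z) ^+ m * g s = (s - z) ^+ n * h s) -> m = n.
Proof.
move=> e0 ga hb gz hz E; apply/eqP; rewrite eqn_leq; apply/andP; split; rewrite leqNgt; apply/negP => lt.
  by apply: (order_lt_contra e0 lt hb ga hz) => s hs; rewrite E.
exact: (order_lt_contra e0 lt ga hb gz E).
Qed.

(** [hol_factor] is applied on a disc that contains a point where [f] is nonzero; its quotient is
    glued to [f / (s - z)^m], which is differentiable away from [z]. *)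
Lemma entire_factor f z : entire f -> (exists w, f w != 0) ->
  exists m g, [/\ entire g, g z != 0 & forall s, f s = (s - z) ^+ m * g s].
Proof.
move=> fe [w fw]; have r0 : 0 < cabs (w - z) + 1 by rewrite ltr_wpDl.
have [|m [g [hg gz E]]] := hol_factor r0 (@entire_hol _ f z _ fe).
  by exists w => //; rewrite ltrDl.
pose G s := if s == z then g z else f s / (s - z) ^+ m.
have GE s : cabs (s - z) < cabs (w - z) + 1 -> G s = g s.
  rewrite /G; case: eqVneq => [->//|sz] hs.
  by rewrite E// mulrAC mulfV ?mul1r// expf_neq0// subr_eq0.
exists m, G; split.
- move=> s; have [sz|sz] := eqVneq s z.
    have [l hl] : exists l, cdiff g z l by apply: hg; rewrite subrr cabs0.
    by exists l; rewrite sz; apply: cdiff_eq_near r0 _ hl => v /GE.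
  have d0 : 0 < cabs (s - z) by rewrite cabs_gt0 subr_eq0.
  have [l hl] := fe s; eexists.
  apply: (cdiff_eq_near (f := fun v => f v * ((v - z) ^+ m)^-1) d0).
    move=> v hv; rewrite /G; case: eqVneq => // vz.
    by move: hv; rewrite vz cabs_subC ltxx.
  apply: cdiffM; first exact: hl.
  apply: cdiffV; first by rewrite expf_neq0// subr_eq0.
  apply: (@cdiff_comp _ (fun s => s - z) (fun s => s ^+ m)); last exact: cdiffX.
  by apply: cdiffB; [exact: cdiff_id|exact: cdiff_cst].
- by rewrite /G eqxx.
- move=> s; have [->|sz] := eqVneq s z.
    by rewrite E ?subrr ?cabs0// GE// subrr cabs0.
  by rewrite /G (negPf sz) mulrC divfK// expf_neq0// subr_eq0.
Qed.

Definition zmult z : nat := multiplicity (z : R[i]^o).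

(** [zmult z] is picked by [get] among the orders of zeta at [z]. By [zeta_xi] the order of [xi] is
    one of them, and orders are unique. *)
Lemma xi_order z : xi z = 0 -> [/\ (0 < zmult z)%N & exists g, [/\ entire g, g z != 0 &
  forall s, xi s = (s - z) ^+ zmult z * g s]].
Proof.
move=> z0; have nz : nontrivial_zero (z : R[i]^o) by apply/nontrivial_zeroE.
have xn : exists w : C, xi w != 0 by exists 1; rewrite xi1 oner_neq0.
have [m [g [ge gz E]]] := entire_factor z (@xi_entire R) xn.
have m0 : (0 < m)%N.
  rewrite lt0n; apply/eqP => m0; move/eqP: (E z); rewrite z0 m0 expr0 mul1r eq_sym.
  by rewrite (negPf gz).
have [u uz [e e0 [hu uE]]] := zeta_xi nz.
have hz : exists l, cdiff u z l by apply: hu; rewrite subrr cabs0.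
have ho : has_order (@zeta R) (z : R[i]^o) m.
  exists (fun s => g s * u s); split.
  - apply/nearCP; exists e => // s hs; apply/derivableC.
    by have [a ha] := ge s; have [b hb] := hu s hs; eexists; exact: (cdiffM ha hb).
  - by rewrite mulf_neq0.
  - by apply/nearCP; exists e => // s hs; rewrite uE// E mulrA.
have [v [vd vz vE]] : has_order (@zeta R) (z : R[i]^o) (zmult z).
  by apply: (@getPex _ [set m | has_order (@zeta R) (z : R[i]^o) m]); exists m.
have [d d0 hd] := (nearCP _ _).1 vE; have [d' d0' hd'] := (nearCP _ _).1 vd.
suff -> : zmult z = m by split=> //; exists g.
have q0 : 0 < Num.min e d by rewrite lt_min e0.
apply: (order_unique (g := v) (h := fun s => g s * u s) (z := z) q0) => //.
- by apply/derivableC; apply: hd'; rewrite subrr cabs0.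
- by have [a ha] := ge z; have [b hb] := hz; eexists; exact: (cdiffM ha hb).
- by rewrite mulf_neq0.
- move=> s; rewrite lt_min => /andP[se sd].
  by rewrite -hd// uE// E mulrA.
Qed.

Lemma zmult_eq z m g : xi z = 0 -> (exists l, cdiff g z l) -> g z != 0 ->
  (forall s, xi s = (s - z) ^+ m * g s) -> zmult z = m.
Proof.
move=> z0 gd gz E; have [_ [h [he hz hE]]] := xi_order z0.
apply: (order_unique (g := h) (h := g) (z := z) ltr01) => // s _.
by rewrite -hE -E.
Qed.

Lemma xi_zero_sym z : xi z = 0 -> xi (1 - z) = 0. Proof. by rewrite xi_sym. Qed.

Lemma xi_zero_conj z : xi z = 0 -> xi (cj z) = 0.
Proof. by rewrite xi_conj => ->; rewrite /conjc /= oppr0. Qed.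

Lemma zmult_sym z : xi z = 0 -> zmult (1 - z) = zmult z.
Proof.
move=> z0; have [_ [g [ge gz gE]]] := xi_order z0.
have d s : cdiff (fun s : C => 1 - s) s (0 - 1) by apply: cdiffB; [exact: cdiff_cst|exact: cdiff_id].
apply: (@zmult_eq _ _ (fun s => (-1) ^+ zmult z * g (1 - s))); first exact: xi_zero_sym.
- have [l hl] := ge (1 - (1 - z)).
  by eexists; apply: cdiffM; [exact: cdiff_cst|exact: (cdiff_comp (d _) hl)].
- by rewrite subKr mulf_neq0// expf_neq0// oppr_eq0 oner_neq0.
- move=> s; rewrite -xi_sym gE mulrA -exprMn; congr (_ ^+ _ * _); ring.
Qed.

Lemma cdiff_conj f z l : cdiff f (cj z) l -> cdiff (fun s => cj (f (cj s))) z (cj l).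
Proof.
move=> h e e0; have [d d0 hd] := h e e0; exists d => // w wd.
have wd' : cabs (cj w) < d by rewrite cabs_conj.
have := hd _ wd'; rewrite cabs_conj -cjD -(cabs_conj (_ - _ * _)) !cjB cjM.
by rewrite conjcK.
Qed.

Lemma zmult_conj z : xi z = 0 -> zmult (cj z) = zmult z.
Proof.
move=> z0; have [_ [g [ge gz gE]]] := xi_order z0.
apply: (@zmult_eq _ _ (fun s => cj (g (cj s)))); first exact: xi_zero_conj.
- have [l hl] := ge (cj (cj z)); eexists; exact: cdiff_conj hl.
- by rewrite conjcK -cabs_eq0 cabs_conj cabs_eq0.
- move=> s; rewrite -[s in LHS]conjcK xi_conj gE cjM cjX cjB conjcK //.
Qed.

Lemma xi_divide (B : seq C) : uniq B -> (forall z, z \in B -> xi z = 0) ->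
  exists q, [/\ entire q, forall z, z \in B -> q z != 0 &
    forall s, xi s = (\prod_(z <- B) (s - z) ^+ zmult z) * q s].
Proof.
elim: B => [|z B IH] /=.
  move=> _ _; exists (@xi R); split=> //; first exact: xi_entire.
  by move=> s; rewrite big_nil mul1r.
move=> /andP[zB uB] hB; have [w wB|q [qe qB qE]] := IH uB; first by apply: hB; rewrite in_cons wB orbT.
have z0 : xi z = 0 by apply: hB; rewrite in_cons eqxx.
have q1 : exists w, q w != 0.
  by exists 1; apply/eqP => h; move/eqP: (qE 1); rewrite h mulr0 xi1 oner_eq0.
have [m [g [ge gz gE]]] := entire_factor z qe q1.
pose P s := \prod_(w <- B) (s - w) ^+ zmult w.
have Pe : entire P.
  apply: entire_prod => w s; eexists.
  apply: (@cdiff_comp _ (fun s => s - w) (fun s => s ^+ zmult w)); last exact: cdiffX.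
  by apply: cdiffB; [exact: cdiff_id|exact: cdiff_cst].
have Pz : P z != 0.
  rewrite /P prodf_seq_neq0; apply/allP => w wB /=; rewrite expf_neq0// subr_eq0.
  by apply: contraNneq zB => ->.
have E s : xi s = (s - z) ^+ m * (P s * g s) by rewrite qE gE /P; ring.
(* [P] is nonzero at the new point [z], so the power extracted from the quotient [q] is the full
   multiplicity in [xi]. *)
have mE : zmult z = m.
  apply: (zmult_eq z0 (g := fun s => P s * g s)) => //; last by rewrite mulf_neq0.
  by have [a ha] := Pe z; have [b hb] := ge z; eexists; exact: (cdiffM ha hb).
exists g; split=> //.
- move=> w; rewrite in_cons => /predU1P[->//|wB].
  by apply: contraNneq (qB w wB) => h; rewrite gE h mulr0.
- by move=> s; rewrite big_cons mE E /P mulrA.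
Qed.

End ZeroOrders.

(** * Counting zeros and summing inverse squares *)

Section ZeroCounting.
Variable R : realType.
Local Notation C := R[i].
Implicit Types (s z w : C) (r : R) (B : seq C).

Definition zeros B := uniq B /\ forall z, z \in B -> xi z = 0.

Lemma zeros_filter B (P : pred C) : zeros B -> zeros [seq z <- B | P z].
Proof.
move=> [uB hB]; split; first exact: filter_uniq.
by move=> z; rewrite mem_filter => /andP[_]; exact: hB.
Qed.

Lemma zero_neq1 z : xi z = 0 -> 1 - z != 0.
Proof.
move=> z0; rewrite subr_eq0; apply/eqP => h.
by move/eqP: z0; rewrite -h xi1 oner_eq0.
Qed.

(** Normalised at [s = 1], where [xi] also takes the value 1. *)
Definition zprod B s := \prod_(z <- B) ((s - z) / (1 - z)) ^+ zmult z.

(** On the circle [|s - 1| = 4 r] every factor has modulus at least 3, as [|s - z| >= 3 r] and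
    [|1 - z| <= r]; so the quotient is smaller there by a power of 3. *)
Lemma xi_quotient B r : 0 < r -> zeros B -> (forall z, z \in B -> cabs (z - 1) <= r) ->
  exists q : C -> C, [/\ entire q, q 1 = 1, forall z, z \in B -> q z != 0,
    forall s, xi s = zprod B s * q s &
    forall s, cabs (s - 1) = 4 * r -> 3 ^+ (\sum_(z <- B) zmult z) * cabs (q s) <= cabs (xi s)].
Proof.
move=> r0 [uB hB] Br; have [q [qe qB qE]] := xi_divide uB hB.
pose c := \prod_(z <- B) (1 - z) ^+ zmult z.
have c0 : c != 0.
  rewrite /c prodf_seq_neq0; apply/allP => z zB /=; rewrite expf_neq0//.
  exact: zero_neq1 (hB z zB).
have PE s : \prod_(z <- B) (s - z) ^+ zmult z = zprod B s * c.
  rewrite /zprod /c -big_split/= !big_seq; apply: eq_bigr => z zB.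
  by rewrite -exprMn divfK// zero_neq1// hB.
exists (fun s => c * q s); split.
- move=> s; have [l hl] := qe s; eexists; apply: cdiffM; [exact: cdiff_cst|exact: hl].
- by rewrite -[c * q 1]/(\prod_(z <- B) (1 - z) ^+ zmult z * q 1) -qE xi1.
- by move=> z zB; rewrite mulf_neq0// qB.
- by move=> s; rewrite qE PE mulrA.
- move=> s hs; rewrite qE !cabsM mulrA ler_wpM2r// /c !cabs_prod.
  rewrite (_ : 3 ^+ _ = \prod_(z <- B) 3 ^+ zmult z :> R); last by rewrite -prodrXr.
  rewrite -big_split/= big_seq [leRHS]big_seq; apply: ler_prod => z zB.
  rewrite !cabsX -exprMn exprn_ge0 ?mulr_ge0//= lerXn2r ?nnegrE ?mulr_ge0//.
  have h1 := Br z zB; have h2 := cabsD (s - z) (z - 1).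
  rewrite (_ : s - z + (z - 1) = s - 1) in h2; last by ring.
  rewrite (cabs_subC 1 z); rewrite hs in h2; lra.
Qed.

Lemma expR_half_le : expR (1 / 2) <= 3 :> R.
Proof.
have := expR_ge1Dx (- (1 / 2) : R); rewrite expRN; have := expR_gt0 (1 / 2 : R).
move: (expR _) => e e0 h1; have := ler_wpM2l (ltW e0) h1; rewrite mulfV ?gt_eqF//; lra.
Qed.

(** Jensen's argument: the quotient has value 1 at the centre, which is at most its maximum on the
    circle of radius [4^(j+1)]; so [3^S <= exp (c 8^(j+1))]. *)
Lemma xi_count : exists2 K : R, 0 < K & forall B j, zeros B ->
  (forall z, z \in B -> cabs (z - 1) <= 4 ^+ j) -> (\sum_(z <- B) zmult z)%:R <= K * 8 ^+ j.
Proof.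
have [c c0 hc] := xi_growth R; exists (16 * c); first by rewrite mulr_gt0.
move=> B j zB hB; have r0 : 0 < 4 ^+ j :> R by rewrite exprn_gt0.
have [q [qe q1 _ _ qM]] := xi_quotient r0 zB hB.
set S := (\sum_(z <- B) zmult z)%N in qM *.
have p0 : 0 < 4 * 4 ^+ j :> R by rewrite mulr_gt0.
have h3 : 0 < 3 ^+ S :> R by rewrite exprn_gt0.
have h : cabs (q 1) <= expR (c * 8 ^+ j.+1) / 3 ^+ S.
  apply: (@hol_center _ q 1 (4 * 4 ^+ j + 1) (4 * 4 ^+ j)); first exact: entire_hol.
    by apply/andP; split=> //; rewrite ltrDl.
  move=> w hw; rewrite ler_pdivlMr// mulrC; apply: le_trans (qM w hw) _.
  by apply: hc; rewrite hw exprS.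
rewrite q1 cabs1 ler_pdivlMr// mul1r in h.
have e3 := expR_half_le.
have : expR (S%:R / 2) <= expR (c * 8 ^+ j.+1).
  apply: le_trans h; rewrite (_ : S%:R / 2 = S%:R * (1 / 2)); last by ring.
  by rewrite expRM_natl lerXn2r ?nnegrE ?expR_ge0.
by rewrite ler_expR exprS; clear; move: (8 ^+ j) (S%:R) => a b; lra.
Qed.

Lemma zeros_away1 : exists2 d : R, 0 < d & forall z, xi z = 0 -> d <= cabs (z - 1).
Proof.
have [l hl] := @xi_entire R 1; have [d d0 hd] := cdiff_continuous hl ltr01.
exists d => // z z0; rewrite leNgt; apply/negP => /hd.
by rewrite z0 xi1 sub0r cabsN cabs1 ltxx.
Qed.

(** By [xi_count] the lists of distinct zeros in the disc have bounded length, and one of maximal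
    length contains them all. *)
Lemma zeros_complete j : exists2 B, zeros B &
  forall z, xi z = 0 -> cabs (z - 1) <= 4 ^+ j -> cabs z <= 4 ^+ j -> z \in B.
Proof.
have [K K0 hK] := xi_count.
pose P n := `[< exists B, [/\ zeros B, (forall z, z \in B -> cabs (z - 1) <= 4 ^+ j) & size B = n] >].
have P0 : exists n, P n by exists 0%N; apply/asboolP; exists [::]; split.
pose M := Num.bound (K * 8 ^+ j).
have Pb n : P n -> (n <= M)%N.
  move=> /asboolP[B [zB hB <-]]; rewrite -(ler_nat R).
  apply: le_trans (ltW (archi_boundP (_ : 0 <= K * 8 ^+ j))); last by rewrite mulr_ge0 ?ltW// exprn_ge0.
  apply: le_trans (hK B j zB hB); rewrite ler_nat -sum1_size big_seq [leqRHS]big_seq.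
  by apply: leq_sum => z zin; have [] := xi_order (zB.2 z zin).
case: (ex_maxnP P0 Pb) => n /asboolP[B [zB hB sB]] nmax.
exists B => // z z0 zj _; apply/negPn/negP => zB'.
suff : (n.+1 <= n)%N by rewrite ltnn.
apply: nmax; apply/asboolP; exists (z :: B); split.
- split=> [|w]; first by rewrite /= zB' zB.1.
  by rewrite in_cons => /predU1P[->//|]; exact: zB.2.
- by move=> w; rewrite in_cons => /predU1P[->//|]; exact: hB.
- by rewrite /= sB.
Qed.

(** Imposing both bounds makes each [Z j] stable under [z |-> 1 - z] as well as under
    conjugation. *)
Lemma zeros_list : exists Z : nat -> seq C, forall j, uniq (Z j) /\
  forall z, (z \in Z j) <-> [/\ xi z = 0, cabs (z - 1) <= 4 ^+ j & cabs z <= 4 ^+ j].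
Proof.
have h j : exists B : seq C, uniq B /\
    forall z, (z \in B) <-> [/\ xi z = 0, cabs (z - 1) <= 4 ^+ j & cabs z <= 4 ^+ j].
  have [B zB hB] := zeros_complete j.
  exists [seq z <- B | (cabs (z - 1) <= 4 ^+ j) && (cabs z <= 4 ^+ j)].
  split=> [|z]; first exact: (zeros_filter _ zB).1.
  rewrite mem_filter; split=> [/andP[/andP[h1 h2] h3]|[h1 h2 h3]]; first by split=> //; exact: zB.2.
  by rewrite h2 h3 hB.
by have [Z hZ] := choice h; exists Z.
Qed.

Definition msum B : R := \sum_(z <- B) (zmult z)%:R / cabs (z - 1) ^+ 2.

Lemma msum_le_count B (d : R) : 0 < d -> (forall z, z \in B -> d <= cabs (z - 1)) ->
  msum B <= (\sum_(z <- B) zmult z)%:R / d ^+ 2.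
Proof.
move=> d0 hB; rewrite natr_sum mulr_suml /msum big_seq [leRHS]big_seq.
apply: ler_sum => z zB; rewrite ler_wpM2l// lef_pV2 ?posrE ?exprn_gt0//.
  by rewrite lerXn2r ?nnegrE ?(ltW d0)// hB.
exact: lt_le_trans d0 (hB z zB).
Qed.

Lemma msum_split B (P : pred C) : msum B = msum [seq z <- B | P z] + msum [seq z <- B | ~~ P z].
Proof. by rewrite /msum !big_filter (bigID P). Qed.

Lemma seq_bounded B : exists n, forall z, z \in B -> cabs (z - 1) <= 4 ^+ n.
Proof.
elim: B => [|z B [n hn]]; first by exists 0%N.
pose m := Num.bound (cabs (z - 1)).
exists (n + m)%N => w; rewrite in_cons => /predU1P[->|/hn h].
  apply: (@le_trans _ _ (4 ^+ m)); last by rewrite ler_weXn2l ?leq_addl//; lra.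
  apply: (@le_trans _ _ m%:R); first by apply/ltW/archi_boundP.
  by rewrite -natrX ler_nat ltnW// ltn_expl.
by apply: le_trans h _; rewrite ler_weXn2l ?leq_addr//; lra.
Qed.

(** The shell [4^i < |z - 1| <= 4^(i+1)] holds at most [K 8^(i+1)] zeros, each contributing at most
    [16^-i], hence [8 K / 2^i] in all. The induction on the number of shells carries the geometric
    sum in closed form. *)
Lemma msum_tail : exists2 K : R, 0 < K & forall B j, zeros B ->
  (forall z, z \in B -> 4 ^+ j < cabs (z - 1)) -> msum B <= K / 2 ^+ j.
Proof.
have [K K0 hK] := xi_count; exists (16 * K); first by rewrite mulr_gt0.
move=> B j zB hB; have [n hn] := seq_bounded B.
suff h k B' : zeros B' -> (forall z, z \in B' -> 4 ^+ j < cabs (z - 1)) ->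
    (forall z, z \in B' -> cabs (z - 1) <= 4 ^+ (j + k)) ->
    msum B' <= 16 * K * ((2 ^+ j)^-1 - (2 ^+ (j + k))^-1).
  apply: le_trans (h n B zB hB _) _.
    by move=> z /hn hz; apply: le_trans hz _; rewrite ler_weXn2l ?leq_addl//; lra.
  by rewrite ler_wpM2l ?mulr_ge0 ?(ltW K0)// gerBl invr_ge0 exprn_ge0.
elim: k B' {zB hB hn B} => [|k IH] B zB h1 h2.
  rewrite addn0 subrr mulr0 /msum big_seq big1// => z zin.
  by have := lt_le_trans (h1 z zin) (h2 z zin); rewrite addn0 ltxx.
rewrite (msum_split B (fun z => cabs (z - 1) <= 4 ^+ (j + k))).
have e1 := IH _ (zeros_filter (fun z => cabs (z - 1) <= 4 ^+ (j + k)) zB).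
have {}e1 : msum [seq z <- B | cabs (z - 1) <= 4 ^+ (j + k)] <= 16 * K * ((2 ^+ j)^-1 - (2 ^+ (j + k))^-1).
  apply: e1 => z; rewrite mem_filter => /andP[hz zin] //; exact: h1.
have p4 : 0 < 4 ^+ (j + k) :> R by rewrite exprn_gt0.
have e2 : msum [seq z <- B | ~~ (cabs (z - 1) <= 4 ^+ (j + k))] <= K * 8 ^+ (j + k).+1 / (4 ^+ (j + k)) ^+ 2.
  apply: le_trans (msum_le_count p4 _) _.
    by move=> z; rewrite mem_filter -ltNge => /andP[/ltW].
  rewrite ler_wpM2r ?invr_ge0 ?sqr_ge0//; apply: hK; first exact: zeros_filter.
  by move=> z; rewrite mem_filter addnS in h2 * => /andP[_ /h2].
apply: le_trans (lerD e1 e2) _; rewrite addnS.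
have -> : 8 ^+ (j + k).+1 = 8 * 2 ^+ (j + k) * 4 ^+ (j + k) :> R.
  by rewrite exprS -mulrA -exprMn; congr (_ * _ ^+ _); ring.
have -> : 4 ^+ (j + k) = 2 ^+ (j + k) ^+ 2 :> R by rewrite -exprM mulnC exprM; congr (_ ^+ _); ring.
rewrite [2 ^+ (j + k).+1]exprS le_eqVlt; apply/orP; left; apply/eqP; field.
by rewrite !expf_neq0// pnatr_eq0.
Qed.

Lemma msum_bound : exists2 K : R, 0 < K & forall B, zeros B -> msum B <= K.
Proof.
have [K K0 hK] := msum_tail; have [K1 K10 hK1] := xi_count; have [d d0 hd] := zeros_away1.
exists (K + K1 / d ^+ 2); first by rewrite addr_gt0// divr_gt0// exprn_gt0.
move=> B zB; rewrite (msum_split B (fun z => cabs (z - 1) <= 1)) addrC.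
apply: lerD.
  have := hK [seq z <- B | ~~ (cabs (z - 1) <= 1)] 0%N (zeros_filter _ zB); rewrite expr0 divr1; apply.
  by move=> z; rewrite mem_filter -ltNge => /andP[].
apply: le_trans (msum_le_count d0 _) _.
  by move=> z; rewrite mem_filter => /andP[_ /zB.2]; exact: hd.
rewrite ler_wpM2r ?invr_ge0 ?sqr_ge0//.
have := hK1 [seq z <- B | cabs (z - 1) <= 1] 0%N (zeros_filter _ zB); rewrite expr0 mulr1; apply.
by move=> z; rewrite mem_filter => /andP[].
Qed.

End ZeroCounting.

(** * The logarithmic derivative of xi at 0 and 1 *)

Section Hadamard.
Variable R : realType.
Local Notation C := R[i].
Local Notation cj := (@conjc R).
Implicit Types (f q h : C -> C) (s z w a : C) (r p A : R) (B : seq C).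

(** A weak Schwarz lemma: the constant coefficient is 0 and the others are at most [p^-k], so the
    series is bounded by [1/4 + 1/16 + ... = 1/3]. *)
Lemma hol_zero_small f a r p z : hol f a r -> 0 < p < r -> f a = 0 ->
  (forall w, cabs (w - a) < r -> cabs (f w) <= 1) -> cabs (z - a) <= p / 4 -> cabs (f z) <= 1 / 3.
Proof.
move=> hf /andP[p0 pr] fa f1 za; have r0 : 0 < r by exact: lt_trans pr.
have [c hc] := hol_ps r0 hf.
have c0 : c 0%N = 0.
  have h := ps0 c; have := hc 0; rewrite cabs0 addr0 fa => /(_ r0) h2.
  exact: csum_unique h h2.
have ck k : cabs (c k) * p ^+ k <= 1.
  apply: (@ps_coef _ c (fun w => f (a + w)) r) => //; first by rewrite p0 pr.
  by move=> w wp; apply: f1; rewrite addrC addKr wp.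
have zr : cabs (z - a) < r by lra.
have := hc (z - a) zr; rewrite [a + _]addrC subrK /ps => hz.
have {}hz : csum (fun k => c k.+1 * (z - a) ^+ k.+1) (f z).
  have := (csum_shift (fun k => c k * (z - a) ^+ k) (f z)).2.
  by rewrite c0 mul0r add0r; apply.
have geo : 0 <= (1 / 4 : R) < 1 by apply/andP; split; lra.
rewrite (_ : 1 / 3 = 1 / 4 / (1 - 1 / 4)); last by field.
rewrite -(geo_lim (1 / 4) geo); apply: csum_le hz; last exact: geo_cvg.
move=> k; rewrite -exprS cabsM cabsX.
have h4 : cabs (z - a) ^+ k.+1 <= (p / 4) ^+ k.+1 by rewrite lerXn2r ?nnegrE ?divr_ge0// ltW.
apply: le_trans (ler_wpM2l (cabs_ge0 _) h4) _.
rewrite exprMn mulrA -[leRHS]mul1r -[1 / 4]/(1 / 4) div1r.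
by rewrite ler_wpM2r ?exprn_ge0 ?invr_ge0.
Qed.

(** Only Taylor coefficients of index at least 2 enter the difference of the derivatives at [a - 1]
    and [a]; this gains two powers of [p], against one for a single derivative. *)
Lemma deriv_diff f a r p A (l1 l2 : C) : hol f a r -> 2 <= p -> p < r ->
  (forall w, cabs (w - a) <= p -> cabs (f w) <= A) ->
  cdiff f a l1 -> cdiff f (a - 1) l2 -> cabs (l2 - l1) <= 8 * A / p ^+ 2.
Proof.
move=> hf p2 pr fA h1 h2; have p0 : 0 < p by lra.
have r0 : 0 < r by exact: lt_trans pr.
have A0 : 0 <= A by apply: le_trans (cabs_ge0 (f a)) (fA a _); rewrite subrr cabs0 ltW.
have [c hc] := hol_ps r0 hf.
have ck k : cabs (c k) * p ^+ k <= A.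
  apply: (@ps_coef _ c (fun w => f (a + w)) r) => //; first by rewrite p0 pr.
  by move=> w wp; apply: fA; rewrite addrC addKr wp.
have e1 : l1 = c 1%N.
  have [|l hl hd] := ps_cdiff (z := 0) hc; first by rewrite cabs0.
  have -> : l1 = l.
    by apply: cdiff_unique hd; apply/cdiff_shift; rewrite addr0.
  by have := csum_unique hl (ps0 _); rewrite mul1r.
have [|l hl hd] := ps_cdiff (z := -1) hc; first by rewrite cabsN cabs1; lra.
have e2 : l2 = l by apply: cdiff_unique hd; apply/cdiff_shift.
have hz : csum (fun k => k.+2%:R * c k.+2 * (-1) ^+ k.+1) (l2 - l1).
  have := (csum_shift (fun k => k.+1%:R * c k.+1 * (-1) ^+ k) (l2 - l1)).2.
  by rewrite expr0 mulr1 mul1r e1 [c 1%N + _]addrC subrK e2; apply.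
have geo : 0 <= (3 / 4 : R) < 1 by apply/andP; split; lra.
have -> : 8 * A / p ^+ 2 = (2 * A / p ^+ 2) / (1 - 3 / 4) by field; rewrite gt_eqF.
rewrite -(geo_lim _ geo); apply: csum_le hz; last exact: geo_cvg.
move=> k; rewrite !cabsM cabsX cabsN cabs1 expr1n mulr1 cabs_nat.
have pk : 0 < p ^+ k by rewrite exprn_gt0.
have p20 : 0 < p ^+ 2 by rewrite exprn_gt0.
have hck : cabs (c k.+2) <= A / p ^+ 2 * (1 / 2) ^+ k.
  have := ck k.+2; rewrite -ler_pdivlMr ?exprn_gt0// => h; apply: le_trans h _.
  rewrite -[X in p ^+ X]addn2 exprD [p ^+ k * _]mulrC invfM mulrA ler_wpM2l//.
    by apply: divr_ge0; [exact: A0|exact: ltW].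
  by rewrite exprMn expr1n mul1r exprVn lef_pV2 ?posrE ?exprn_gt0// lerXn2r ?nnegrE//; lra.
have hk : k.+2%:R <= 2 * (3 / 2) ^+ k :> R.
  elim: k {hck pk} => [|k IH]; first by rewrite expr0; lra.
  have k0 : 0 <= k%:R :> R by [].
  rewrite exprS -natr1; move: IH; rewrite -[k.+2%:R]natr1 -[k.+1%:R]natr1; lra.
apply: le_trans (ler_pM (ler0n _ _) (cabs_ge0 _) hk hck) _.
rewrite le_eqVlt; apply/orP; left; apply/eqP.
rewrite (_ : 3 / 4 = (3 / 2) * (1 / 2)); last by field.
by rewrite (exprMn _ (3 / 2)); ring.
Qed.

(* Borel-Caratheodory for a logarithm of [q], through [h / (2 A - h)]. *)
Lemma log_deriv_diff q r A (l1 l0 : C) : 32 <= r -> 0 < A -> hol q 1 r -> q 1 = 1 ->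
  (forall s, cabs (s - 1) < r -> q s != 0 /\ cabs (q s) <= expR A) ->
  cdiff q 1 l1 -> cdiff q 0 l0 -> cabs (l0 / q 0 - l1) <= 8 * A / (r / 8) ^+ 2.
Proof.
move=> r32 A0 hq q1 qb h1 h0; have r0 : 0 < r by lra.
pose D s := cderiv q s / q s.
have hD : hol D 1 r.
  move=> s sr; have [a ha] := hol_deriv hq sr; have [b hb] := hq s sr.
  by eexists; apply: cdiffM; [exact: ha|apply: cdiffV; [exact: (qb s sr).1|exact: hb]].
have [h h10 hp] := hol_primitive r0 hD.
(* [q e^(-h)] has derivative 0, so [h] is a logarithm of [q] that vanishes at 1. *)
have eh s : cabs (s - 1) < r -> q s = cexp (h s).
  move=> sr; have : q s * cexp (- h s) = q 1 * cexp (- h 1).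
    apply: (@cdiff0_const _ (fun s => q s * cexp (- h s)) 1 r) => // w wr.
    have [b hb] := hq w wr; have [qw _] := qb w wr.
    have := cdiffM hb (cdiff_comp (cdiffN (hp w wr)) (cdiff_cexp _)).
    apply: cdiff_ext => //; rewrite /D (cderiv_eq hb) /=; move: (cexp _) => E.
    by rewrite mulrN mulrN mulrCA [q w * _]mulrC divfK// addNr.
  by rewrite q1 h10 oppr0 cexp0 mulr1 cexpN => /divr1_eq.
have Reh s : cabs (s - 1) < r -> complex.Re (h s) <= A.
  by move=> sr; have := (qb s sr).2; rewrite eh// cabs_cexp ler_expR.
pose AC : C := (2 * A)%:C.
(* [Re h <= A] means that [h] is at least as close to 0 as to [2 A]. *)
have den s : cabs (s - 1) < r -> cabs (h s) <= cabs (AC - h s) /\ AC - h s != 0.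
  move=> sr; have hr := Reh s sr; split.
    rewrite -(@ler_pXn2r _ 2) ?nnegrE// !cabs_sqr ReB ImB /AC /= sub0r sqrrN lerD2r.
    move: (complex.Re _) hr => x hr; rewrite !expr2.
    have : 0 <= A * (A - x) by rewrite mulr_ge0 ?subr_ge0 ?(ltW A0).
    lra.
  apply/eqP => /(congr1 (@complex.Re R)); rewrite ReB /AC /= => h2; lra.
pose phi s := h s / (AC - h s).
have hphi : hol phi 1 r.
  move=> s sr; eexists; apply: cdiffM; first exact: hp.
  apply: cdiffV; first exact: (den s sr).2.
  by apply: cdiffB; [exact: cdiff_cst|exact: hp].
have phi1 s : cabs (s - 1) < r -> cabs (phi s) <= 1.
  move=> sr; have [d1 d2] := den s sr; rewrite /phi cabsM cabsV ler_pdivrMr ?mul1r//.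
  by rewrite cabs_gt0.
(* With [|phi| <= 1/3] the relation [h = phi (2 A - h)] gives [|h| <= (2 A + |h|) / 3], that is
   [|h| <= A]. *)
have hA s : cabs (s - 1) <= r / 8 -> cabs (h s) <= A.
  move=> sr; have sr' : cabs (s - 1) < r by lra.
  have r2 : 0 < r / 2 < r by apply/andP; split; lra.
  have := @hol_zero_small phi 1 r (r / 2) s hphi r2.
  rewrite {1}/phi h10 mul0r => /(_ erefl phi1) H.
  have {}H : cabs (phi s) <= 1 / 3 by apply: H; lra.
  have E : h s = phi s * (AC - h s) by rewrite /phi divfK// (den s sr').2.
  have h2 : cabs (AC - h s) <= 2 * A + cabs (h s).
    by apply: le_trans (cabsB _ _) _; rewrite cabs_real gtr0_norm ?mulr_gt0.
  have : cabs (h s) <= 1 / 3 * (2 * A + cabs (h s)).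
    by rewrite {1}E cabsM; apply: ler_pM.
  lra.
have hh : hol h 1 r by move=> s /hp hs; exists (D s).
have c1 : cdiff h 1 l1.
  have := hp 1; rewrite subrr cabs0 => /(_ r0).
  by rewrite /D q1 divr1 (cderiv_eq h1).
have c0 : cdiff h (1 - 1) (l0 / q 0).
  rewrite subrr; have := hp 0; rewrite sub0r cabsN cabs1 => H.
  by rewrite -(cderiv_eq h0); apply: H; lra.
have h3 : 2 <= r / 8 by lra.
have h4 : r / 8 < r by lra.
exact: deriv_diff hh h3 h4 hA c1 c0.
Qed.

Lemma zprod_cdiff B s : zeros B -> s \notin B ->
  cdiff (zprod B) s (zprod B s * \sum_(z <- B) (zmult z)%:R / (s - z)).
Proof.
elim: B => [|z B IH] zB sB.
  apply: (@cdiff_ext _ (fun=> 1) _ _ 0); last exact: cdiff_cst.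
    by move=> w; rewrite /zprod big_nil.
  by rewrite big_nil mulr0.
have zB' : zeros B.
  by split=> [|w wB]; [have := zB.1; rewrite /= => /andP[]|apply: zB.2; rewrite in_cons wB orbT].
have z0 : 1 - z != 0 by apply: zero_neq1; apply: zB.2; rewrite in_cons eqxx.
move: sB; rewrite in_cons negb_or => /andP[sz sB].
have sz0 : s - z != 0 by rewrite subr_eq0.
have d1 : cdiff (fun w => (w - z) / (1 - z)) s (1 / (1 - z)).
  have := cdiffM (cdiffB (cdiff_id s) (cdiff_cst z s)) (cdiff_cst (1 - z)^-1 s).
  by apply: cdiff_ext => //; rewrite mulr0 add0r subr0 mulrC.
have := cdiffM (cdiff_comp d1 (cdiffX (zmult z) _)) (IH zB' sB).
apply: cdiff_ext => [w|]; first by rewrite /zprod big_cons.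
rewrite /zprod !big_cons /=; case: (zmult z) => [|m].
  by rewrite expr0 !mul0r !mul1r mulr0 addr0 add0r.
rewrite [m.+1.-1]/= -mulr_natr exprS; field.
by rewrite z0 sz0.
Qed.

Lemma perm_invol B (f : C -> C) : involutive f -> uniq B -> (forall z, z \in B -> f z \in B) ->
  perm_eq [seq f z | z <- B] B.
Proof.
move=> fi uB fB; have fj := inv_inj fi; apply: uniq_perm => //; first by rewrite map_inj_uniq.
move=> z; apply/mapP/idP => [[w wB ->]|zB]; first exact: fB.
by exists (f z); [exact: fB|rewrite fi].
Qed.

(** [G] receives the multiplicity as a separate argument because that is invariant under
    [z |-> 1 - z], whereas the zero is not. *)
Lemma sum_zeros_sym (V : nmodType) B (G : nat -> C -> V) : zeros B ->
  (forall z, z \in B -> 1 - z \in B) ->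
  \sum_(z <- B) G (zmult z) (1 - z) = \sum_(z <- B) G (zmult z) z.
Proof.
move=> zB symB.
have fi : involutive (fun z : C => 1 - z) by move=> z; rewrite subKr.
rewrite -[RHS](perm_big _ (perm_invol fi zB.1 symB)) big_map.
by apply: eq_big_seq => z /zB.2 z0; rewrite zmult_sym.
Qed.

(** The logarithmic derivative of [xi] is [k] at 1 and [- k] at 0, and the sums of [1 / (1 - z)] and
    [1 / z] over the symmetric list [B] agree. Hence twice [S - k] is the difference of the
    logarithmic derivatives of the quotient, of size [8^j / 16^j]. *)
Lemma zeros_sum : exists (k : R) (K : R), [/\ 0 < k, 0 < K &
  forall (Z : nat -> seq C), (forall j, uniq (Z j) /\
    forall z, (z \in Z j) <-> [/\ xi z = 0, cabs (z - 1) <= 4 ^+ j & cabs z <= 4 ^+ j]) ->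
  forall j, (3 <= j)%N -> cabs (\sum_(z <- Z j) (zmult z)%:R / z - k%:C) <= K / 2 ^+ j].
Proof.
have [k k0 dk] := xi_deriv1 R; have [c c0 hc] := xi_growth R.
exists k, (4 * (16 * 16) * (1 + 8 * c)); split=> //; first by rewrite !mulr_gt0// addr_gt0// mulr_gt0.
move=> Z hZ j j3; have [uB hB] := hZ j; set B := Z j in uB hB *.
set r : R := 4 ^+ j.
have r64 : 64 <= r.
  by rewrite (_ : 64 = 4 ^+ 3 :> R) ?ler_weXn2l//; [lra|rewrite !exprS expr0; lra].
have r0 : 0 < r by lra.
have zB : zeros B by split=> // z /hB[].
have [|q [qe q1 qB qE qM]] := xi_quotient r0 zB; first by move=> z /hB[].
(* The exponent [j + 1] belongs to the circle of radius [4 r]; the added 1 pays for the factor 2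
   lost through [hol_est], as [2 <= e]. *)
pose A := 1 + c * 8 ^+ j.+1.
have A0 : 0 < A by rewrite addr_gt0// mulr_gt0// exprn_gt0.
(* A zero of [q] in this disc would be a zero of [xi] with [|s - 1|] and [|s|] at most [4^j], hence
   a member of [B], where [q] does not vanish. *)
have qb s : cabs (s - 1) < r / 2 -> q s != 0 /\ cabs (q s) <= expR A.
  move=> sr; split.
    apply/eqP => qs; have x0 : xi s = 0 by rewrite qE qs mulr0.
    have sB : s \in B.
      apply/hB; split=> //; rewrite -/r; first by lra.
      by rewrite -[s](subrK 1); apply: le_trans (cabsD _ _) _; rewrite cabs1; lra.
    by move/eqP: qs; rewrite (negPf (qB s sB)).
  have := @hol_est _ q 1 (4 * r + 1) (4 * r) (expR (c * 8 ^+ j.+1)) s.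
  have h4 : 0 < 4 * r < 4 * r + 1 by apply/andP; split; lra.
  move=> /(_ (entire_hol qe) h4) H.
  have {}H : cabs (q s) <= expR (c * 8 ^+ j.+1) / (1 - cabs (s - 1) / (4 * r)).
    apply: H; last by lra.
    move=> w hw; have h1 := qM w hw.
    have h2 : cabs (xi w) <= expR (c * 8 ^+ j.+1) by apply: hc; rewrite hw exprS.
    apply: le_trans (le_trans h1 h2); rewrite ler_peMl//.
    by rewrite exprn_ege1// ler1n.
  apply: le_trans H _; rewrite /A expRD mulrC ler_wpM2r ?expR_ge0//.
  have h5 : cabs (s - 1) / (4 * r) <= 1 / 2 by rewrite ler_pdivrMr; lra.
  have e2 : 2 <= expR 1 :> R by have := expR_ge1Dx (1 : R); lra.
  apply: le_trans e2; rewrite -[leRHS]invrK lef_pV2 ?posrE; lra.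
have [l1 hl1] := qe 1; have [l0 hl0] := qe 0.
have n1 : 1 \notin B by apply/negP => /hB[] x1 _ _; move/eqP: x1; rewrite xi1 oner_eq0.
have xi0 : xi (0 : C) = 1 by rewrite -(subrr 1) xi_sym xi1.
have n0 : 0 \notin B by apply/negP => /hB[] x1 _ _; move/eqP: x1; rewrite xi0 oner_eq0.
have p1 : zprod B 1 = 1.
  by rewrite /zprod big_seq big1// => z /zB.2 z0; rewrite divff ?expr1n// zero_neq1.
have E1 : k%:C = \sum_(z <- B) (zmult z)%:R / (1 - z) + l1.
  apply: cdiff_unique dk _; have := cdiffM (zprod_cdiff zB n1) hl1.
  by apply: cdiff_ext => //; rewrite p1 q1 !mul1r addrC.
have dk0 : cdiff (@xi R) 0 (- k%:C).
  have d1 : cdiff (fun s : C => 1 - s) 0 (0 - 1) by apply: cdiffB; [exact: cdiff_cst|exact: cdiff_id].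
  have := @cdiff_comp _ _ (@xi R) 0 _ (k%:C) d1; rewrite subr0 => /(_ dk).
  by apply: cdiff_ext => [w|]; [rewrite /= xi_sym|rewrite sub0r mulrN1].
have q0 : zprod B 0 * q 0 = 1 by rewrite -qE.
have q00 : q 0 != 0 by apply/eqP => h; move/eqP: q0; rewrite h mulr0 eq_sym oner_eq0.
have E0 : - k%:C = \sum_(z <- B) (zmult z)%:R / (0 - z) + l0 / q 0.
  apply: cdiff_unique dk0 _; have := cdiffM (zprod_cdiff zB n0) hl0.
  apply: cdiff_ext => //.
  have -> : zprod B 0 = (q 0)^-1 by apply: (mulIf q00); rewrite q0 mulVf.
  by field.
have symB z : z \in B -> 1 - z \in B.
  move/hB => [x0 h1 h2]; apply/hB; split; first exact: xi_zero_sym.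
    by rewrite addrAC subrr sub0r cabsN.
  by rewrite cabs_subC.
have S1 : \sum_(z <- B) (zmult z)%:R / (1 - z) = \sum_(z <- B) (zmult z)%:R / z.
  exact: (sum_zeros_sym (fun m z => m%:R / z) zB symB).
have S0 : \sum_(z <- B) (zmult z)%:R / (0 - z) = - \sum_(z <- B) (zmult z)%:R / z.
  by rewrite -sumrN; apply: eq_bigr => z _; rewrite sub0r invrN mulrN.
rewrite S1 in E1; rewrite S0 in E0; set S := \sum_(z <- B) (zmult z)%:R / z in E1 E0 *.
have E : S - k%:C = (l0 / q 0 - l1) / 2.
  have -> : l1 = k%:C - S by rewrite E1 addrC addKr.
  have -> : l0 / q 0 = - k%:C + S by rewrite E0 addrAC addNr add0r.
  by field.
have r2 : 32 <= r / 2 by lra.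
have := log_deriv_diff r2 A0 (entire_hol qe) q1 qb hl1 hl0.
rewrite E cabs_half => H.
have pj : 0 < 2 ^+ j :> R by rewrite exprn_gt0.
have p8 : 1 <= 8 ^+ j :> R by rewrite exprn_ege1//; lra.
have hA : A <= (1 + 8 * c) * 8 ^+ j by rewrite /A exprS mulrDl mul1r; move: (8 ^+ j) p8 => x x1; lra.
have e8 : 8 ^+ j * 2 ^+ j = r ^+ 2.
  by rewrite /r -exprMn expr2 -exprMn; congr (_ ^+ _); ring.
have h6 : 8 * A / (r / 2 / 8) ^+ 2 / 2 <= 4 * (16 * 16) * (1 + 8 * c) / 2 ^+ j.
  have -> : 8 * A / (r / 2 / 8) ^+ 2 / 2 = 4 * (16 * 16) * A / r ^+ 2 by field; rewrite gt_eqF.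
  have -> : 4 * (16 * 16) * (1 + 8 * c) / 2 ^+ j = 4 * (16 * 16) * ((1 + 8 * c) * 8 ^+ j) / r ^+ 2.
    by rewrite -e8; field; rewrite !gt_eqF// (lt_le_trans ltr01).
  by rewrite ler_wpM2r ?invr_ge0 ?sqr_ge0// ler_wpM2l.
by apply: le_trans h6; rewrite ler_wpM2r ?invr_ge0.
Qed.

End Hadamard.

(** * The sum over the zeros *)

Section ZeroSum.
Variable R : realType.
Local Notation C := R[i].
Local Notation cj := (@conjc R).
Implicit Types (z w v s : C) (a x t : R).

Lemma cos_sin_carg w : 0 < complex.Re w ->
  [/\ cabs w * cos (carg w) = complex.Re w, cabs w * sin (carg w) = complex.Im w &
      `|carg w| <= pi / 2].
Proof.
case: w => p q /= p0; set w : C := p +i* q.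
have w0 : 0 < cabs w by rewrite cabs_gt0 eq_complex/= negb_and gt_eqF.
have wp : cabs w != 0 by rewrite gt_eqF.
pose c := p / cabs w; have c0 : 0 < c by rewrite divr_gt0.
have pw : p <= cabs w by apply: le_trans (ler_norm _) (cabs_Re w).
have c1 : c <= 1 by rewrite ler_pdivrMr// mul1r.
have cI : -1 <= c <= 1 by rewrite c1 andbT; lra.
have cs : cos (acos c) = c by exact: acosK.
have s2 : cabs w * sin (acos c) = `|q|.
  rewrite sin_acos// -[X in X * _](ger0_norm (cabs_ge0 w)) -sqrtr_sqr -sqrtrM ?sqr_ge0// -sqrtr_sqr.
  congr Num.sqrt; rewrite mulrBr mulr1 /c expr_div_n mulrCA divff ?mulr1 ?expf_neq0//.
  by rewrite cabs_sqr /= addrC addKr.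
have th : 0 <= acos c <= pi / 2.
  rewrite acos_ge0//= leNgt; apply/negP => h.
  have p0' := @pi_gt0 R.
  have := @ltr_cos R (pi / 2) (acos c); rewrite cs cos_pihalf h.
  rewrite !in_itv/= acos_ge0// acos_lepi// => H.
  have : c < 0 by rewrite H//; apply/andP; split; lra.
  by rewrite ltNge (ltW c0).
have cE : carg w = if 0 <= q then acos c else - acos c by [].
have h1 : cabs w * cos (acos c) = p by rewrite cs /c mulrC divfK.
rewrite cE; case: ifP => q0; rewrite ?cosN ?sinN ?normrN.
  split=> //; first by rewrite s2 ger0_norm.
  by rewrite ger0_norm; case/andP: th.
split=> //; last by rewrite ger0_norm; case/andP: th.
by rewrite mulrN s2 ltr0_norm ?opprK// ltNge q0.
Qed.

Lemma clogK w : 0 < complex.Re w -> cexp (clog w) = w.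
Proof.
move=> w0; have [h1 h2 _] := cos_sin_carg w0.
have w1 : 0 < cabs w by rewrite cabs_gt0; apply: contraTneq w0 => ->; rewrite ltxx.
rewrite /cexp /clog /= lnK ?posrE// h1 h2; by case: (w).
Qed.

Lemma ln_leB1 x : 0 < x -> ln x <= x - 1.
Proof.
move=> x0; have := @le_ln1Dx R (x - 1); rewrite [1 + _]addrC subrK; apply.
lra.
Qed.

(** The argument is defined by [acos]; it is bounded through [sin_ge_lin], because [|w|] times the
    sine of [|arg w|] is [|Im v|]. The modulus contributes [2 |v|] and the argument [12 |v|]. *)
Lemma clog_small v : cabs v <= 1 / 4 -> cabs (clog (1 + v)) <= 16 * cabs v.
Proof.
move=> v4; set w := 1 + v.
have vR := le_trans (cabs_Re v) v4.
have w0 : 0 < complex.Re w.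
  by rewrite /w ReD /=; move: vR; rewrite ler_norml => /andP[]; lra.
have [h1 h2 h3] := cos_sin_carg w0.
have up : cabs w <= 1 + cabs v by apply: le_trans (cabsD _ _) _; rewrite cabs1.
have lo : 1 - cabs v <= cabs w by have := cabs_lerB 1 (- v); rewrite cabs1 cabsN opprK.
have v0 := cabs_ge0 v.
have wp : 0 < cabs w by lra.
have ln1 : `|ln (cabs w)| <= 2 * cabs v.
  rewrite ler_norml; apply/andP; split; last first.
    by have := ln_leB1 wp; lra.
  rewrite lerNl -lnV ?posrE//.
  have iw : (cabs w)^-1 - 1 <= 2 * cabs v.
    rewrite lerBlDl -[leLHS]mul1r ler_pdivrMr//.
    have := ler_wpM2l (_ : 0 <= 1 + 2 * cabs v) lo => /(_ ltac:(lra)).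
    by nra.
  have i0 : 0 < (cabs w)^-1 by rewrite invr_gt0.
  by have := ln_leB1 i0; lra.
have Im1 : `|carg w| <= 12 * cabs v.
  have hs : `|carg w| / 8 <= sin `|carg w| by apply: sin_ge_lin; rewrite normr_ge0.
  have sE : cabs w * sin `|carg w| <= cabs v.
    have -> : cabs w * sin `|carg w| <= cabs v = (cabs w * `|sin (carg w)| <= cabs v).
      congr (_ * _ <= _); have [cp|cn] := leP 0 (carg w).
        rewrite !ger0_norm//; have := hs; rewrite (ger0_norm cp); apply: le_trans.
        by rewrite divr_ge0.
      rewrite (ltr0_norm cn) sinN in hs *; rewrite ltr0_norm// -oppr_gt0.
      by apply: lt_le_trans hs; rewrite divr_gt0// oppr_gt0.
    rewrite -[X in X * _](ger0_norm (cabs_ge0 w)) -normrM h2 /w ImD/= add0r; exact: cabs_Im.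
  have := ler_wpM2l (ltW wp) hs.
  have : 3 / 4 * `|carg w| <= cabs w * `|carg w| by rewrite ler_wpM2r//; lra.
  lra.
by apply: le_trans (cabs_ReIm _) _; rewrite /clog /=; lra.
Qed.

Lemma clog_conj w : 0 < complex.Re w -> clog (cj w) = cj (clog w).
Proof.
case: w => p q /= p0; have cE := cabs_conj (p +i* q : C).
rewrite /= in cE; rewrite /clog /carg /= cE.
have [q0|q0|q0] := ltgtP q 0.
- by rewrite oppr_ge0 (ltW q0) opprK.
- by rewrite oppr_ge0 leNgt q0.
- rewrite q0 oppr0 lexx; have -> : cabs (p +i* 0 : C) = p.
    by rewrite (_ : p +i* 0 = p%:C)// cabs_real gtr0_norm.
  by rewrite divff ?gt_eqF// acos1 oppr0.
Qed.

Definition term x t z : C := 1 - cpow (z / (z - t%:C)) x%:C.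

(** With [u = t / z] one has [v = u / (1 - u)] and [v - u = u^2 / (1 - u)], where
    [|1 - u| >= 1 / 2]. *)
Lemma term_arg t z : 0 < t -> 64 * t <= cabs z ->
  exists2 v : C, z / (z - t%:C) = 1 + v & cabs v <= 2 * (t / cabs z) /\
    cabs (v - t%:C / z) <= 2 * (t / cabs z) ^+ 2.
Proof.
move=> t0 tz; have z0 : 0 < cabs z by apply: lt_le_trans tz; rewrite mulr_gt0.
have zn : z != 0 by rewrite -cabs_gt0.
have ct : cabs (t%:C / z) = t / cabs z by rewrite cabsM cabsV cabs_real gtr0_norm.
have q1 : t / cabs z <= 1 / 64 by rewrite ler_pdivrMr//; lra.
have q0 : 0 <= t / cabs z by rewrite divr_ge0 ?ltW.
have lo : 1 / 2 <= cabs (1 - t%:C / z).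
  by have := cabs_lerB 1 (t%:C / z); rewrite cabs1 ct; lra.
have dn : 1 - t%:C / z != 0 by rewrite -cabs_gt0; lra.
have dz : z - t%:C != 0.
  have -> : z - t%:C = z * (1 - t%:C / z) by rewrite mulrBr mulr1 mulrCA divff ?mulr1.
  by rewrite mulf_neq0.
have i2 : (cabs (1 - t%:C / z))^-1 <= 2 by rewrite -[leRHS]invrK lef_pV2 ?posrE; lra.
exists (t%:C / z / (1 - t%:C / z)); first by field; rewrite zn dz.
rewrite cabsM ct cabsV; split; first by rewrite mulrC ler_wpM2r.
have -> : t%:C / z / (1 - t%:C / z) - t%:C / z = (t%:C / z) ^+ 2 / (1 - t%:C / z).
  by field; rewrite zn dz.
by rewrite cabsM cabsX ct cabsV mulrC ler_wpM2r// sqr_ge0.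
Qed.

(** Collects the errors in [term_est]: [4 * 32^2] from the exponential, as much from the logarithm,
    and 2 from replacing [v] by [t / z]. The 32 is twice the constant of [clog_small]. *)
Definition Cst : R := 8 * (32 * 32) + 2.

(** [64 x t <= |z|] gives [x |log (1 + v)| <= 1/2], the range of [cexp_quad]; [x > 1] lets errors of
    size [x u^2] be absorbed into [(x u)^2]. *)
Lemma term_est x t z : 1 < x -> 0 < t -> 64 * (x * t) <= cabs z ->
  cabs (term x t z + (x * t)%:C / z) <= Cst * (x * t) ^+ 2 / cabs z ^+ 2.
Proof.
move=> x1 t0 az; have ta : t <= x * t by rewrite ler_peMl ?ltW.
have a0 : 0 < x * t by rewrite mulr_gt0//; lra.
have z0 : 0 < cabs z by apply: lt_le_trans az; rewrite mulr_gt0.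
have [|v vE [v1 v2]] := @term_arg t z t0; first by lra.
set u := t / cabs z in v1 v2.
have u0 : 0 <= u by rewrite divr_ge0 ?ltW.
have xu : x * u <= 1 / 64 by rewrite /u mulrA ler_pdivrMr//; lra.
have ux : u <= x * u by rewrite ler_peMl // ltW.
have v4 : cabs v <= 1 / 4 by lra.
have w0 : 0 < complex.Re (1 + v).
  rewrite ReD /=; have := le_trans (cabs_Re v) v4; rewrite ler_norml => /andP[]; lra.
have wn : 1 + v != 0 by apply: contraTneq w0 => ->; rewrite ltxx.
set y := clog (1 + v).
have y1 : cabs y <= 32 * u by have := clog_small v4; rewrite -/y; lra.
(* The logarithm is linearised through the exponential: [e^y - 1 - y] equals [v - y]. *)
have y2 : cabs (y - v) <= 4 * (32 * u) ^+ 2.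
  have yh : cabs y <= 1 / 2 by lra.
  have := cexp_quad yh; rewrite (clogK w0) (_ : 1 + v - 1 - y = v - y); last by ring.
  rewrite cabs_subC => h; apply: le_trans h _; rewrite ler_wpM2l// lerXn2r ?nnegrE//.
  by rewrite mulr_ge0.
have x0 : 0 <= x by lra.
have cx (s : C) : cabs (x%:C * s) = x * cabs s by rewrite cabsM cabs_real ger0_norm.
have xy : cabs (x%:C * y) <= 32 * (x * u) by rewrite cx; have := ler_wpM2l x0 y1; lra.
have xyh : cabs (x%:C * y) <= 1 / 2 by lra.
have E3 := cexp_quad xyh.
have zn : z != 0 by rewrite -cabs_gt0.
have -> : term x t z + (x * t)%:C / z =
    - ((cexp (x%:C * y) - 1 - x%:C * y) + x%:C * (y - v) + x%:C * (v - t%:C / z)).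
  rewrite /term vE /cpow (negPf wn) -/y rmorphM /=; ring.
rewrite cabsN; apply: le_trans (cabsD _ _) _; apply: le_trans (lerD (cabsD _ _) (lexx _)) _.
rewrite !cx.
have -> : Cst * (x * t) ^+ 2 / cabs z ^+ 2 = Cst * (x * u) ^+ 2.
  by rewrite /u; field; rewrite gt_eqF.
clearbody u.
have s1 : 4 * cabs (x%:C * y) ^+ 2 <= 4 * (32 * (x * u)) ^+ 2.
  by rewrite ler_wpM2l// lerXn2r ?nnegrE// mulr_ge0// mulr_ge0.
have xu2 : x * u ^+ 2 <= (x * u) ^+ 2.
  rewrite [leRHS](_ : _ = x * (x * u ^+ 2)); last by ring.
  by rewrite ler_peMl ?(ltW x1)// mulr_ge0// sqr_ge0.
have s2 : x * cabs (y - v) <= x * (4 * (32 * u) ^+ 2) by rewrite ler_wpM2l.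
have s3 : x * cabs (v - t%:C / z) <= x * (2 * u ^+ 2) by rewrite ler_wpM2l.
apply: le_trans (lerD (lerD (le_trans E3 s1) s2) s3) _.
have e1 : x * (4 * (32 * u) ^+ 2) = 4 * (32 * 32) * (x * u ^+ 2) by ring.
have e2 : 4 * (32 * (x * u)) ^+ 2 = 4 * (32 * 32) * (x * u) ^+ 2 by ring.
have e3 : x * (2 * u ^+ 2) = 2 * (x * u ^+ 2) by ring.
rewrite e1 e2 e3 /Cst.
by move: xu2; clear; move: (x * u ^+ 2) ((x * u) ^+ 2) => Q P; lra.
Qed.

(** The base of the power lies in the right half-plane, off the branch cut, where the principal
    power with real exponent commutes with conjugation. *)
Lemma term_conj x t z : 0 < t -> 64 * t <= cabs z -> term x t (cj z) = cj (term x t z).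
Proof.
move=> t0 tz; have [v vE [v1 _]] := term_arg t0 tz.
have z0 : 0 < cabs z by apply: lt_le_trans tz; rewrite mulr_gt0.
have v4 : cabs v <= 1 / 4.
  by apply: le_trans v1 _; rewrite mulrA ler_pdivrMr//; lra.
have w0 : 0 < complex.Re (1 + v).
  rewrite ReD /=; have := le_trans (cabs_Re v) v4; rewrite ler_norml => /andP[]; lra.
have wn : 1 + v != 0 by apply: contraTneq w0 => ->; rewrite ltxx.
have cV (s : C) : cj s^-1 = (cj s)^-1 by exact: fmorphV.
have E : cj z / (cj z - t%:C) = cj (1 + v) by rewrite -vE cjM cV cjB cj_real.
have wn' : cj (1 + v) != 0 by rewrite -cabs_eq0 cabs_conj cabs_eq0.
rewrite /term E vE /cpow (negPf wn) (negPf wn') clog_conj//.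
by rewrite cjB cj1 -cexp_conj cjM cj_real.
Qed.

Definition tsum x t (B : seq C) : C := \sum_(z <- B) term x t z *+ zmult z.

(* Pairing [z] with [1 - z] turns [1 / z] into [1 / (z (1 - z))]. *)
Lemma pair_sum (B : seq C) : zeros B -> (forall z, z \in B -> 1 - z \in B) ->
  cabs (\sum_(z <- B) (zmult z)%:R / z) <= msum B /\
  \sum_(z <- B) (zmult z)%:R / cabs z ^+ 2 = msum B.
Proof.
move=> zB sB.
have S2 : \sum_(z <- B) (zmult z)%:R / cabs z ^+ 2 = msum B.
  rewrite -(sum_zeros_sym (fun m z => m%:R / cabs z ^+ 2) zB sB).
  by apply: eq_bigr => z _; rewrite cabs_subC.
split=> //; have S1 := sum_zeros_sym (fun m z => m%:R / z) zB sB.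
have -> : \sum_(z <- B) (zmult z)%:R / z = \sum_(z <- B) (zmult z)%:R / (2 * (z * (1 - z))) :> C.
  apply: (mulIf (_ : 2 != 0)); first by rewrite pnatr_eq0.
  rewrite mulr_natr mulr2n -{1}S1 -big_split/= mulr_suml; apply: eq_big_seq => z /zB.2 z0.
  have z1 := zero_neq1 z0; have z2 := zero_neq1 (xi_zero_sym z0).
  by rewrite subKr in z2; field; rewrite z1 z2.
apply: le_trans (cabs_sum _ _ _) _.
(* [p q <= (p^2 + q^2) / 2] for [p = 1 / |z|] and [q = 1 / |1 - z|], with a factor 2 to spare; by
   symmetry both squares sum to [msum B]. *)
apply: (@le_trans _ _ (\sum_(z <- B) ((zmult z)%:R / cabs z ^+ 2 + (zmult z)%:R / cabs (z - 1) ^+ 2) / 2)).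
  rewrite big_seq [leRHS]big_seq; apply: ler_sum => z /zB.2 z0.
  have z1 := zero_neq1 z0; have z2 := zero_neq1 (xi_zero_sym z0); rewrite subKr in z2.
  rewrite cabsM cabs_nat cabsV !cabsM (cabs_nat 2) [in leRHS]cabs_subC -mulrDr -mulrA ler_wpM2l//.
  have p1 : 0 < cabs z by rewrite cabs_gt0.
  have p2 : 0 < cabs (1 - z) by rewrite cabs_gt0.
  have := sqr_ge0 ((cabs z)^-1 - (cabs (1 - z))^-1).
  rewrite -2!exprVn.
  have -> : (2 * (cabs z * cabs (1 - z)))^-1 = (cabs z)^-1 * (cabs (1 - z))^-1 / 2.
    by field; rewrite !gt_eqF.
  have : 0 <= (cabs z)^-1 * (cabs (1 - z))^-1 by rewrite mulr_ge0 ?invr_ge0.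
  move: (cabs z)^-1 (cabs (1 - z))^-1 => p q; clear; rewrite sqrrB !expr2; lra.
rewrite -mulr_suml big_split/= S2 -/(msum B); move: (msum B) => m; lra.
Qed.

Lemma tsum_split x t (B : seq C) : 1 < x -> 0 < t -> zeros B -> (forall z, z \in B -> 1 - z \in B) ->
  (forall z, z \in B -> 64 * (x * t) <= cabs z) ->
  cabs (tsum x t B + (x * t)%:C * \sum_(z <- B) (zmult z)%:R / z) <= Cst * (x * t) ^+ 2 * msum B.
Proof.
move=> x1 t0 zB sB hB; have [_ <-] := pair_sum zB sB.
rewrite /tsum mulr_sumr -big_split/= mulr_sumr.
apply: le_trans (cabs_sum _ _ _) _; rewrite big_seq [leRHS]big_seq; apply: ler_sum => z /hB hz.
rewrite (_ : term x t z *+ zmult z + _ = (zmult z)%:R * (term x t z + (x * t)%:C / z)); last first.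
  by rewrite -mulr_natl; ring.
rewrite cabsM cabs_nat mulrCA ler_wpM2l//.
exact: term_est.
Qed.

Lemma tsum_bound x t (B : seq C) : 1 < x -> 0 < t -> zeros B -> (forall z, z \in B -> 1 - z \in B) ->
  (forall z, z \in B -> 64 * (x * t) <= cabs z) ->
  cabs (tsum x t B) <= (Cst * (x * t) ^+ 2 + x * t) * msum B.
Proof.
move=> x1 t0 zB sB hB; have h := tsum_split x1 t0 zB sB hB; have [h2 _] := pair_sum zB sB.
have a0 : 0 <= x * t by rewrite mulr_ge0 ?ltW// (lt_trans ltr01).
rewrite -[tsum x t B](addrK ((x * t)%:C * \sum_(z <- B) (zmult z)%:R / z)).
apply: le_trans (cabsB _ _) _; rewrite mulrDl; apply: lerD => //.
by rewrite cabsM cabs_real ger0_norm// ler_wpM2l.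
Qed.

End ZeroSum.

(** * Convergence along paired sets and the sign of the limit *)

Section Limit.
Variable R : realType.
Local Notation C := R[i].
Local Notation cj := (@conjc R).
Implicit Types (z w : C) (x t : R).

Let paired0 : paired (fset0 : {fset R[i]^o}).
Proof. by move=> z; rewrite in_fset0. Qed.

Lemma paired_sets_proper : ProperFilter (@paired_sets R).
Proof.
apply: filter_from_proper; last by move=> A pA; exists A; split.
apply: filter_from_filter; first by exists fset0.
move=> A B pA pB; exists (A `|` B)%fset.
  move=> z; rewrite !in_fsetU => /orP[zA|zB].
    by have [nz ->] := pA z zA; split.
  by have [nz ->] := pB z zB; rewrite orbT; split.
move=> D [pD sD]; split; split=> //; apply: fsubset_trans sD; [exact: fsubsetUl|exact: fsubsetUr].
Qed.

Lemma sum_over_zeros_eq (f : C -> C) (L : C) :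
  (forall e : R, 0 < e -> exists2 A : {fset R[i]^o}, paired A & forall B : {fset R[i]^o},
     paired B -> (A `<=` B)%fset -> cabs (\sum_(z <- B) f z *+ zmult z - L) < e) ->
  sum_over_zeros (f : R[i]^o -> R[i]^o) = L.
Proof.
move=> h; have pf := paired_sets_proper.
apply/cvg_lim => //; apply/cvgCP => e e0.
have [A pA hA] := h e e0; exists A => // B [pB AB]; exact: hA.
Qed.

Lemma half_pow_le m n : (m <= n)%N -> (2 ^+ n)^-1 <= (2 ^+ m)^-1 :> R.
Proof.
by move=> mn; rewrite lef_pV2 ?posrE ?exprn_gt0// ler_weXn2l// ler1n.
Qed.

Lemma mulf_div4 (q e : R) : q != 0 -> q * (e / (4 * q)) = e / 4.
Proof. by move=> q0; field. Qed.

Variables x t : R.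
Hypotheses (x1 : 1 < x) (t0 : 0 < t).

Section Fixed.
Variables (k K K1 K2 d : R) (Z : nat -> seq C).
Hypotheses (K0 : 0 < K) (K10 : 0 < K1) (d0 : 0 < d).
Hypothesis hZ : forall j, uniq (Z j) /\
  forall z, (z \in Z j) <-> [/\ xi z = 0, cabs (z - 1) <= 4 ^+ j & cabs z <= 4 ^+ j].
Hypothesis hS : forall j, (3 <= j)%N -> cabs (\sum_(z <- Z j) (zmult z)%:R / z - k%:C) <= K / 2 ^+ j.
Hypothesis hT : forall B j, zeros B -> (forall z, z \in B -> 4 ^+ j < cabs (z - 1)) -> msum B <= K1 / 2 ^+ j.
Hypothesis hB : forall B : seq C, zeros B -> msum B <= K2.
Hypothesis hd : forall z : C, xi z = 0 -> d <= cabs (z - 1).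
Hypothesis xtd : 64 * (x * t) <= d.

Let a : R := x * t.
Let a0 : 0 < a. Proof. by rewrite mulr_gt0// (lt_trans ltr01). Qed.

Let zfar z : xi z = 0 -> 64 * (x * t) <= cabs z.
Proof.
move=> z0; apply: le_trans xtd _; have := hd (xi_zero_sym z0).
by rewrite addrAC subrr sub0r cabsN.
Qed.

Let Zzeros j : zeros (Z j).
Proof. by split=> [|z /(hZ j).2[]//]; exact: (hZ j).1. Qed.

Let Zsym j z : z \in Z j -> 1 - z \in Z j.
Proof.
move/(hZ j).2 => [z0 h1 h2]; apply/(hZ j).2; split; first exact: xi_zero_sym.
  by rewrite addrAC subrr sub0r cabsN.
by rewrite cabs_subC.
Qed.

Let Zconj j z : z \in Z j -> cj z \in Z j.
Proof.
move/(hZ j).2 => [z0 h1 h2]; apply/(hZ j).2; split; first exact: xi_zero_conj.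
  by rewrite -(cj1 R) -cjB cabs_conj.
by rewrite cabs_conj.
Qed.

Let D : R := Cst R * a ^+ 2 + a.
Let D0 : 0 < D. Proof. by rewrite ltr_wpDl// mulr_ge0 ?sqr_ge0 /Cst. Qed.

(* The zeros outside [Z j.+1] satisfy [|z - 1| > 4 ^ j]. *)
Let far_sum (B : seq C) j : zeros B -> (forall z, z \in B -> 1 - z \in B) ->
  (forall z, z \in B -> z \notin Z j.+1) -> cabs (tsum x t B) <= D * (K1 / 2 ^+ j).
Proof.
move=> zB sB nB; apply: le_trans (tsum_bound x1 t0 zB sB (fun z zin => zfar (zB.2 z zin))) _.
rewrite ler_wpM2l ?(ltW D0)//; apply: hT => // z zin; rewrite ltNge; apply/negP => h.
have p1 : 1 <= 4 ^+ j :> R by rewrite exprn_ege1//; lra.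
have := nB z zin; move/negP; apply; apply/(hZ j.+1).2; rewrite exprS; split; [exact: zB.2|lra|].
by rewrite -[z](subrK 1); apply: le_trans (cabsD _ _) _; rewrite cabs1; lra.
Qed.

(** The zeros of [B] outside [Z j.+1] are again stable under [z |-> 1 - z], so [far_sum] applies to
    them. This is the Cauchy property for sums over paired sets. *)
Let sum_diff (B : seq C) j : zeros B -> (forall z, z \in B -> 1 - z \in B) ->
  (forall z, z \in Z j.+1 -> z \in B) -> cabs (tsum x t B - tsum x t (Z j.+1)) <= D * (K1 / 2 ^+ j).
Proof.
move=> zB sB ZB.
have -> : tsum x t B - tsum x t (Z j.+1) = tsum x t [seq z <- B | z \notin Z j.+1].
  have pe : perm_eq [seq z <- B | z \in Z j.+1] (Z j.+1).
    apply: uniq_perm; [exact/filter_uniq/zB.1|exact: (hZ j.+1).1|].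
    by move=> z; rewrite mem_filter; apply: andb_idr; exact: ZB.
  have e1 : tsum x t B = tsum x t [seq z <- B | z \in Z j.+1] + tsum x t [seq z <- B | z \notin Z j.+1].
    by rewrite /tsum (bigID (mem (Z j.+1)))/= !big_filter.
  have e2 : tsum x t [seq z <- B | z \in Z j.+1] = tsum x t (Z j.+1) by exact: perm_big.
  by rewrite e1 e2 addrAC subrr add0r.
apply: far_sum; first exact: zeros_filter.
- move=> z; rewrite !mem_filter => /andP[h1 /sB ->]; rewrite andbT.
  by apply: contra h1 => /Zsym; rewrite subKr.
- by move=> z; rewrite mem_filter => /andP[].
Qed.

Let lim_ex : exists2 L : C, clim (fun j => tsum x t (Z j.+1)) L &
  forall j, cabs (L - tsum x t (Z j.+1)) <= D * (K1 / 2 ^+ j).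
Proof.
apply: (clim_cauchy (b := fun j => D * (K1 / 2 ^+ j))).
  move=> m n mn; apply: sum_diff => //; first exact: Zsym.
  move=> z /(hZ m.+1).2[z0 h1 h2]; apply/(hZ n.+1).2.
  have p : 4 ^+ m.+1 <= 4 ^+ n.+1 :> R by rewrite ler_weXn2l//; lra.
  by split=> //; [exact: le_trans p|exact: le_trans p].
rewrite -(mulr0 D) -[X in D * X](mulr0 K1).
apply: cvgM; first exact: cvg_cst.
apply: cvgM; first exact: cvg_cst.
rewrite (_ : (fun n => _) = (fun n => 2^-1 ^+ n)); last by apply/funext => n; rewrite exprVn.
by apply: cvg_expr; rewrite ger0_norm//; lra.
Qed.

(** Paired sets are not assumed stable under conjugation; reality is therefore proved on the lists
    [Z j] and inherited by the limit. *)
Let ImZ j : complex.Im (tsum x t (Z j)) = 0.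
Proof.
have h : cj (tsum x t (Z j)) = tsum x t (Z j).
  have ci : involutive (@conjc R) by exact: conjcK.
  rewrite -[RHS](perm_big _ (perm_invol ci (hZ j).1 (@Zconj j))) big_map /tsum.
  apply: (etrans (rmorph_sum (@conjc R) _ _ _)); apply: eq_big_seq => z /(hZ j).2[z0 _ _].
  rewrite zmult_conj// term_conj//; first exact: (rmorphMn (@conjc R)).
  apply: le_trans (zfar z0); rewrite ler_wpM2l// ler_peMl// ltW //.
move: h; case: (tsum x t (Z j)) => p q /= [h]; lra.
Qed.

Let ReZ j : (3 <= j)%N ->
  complex.Re (tsum x t (Z j)) <= - (a * k) + a * (K / 2 ^+ j) + Cst R * a ^+ 2 * K2.
Proof.
move=> j3; have h := tsum_split x1 t0 (Zzeros j) (@Zsym j) (fun z zin => zfar ((Zzeros j).2 z zin)).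
have h2 := hS j3; set S := \sum_(z <- Z j) _ / z in h h2; set T := tsum _ _ _ in h *.
have e1 : complex.Re (T + (x * t)%:C * S) <= Cst R * a ^+ 2 * K2.
  apply: le_trans (ler_norm _) _; apply: le_trans (cabs_Re _) _; apply: le_trans h _.
  by rewrite ler_wpM2l ?hB//; rewrite mulr_ge0 ?sqr_ge0 /Cst.
have e2 : - complex.Re S <= - k + K / 2 ^+ j.
  have : complex.Re (k%:C - S) <= K / 2 ^+ j.
    by apply: le_trans (ler_norm _) _; apply: le_trans (cabs_Re _) _; rewrite cabs_subC.
  by rewrite ReB /=; lra.
have e3 : complex.Re ((x * t)%:C * S) = a * complex.Re S by case: (S) => p q /=; rewrite mul0r subr0.
rewrite ReD e3 in e1; have := ler_wpM2l (ltW a0) e2; lra.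
Qed.

(** With [a = x t], the main term [- a k] has to beat the error [Cst a^2 K2]; dividing by [a] gives
    the hypothesis. *)
Lemma sum_neg : Cst R * a * K2 < k -> sum_over_zeros (term x t : R[i]^o -> R[i]^o) < 0.
Proof.
move=> ak; have [L _ hL] := lim_ex.
have b_lim (e : R) : 0 < e -> exists j, 2 * (D * (K1 / 2 ^+ j)) < e.
  move=> e0; have c0 : 0 < 2 * (D * K1) by rewrite !mulr_gt0.
  have [N hN] := half_pow_lt (divr_gt0 e0 c0).
  exists N; move: hN; rewrite ltr_pdivlMr// => hN.
  by rewrite (_ : 2 * _ = (2 ^+ N)^-1 * (2 * (D * K1)))//; ring.
have -> : sum_over_zeros (term x t : R[i]^o -> R[i]^o) = L.
  apply: sum_over_zeros_eq => e e0; have [j hj] := b_lim e e0.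
  have ZE : forall z : R[i]^o, (z \in [fset z in Z j.+1]%fset) = (z \in Z j.+1) by move=> z; rewrite inE.
  exists [fset z in Z j.+1]%fset.
    move=> z; rewrite !ZE => zin; split; last exact: Zsym.
    by apply/nontrivial_zeroE; exact: (Zzeros j.+1).2.
  move=> B pB /fsubsetP sB.
  have zB : zeros (B : seq C).
    by split=> [|z /pB[/nontrivial_zeroE]//]; exact: fset_uniq.
  have h1 : cabs (tsum x t B - tsum x t (Z j.+1)) <= D * (K1 / 2 ^+ j).
    apply: sum_diff => // [z /pB[]//|z zin]; apply: sB; by rewrite ZE.
  apply: le_lt_trans hj; rewrite -/(tsum x t B).
  rewrite (_ : _ - L = (tsum x t B - tsum x t (Z j.+1)) - (L - tsum x t (Z j.+1))); last by ring.
  apply: le_trans (cabsB _ _) _; have := hL j; lra.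
have ImL : complex.Im L = 0.
  apply/eqP/negPn/negP => iL; have [j hj] := b_lim `|complex.Im L| (ltac:(by rewrite normr_gt0)).
  have := le_trans (cabs_Im _) (hL j); rewrite ImB ImZ subr0.
  have : 0 <= D * (K1 / 2 ^+ j) by rewrite mulr_ge0 ?(ltW D0)// divr_ge0 ?(ltW K10)// exprn_ge0.
  lra.
have ReL : complex.Re L < 0.
  (* The margin left by the hypothesis; [j] is taken so large that the truncation error and the
     defect in [hS] use up only part of it. *)
  pose e := a * (k - Cst R * a * K2).
  have e0 : 0 < e by rewrite mulr_gt0// subr_gt0.
  have [j1 hj1] := b_lim e e0.
  have aK : 0 < a * K := mulr_gt0 a0 K0.
  have c0 : 0 < 4 * (a * K) by rewrite mulr_gt0.
  have [j2 hj2] := half_pow_lt (divr_gt0 e0 c0).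
  have [j [l1 l2 j3]] : exists j, [/\ (j1 <= j)%N, (j2 <= j.+1)%N & (3 <= j.+1)%N].
    by exists (j1 + j2 + 3)%N; clear; split; lia.
  have i1 : (2 ^+ j)^-1 <= (2 ^+ j1)^-1 :> R by exact: half_pow_le.
  have i2 : (2 ^+ j.+1)^-1 <= (2 ^+ j2)^-1 :> R by exact: half_pow_le.
  have r1 : complex.Re L - complex.Re (tsum x t (Z j.+1)) <= D * (K1 / 2 ^+ j).
    by rewrite -ReB; apply: le_trans (ler_norm _) _; apply: le_trans (cabs_Re _) (hL j).
  have r2 := ReZ j3.
  have r3 : D * (K1 / 2 ^+ j) <= D * (K1 / 2 ^+ j1).
    by apply: ler_wpM2l (ltW D0) _ _ _; exact: ler_wpM2l (ltW K10) _ _ i1.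
  have r4 : a * (K / 2 ^+ j.+1) <= e / 4.
    have := ler_wpM2l (ltW aK) (le_trans i2 (ltW hj2)).
    have aKn : a * K != 0 by rewrite gt_eqF.
    by rewrite [a * (K / _)]mulrA mulf_div4.
  have eE : e = a * k - Cst R * a ^+ 2 * K2 by rewrite /e; ring.
  rewrite eE in hj1 r4 e0; lra.
by rewrite ltcE /= ImL ReL eqxx.
Qed.

End Fixed.

End Limit.

Theorem theorem5p5 (R : realType) :
  exists tau0 x0 : R, [/\ 0 < tau0, 0 < x0 &
    forall x tau : R, x0 < x -> x < tau0 / tau -> F x tau < 0].
Proof.
have [k [K [k0 K0 hS]]] := zeros_sum R.
have [Z hZ] := zeros_list R.
have [K1 K10 hT] := msum_tail R; have [K2 K20 hB] := msum_bound R.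
have [d d0 hd] := zeros_away1 R.
have C0 : 0 < Cst R by rewrite /Cst; lra.
(* Zeros keep distance [d] from 1 and, by symmetry, from 0, so [d / 64] ensures [64 x tau <= |z|]
   for all of them; the second entry yields the hypothesis of [sum_neg], and [x0 = 1] the bound
   [1 < x] of [term_est]. *)
exists (Num.min (d / 64) (k / (Cst R * K2))), 1; split=> //.
  by rewrite lt_min !divr_gt0// mulr_gt0.
set m := Num.min _ _.
have m0 : 0 < m by rewrite lt_min !divr_gt0// mulr_gt0.
move=> x tau x1 xt.
have t0 : 0 < tau.
  rewrite -invr_gt0; have : 0 < m / tau by apply: lt_trans xt; exact: lt_trans x1.
  by rewrite pmulr_rgt0.
have xm : x * tau < m by rewrite -ltr_pdivlMr.
have [xd xk] : x * tau < d / 64 /\ x * tau < k / (Cst R * K2).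
  by split; apply: lt_le_trans xm _; rewrite ge_min lexx ?orbT.
have h : sum_over_zeros (term x tau : R[i]^o -> R[i]^o) < 0.
  apply: (@sum_neg R x tau x1 t0 k K K1 K2 d Z) => //.
  - by move=> j; apply: hS.
  - by lra.
  - by move: xk; rewrite ltr_pdivlMr ?mulr_gt0//; lra.
rewrite /F; have -> : (tau%:C)^-1 = (tau^-1)%:C by rewrite fmorphV.
by rewrite pmulr_rlt0// ltcR invr_gt0.
Qed.
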